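(* Let $\xi_1,\dots,\xi_n$ be independent non-degenerate real random variables with $\mathbf{E}\xi_i=0$ for all $i$. Assume that $|\xi_i|\le1$ for all $1\le i\le n$. For $x\ge0$ put $$t=\frac{x}{\sigma}\exp\left\{\frac{e\,x^2}{2\sigma^2}\right\},\qquad c_x=\frac{2.24\,e^{t^2/2}}{\sqrt{1-t}}+\frac{e^{t+t^2}}{\sqrt{\pi}\,(1-t)}\quad(t<1).$$ Then for all $0\le x\le0.606\,\sigma$ there is a real number $\theta$ with $|\theta|\le1$ (depending on $x$ and on the distribution of the $\xi_i$) such that $$\mathbf{P}(S_n>x\sigma)=\left(\Theta(x)+\theta\,\frac{c_x}{\sigma}\right)\inf_{\lambda\ge0}\mathbf{E}e^{\lambda(S_n-x\sigma)}.$$ In particular, for all $x\ge0$, $$\mathbf{P}(S_n>x\sigma)\le\left(\Big(\Theta(x)+\frac{c_x}{\sigma}\Big)\wedge1\right)H_n(x,\sigma),$$ where, for $x$ such that $t\ge1$, $c_x$ is read as $+\infty$ (so that the factor in front of $H_n(x,\sigma)$ equals $1$). Moreover, if $0\le x\le0.1\,\sigma$, then $c_x\le3.08$.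
   Context: Notation: $S_n=\sum_{i=1}^n\xi_i$, $\sigma_i^2=\mathbf{E}\xi_i^2$, $\sigma^2=\sum_{i=1}^n\sigma_i^2$ with $\sigma>0$; $a\wedge b=\min\{a,b\}$; in the definition of $t$, the factor $e$ in the exponent is Euler's number. $\Phi(x)=\frac1{\sqrt{2\pi}}\int_{-\infty}^x e^{-s^2/2}\,ds$ and $\Theta(x)=(1-\Phi(x))\,e^{x^2/2}$. Hoeffding's bound: $H_n(x,\sigma)=\left\{\left(\frac{\sigma}{x+\sigma}\right)^{x\sigma+\sigma^2}\left(\frac{n}{n-x\sigma}\right)^{n-x\sigma}\right\}^{\frac{n}{n+\sigma^2}}\mathbf{1}_{\{x\le n/\sigma\}}$, with the convention $\left(\frac{n}{n-y}\right)^{n-y}=1$ when $y=n$. *)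

(* Defs.v *)
From HB Require Import structures.
From mathcomp Require Import all_boot all_order all_algebra.
From mathcomp Require Import all_classical all_reals all_analysis.

Set Implicit Arguments.
Unset Strict Implicit.
Unset Printing Implicit Defensive.

Import Order.TTheory GRing.Theory Num.Theory.
Import numFieldNormedType.Exports.

Local Open Scope classical_set_scope.
Local Open Scope ring_scope.

Definition mutually_independent (d : measure_display) (T : measurableType d)
    (R : realType) (P : probability T R) (I : finType) (X : I -> T -> R) : Prop :=
  forall (J : {set I}) (A : I -> set R),
    (forall i, measurable (A i)) ->
    P (\bigcap_(i in [set` J]) (X i @^-1` A i)) =
      (\prod_(i in J) P (X i @^-1` A i))%E.

Definition nondegenerate_rv (d : measure_display) (T : measurableType d)
    (R : realType) (P : probability T R) (X : T -> R) : Prop :=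
  ~ exists c : R, {ae P, forall w, X w = c}.

Definition partial_sum (T : Type) (R : realType) (n : nat)
    (X : 'I_n -> T -> R) : T -> R :=
  fun w => \sum_(i < n) X i w.

(* Square root of the sum of the second moments; [fine] loses nothing when
   the X i are essentially bounded. *)
Definition sigma_of (d : measure_display) (T : measurableType d)
    (R : realType) (P : probability T R) (n : nat) (X : 'I_n -> T -> R) : R :=
  Num.sqrt (\sum_(i < n) fine 'E_P[fun w => (X i w ^+ 2)%R]%E).

Definition inf_exp_moment (d : measure_display) (T : measurableType d)
    (R : realType) (P : probability T R) (S : T -> R) (a : R) : \bar R :=
  ereal_inf [set 'E_P[fun w => expR (lambda * (S w - a))%R]%E
            | lambda in [set l : R | 0 <= l]].

Section analytic_quantities.
Variable R : realType.
Implicit Types x s : R.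

Definition Phi x : R :=
  (Num.sqrt (2 * pi))^-1 *
  \int[lebesgue_measure]_(u in `]-oo, x]) expR (- (u ^+ 2 / 2)).

Definition Theta x : R := (1 - Phi x) * expR (x ^+ 2 / 2).

Definition t_of x s : R := x / s * expR (expR 1 * x ^+ 2 / (2 * s ^+ 2)).

Definition c_of x s : \bar R :=
  let t := t_of x s in
  if t < 1 then
    ((224 / 100) * expR (t ^+ 2 / 2) / Num.sqrt (1 - t)
     + expR (t + t ^+ 2) / (Num.sqrt pi * (1 - t)))%:E
  else +oo%E.

(* At n = x * s the second factor is 0 `^ 0 = 1 (since n / 0 = 0 and
   a `^ 0 = 1 for every a), which is the usual convention; the indicator
   makes the value 0 as soon as n / s < x. *)
Definition Hoeffding_bound (n : nat) x s : R :=
  ((s / (x + s)) `^ (x * s + s ^+ 2)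
   * (n%:R / (n%:R - x * s)) `^ (n%:R - x * s)) `^ (n%:R / (n%:R + s ^+ 2))
  * (x <= n%:R / s)%R%:R.

End analytic_quantities.

(* Main.v *)
Require Import Defs.
From HB Require Import structures.
From mathcomp Require Import all_boot all_order all_algebra.
From mathcomp Require Import all_classical all_reals all_analysis.
From mathcomp Require Import measurable_realfun ring lra.

(* Exponential tilting reduces the expansion to a normal approximation with an
   explicit constant. Let [lam >= 0] solve the saddlepoint equation
   [E (expR (lam * S) * (S - x * sigma)) = 0]; by convexity it minimizes the
   exponential moment. Let [s ^+ 2] be the variance of [S] under the tilted law
   and [a = lam * s]. The tail probability is the minimal exponential moment
   times the tilted mean of [h ((S - x * sigma) / s)], where [h w] is
   [expR (- (a * w))] for [w > 0] and [0] elsewhere, and whose Gaussian mean is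
   [Theta a].

   Stein's method is applied to [h] itself, with the exact solution [F] written
   in terms of the Mills ratio; [w * F w] is Lipschitz with constant [lip a].
   Since each tilted summand [u] lies in an interval of length 2 around its
   mean, replacing [u] by an independent copy moves the sum by at most [2 / s],
   and the increment [u * (f (c + u / s) - f c)] is compared pointwise with
   [u ^+ 2 / s] times the target, for a smoothed [f] with [f - F] nearly
   constant. This gives the error [(2 + 9 / 8 * lip a) / s].

   With [m_i] the tilted means, [`|xi_i| <= 1] forces
   [sigma_i ^+ 2 * (1 - expR (- lam)) <= m_i <= sigma_i ^+ 2 * (expR lam - 1)] and
   [`|s_i ^+ 2 - sigma_i ^+ 2| <= m_i], so that [s] and [a] are comparable to
   [sigma] and [x] up to factors depending on [x / sigma] only.

   For Hoeffding's factor, the convex function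
   [y |-> (1 - expR (- (l * y))) / y] is minorized by its tangent at
   [1 + sigma ^+ 2 / n] at all the points [1 - xi_i]; the first-order terms
   cancel in the product. *)

Set Implicit Arguments.
Unset Strict Implicit.
Unset Printing Implicit Defensive.

Import Order.TTheory GRing.Theory Num.Theory.
Import numFieldNormedType.Exports.

Local Open Scope classical_set_scope.
Local Open Scope ring_scope.

(** * The Mills ratio *)

(** The obstacle is numerical. At [t = 0] the admissible constant is [2.24 + 1 / sqrt pi], barely
    more than [2.803]. Smoothing the jump of [h] costs [2], so [0.803] is left for the Lipschitz
    term [9 / 8 * lip a] and for passing from [Theta a] to [Theta x]. The first is already about
    [0.705] at [a = 0]; the second vanishes there and grows like [a ^+ 2 / (1 + a ^+ 2)]. Both fit
    because [lip a] follows the decrease of [mills a], which is why the Lipschitz bound depends on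
    [a]. For [x > 0] the comparison of [s] with [sigma] costs powers of [(1 - r) ^ (- 1 / 2)], where
    [r = x / sigma]; the right-hand side has matching factors in [t], and [r <= t < 1] with
    [r <= 0.61] makes them sufficient. The independent copy decouples a summand from the sum: the
    target, evaluated at the resampled sum, is independent of [u ^+ 2], whose mean is then exactly
    the tilted variance. *)

Section gaussian_cdf.
Variable R : realType.
Implicit Types x y : R.
Let mu := @lebesgue_measure R.

Lemma normal_pdf01E x :
  normal_pdf 0 1 x = (Num.sqrt (2 * pi))^-1 * expR (- (x ^+ 2 / 2)).
Proof.
rewrite normal_pdfE ?oner_eq0// /normal_peak /normal_fun subr0 expr1n.
by rewrite mul1r -(mulr_natr pi) (mulrC pi) mulNr.
Qed.

Lemma Phi_normal_pdf x : Phi x = \int[mu]_(u in `]-oo, x]) normal_pdf 0 1 u.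
Proof.
rewrite /Phi -RintegralZl//=.
  by apply: eq_Rintegral => u _; rewrite normal_pdf01E.
have := @integrable_normal_pdf R 0 1.
move=> /(integrableS measurableT _ (@subsetT _ _)) - /(_ `]-oo, x]%classic).
move=> /(_ (measurable_itv _)) /(@integrableZl _ _ _ mu _ (measurable_itv _) (Num.sqrt (2 * pi))).
apply: eq_integrable => // u _; rewrite -EFinM normal_pdf01E mulrA divff ?mul1r//.
by rewrite sqrtr_eq0 -ltNge mulr_gt0// pi_gt0.
Qed.

Lemma Phi_normal_prob x : (Phi x)%:E = normal_prob 0 1 `]-oo, x].
Proof.
rewrite Phi_normal_pdf /Rintegral -[X in fine X]/(normal_prob 0 1 `]-oo, x]).
by rewrite fineK//; apply: fin_num_measure.
Qed.

Lemma Phi_le1 x : Phi x <= 1.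
Proof. by rewrite -lee_fin Phi_normal_prob; exact: probability_le1. Qed.

Lemma Phi_cvg1 (e : R) : 0 < e -> exists N : R, forall x, N <= x -> 1 - Phi x < e.
Proof.
move=> e0.
pose F (n : nat) := [set` `]-oo, n%:R : R]].
have FT : \bigcup_n F n = setT.
  rewrite -subTset => t _ /=; exists (Num.truncn t).+1 => //; rewrite /F /=.
  by rewrite in_itv/= ltW// truncnS_gt.
have : normal_prob 0 1 (F n) @[n --> \oo] --> normal_prob (0 : R) 1 (\bigcup_n F n).
  apply: nondecreasing_cvg_mu => //.
  - by move=> n; exact: measurable_itv.
  - by rewrite FT.
  move=> n m nm; apply/subsetPset => x /=; rewrite /F /= !in_itv/= => /le_trans.
  by apply; rewrite ler_nat.
rewrite FT probability_setT => /fine_cvgP[_] /cvgrPdist_lt /(_ _ e0) [N _ hN].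
exists N%:R => x Nx.
have {hN} := hN N (leqnn N); rewrite /= -Phi_normal_prob /= => hN.
apply: le_lt_trans (hN); apply: le_trans (ler_norm _); rewrite lerB//.
rewrite -lee_fin !Phi_normal_prob; apply: le_measure; rewrite ?inE//.
by apply: subitvPr.
Qed.

Lemma is_derive_Phi x :
  is_derive x (1 : R) (@Phi R) ((Num.sqrt (2 * pi))^-1 * expR (- (x ^+ 2 / 2))).
Proof.
have -> : @Phi R = fun x => \int[mu]_(u in `]-oo, x]) normal_pdf 0 1 u.
  by apply/funext => z; exact: Phi_normal_pdf.
have x1 : x < x + 1 by rewrite ltrDl.
have int1 : mu.-integrable [set` `]-oo, x + 1]] (EFin \o @normal_pdf R 0 1).
  by apply: integrableS (@integrable_normal_pdf R 0 1).
have [d1 d2] := @continuous_FTC1 R (normal_pdf 0 1) -oo%O x _ x1 int1 (ltNyr x)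
  (continuous_normal_pdf (m := 0) (oner_neq0 R) (x := x)).
by split => //; rewrite -derive1E d2 normal_pdf01E.
Qed.

Lemma Phi0 : Phi (0 : R) = 2^-1.
Proof.
have c := continuous_normal_pdf (m := 0) (oner_neq0 R).
have := ge0_symfun_integralT (@normal_pdf_ge0 R 0 1) c.
have -> : (\int[lebesgue_measure]_x (@normal_pdf R 0 1 x)%:E = 1)%E.
  exact: integral_normal_pdf.
have even : @normal_pdf R 0 1 =1 normal_pdf 0 1 \o -%R.
  by move=> z; rewrite /= !normal_pdf01E sqrrN.
move=> /(_ even).
rewrite -set_itvcy -integral_itv_obnd_cbnd; last first.
  by apply: measurable_funTS; apply/measurable_EFinP; apply: measurable_normal_pdf.
rewrite -[X in (2%:E * X)%E]/(normal_prob (0 : R) 1 `]0, +oo[) => half.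
have := probability_setT (@normal_prob R 0 1).
rewrite -(setUv `]-oo, (0:R)]%classic) setCitvl measureU//=; last first.
  by rewrite -setCitvl setICr.
rewrite -Phi_normal_prob.
move: half; have := fin_num_measure (normal_prob (0 : R) 1) _ (measurable_itv `]0, +oo[).
case: (normal_prob _ _ _) => // p _ /= [hp] [hq].
by lra.
Qed.
End gaussian_cdf.

Section calculus.
Variable R : realType.
Implicit Types f df : R -> R.

Lemma is_derive_continuous f x d : is_derive x (1 : R) f d -> {for x, continuous f}.
Proof.
by move=> [fx _]; exact/differentiable_continuous/derivable1_diffP.
Qed.

Lemma derive_ge0_le f df (a b : R) : a <= b ->
  (forall x, a <= x <= b -> is_derive x (1 : R) f (df x)) ->
  (forall x, a < x < b -> 0 <= df x) -> f a <= f b.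
Proof.
rewrite le_eqVlt => /predU1P[->//|ab] fd df0.
have fd' x : x \in `]a, b[ -> is_derive x (1 : R) f (df x).
  by rewrite in_itv/= => /andP[/ltW ? /ltW ?]; apply: fd; apply/andP.
have fc : {within `[a, b], continuous f}.
  apply: continuous_in_subspaceT => x; rewrite inE/= in_itv/= => /fd.
  exact: is_derive_continuous.
have [c] := MVT ab fd' fc.
rewrite in_itv/= => c_ab fE; rewrite -subr_ge0 fE mulr_ge0 ?df0//.
by rewrite subr_ge0 ltW.
Qed.

Lemma derive_le0_ge f df (a b : R) : a <= b ->
  (forall x, a <= x <= b -> is_derive x (1 : R) f (df x)) ->
  (forall x, a < x < b -> df x <= 0) -> f b <= f a.
Proof.
move=> ab fd df0; rewrite -lerN2.
apply: (@derive_ge0_le (fun x => - f x) (fun x => - df x)) => // x xab.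
- by have := fd _ xab => ?; exact: is_deriveN.
- by rewrite oppr_ge0 df0.
Qed.

(* The factor [expR (- (x ^+ 2 / 2))] turns the differential inequality into
   monotonicity, and the hypothesis at infinity fixes the sign. *)
Lemma gauss_ode_ge0 f df (c : R) :
  (forall x, c <= x -> is_derive x (1 : R) f (df x)) ->
  (forall x, c <= x -> df x <= x * f x) ->
  (forall e, 0 < e -> exists N : R, forall y, N <= y ->
     - e < expR (- (y ^+ 2 / 2)) * f y) ->
  forall x, c <= x -> 0 <= f x.
Proof.
move=> fd dfle lim x cx; rewrite leNgt; apply/negP => fx0.
have e0 : 0 < - (expR (- (x ^+ 2 / 2)) * f x).
  by rewrite oppr_gt0 pmulr_rlt0// expR_gt0.
have [N /(_ (Num.max N x))] := lim _ e0.
rewrite le_max lexx opprK => /(_ isT).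
apply/negP; rewrite -leNgt.
pose g y := expR (- (y ^+ 2 / 2)) * f y.
apply: (@derive_le0_ge g (fun y => expR (- (y ^+ 2 / 2)) * (df y - y * f y))).
- by rewrite le_max lexx orbT.
- move=> y /andP[xy _]; have fy := fd _ (le_trans cx xy).
  apply: is_derive_eq; rewrite /GRing.scale/=.
  by field.
- move=> y /andP[/ltW xy _]; rewrite pmulr_rle0 ?expR_gt0// subr_le0.
  exact/dfle/(le_trans cx).
Qed.

Lemma gauss_decay (C e : R) : 0 <= C -> 0 < e ->
  exists N : R, forall y, N <= y -> expR (- (y ^+ 2 / 2)) * C < e.
Proof.
move=> C0 e0; exists (1 + 2 * C / e) => y Ny.
rewrite expRN mulrC ltr_pdivrMr ?expR_gt0//.
have Ce : 0 <= C / e by rewrite divr_ge0// ltW.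
apply: (@lt_le_trans _ _ (e * (y ^+ 2 / 2))).
  rewrite -ltr_pdivrMl// (mulrC e^-1).
  have : 2 * (C / e) + 1 <= y by rewrite addrC mulrA.
  nra.
rewrite ler_pM2l//; apply: le_trans (expR_ge1Dx _); lra.
Qed.
End calculus.

(* Locked: unification would otherwise unfold it down to the integral in
   [Phi]. *)
HB.lock Definition mills (R : realType) (x : R) : R := Num.sqrt (2 * pi) * Theta x.

Section mills.
Variable R : realType.
Local Notation mills := (@mills R).
Implicit Types x y : R.

Lemma sqrt2pi_gt0 : 0 < Num.sqrt (2 * pi) :> R.
Proof. by rewrite sqrtr_gt0 mulr_gt0// pi_gt0. Qed.

Lemma mills_gauss x :
  expR (- (x ^+ 2 / 2)) * mills x = Num.sqrt (2 * pi) * (1 - Phi x).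
Proof.
rewrite mills.unlock /Theta mulrCA; congr (_ * _).
by rewrite mulrCA -expRD addNr expR0 mulr1.
Qed.

Lemma mills_ge0 x : 0 <= mills x.
Proof.
by rewrite mills.unlock /Theta !mulr_ge0 ?expR_ge0 ?sqrtr_ge0// subr_ge0 Phi_le1.
Qed.

Lemma is_derive_mills x : is_derive x (1 : R) mills (x * mills x - 1).
Proof.
rewrite mills.unlock /Theta; have := is_derive_Phi x => dPhi.
apply: is_derive_eq; rewrite /GRing.scale/=.
rewrite expRN; field.
by rewrite gt_eqF ?expR_gt0//= gt_eqF// sqrt2pi_gt0.
Qed.

Lemma mills0 : mills 0 = Num.sqrt (2 * pi) / 2.
Proof. by rewrite mills.unlock /Theta Phi0 expr0n/= mul0r expR0; field. Qed.

(** Since [Phi 0 = 1 / 2], the constant [Num.sqrt (2 * pi)] equals [2 * mills 0]. In this form the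
    Gaussian integral is gone, and the Stein solution can be handled through [mills] alone. *)
Lemma ThetaE x : Theta x = mills x / (2 * mills 0).
Proof.
rewrite mills0 mills.unlock; have := sqrt2pi_gt0 => s0.
by field; rewrite gt_eqF.
Qed.

Lemma mills0_gt0 : 0 < mills 0.
Proof. by rewrite mills0 divr_gt0// sqrt2pi_gt0. Qed.

(** [mills_gauss] turns the weighted Mills ratio into a multiple of the normal tail, which vanishes
    at infinity. This supplies the last hypothesis of [gauss_ode_ge0] for functions containing
    [- mills]. *)
Lemma mills_tail (C e : R) : 0 <= C -> 0 < e -> exists N : R, forall y, N <= y ->
  expR (- (y ^+ 2 / 2)) * (mills y * C) < e.
Proof.
move=> C0 e0; have s0 := sqrt2pi_gt0.
have e'0 : 0 < e / (Num.sqrt (2 * pi) * (C + 1)).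
  by rewrite divr_gt0// mulr_gt0// ltr_wpDl.
have [N hN] := Phi_cvg1 e'0; exists N => y /hN.
rewrite ltr_pdivlMr => [h|]; last by rewrite mulr_gt0// ltr_wpDl.
rewrite mulrA mills_gauss; apply: le_lt_trans h.
have : 0 <= Num.sqrt (2 * pi) * (1 - Phi y).
  by rewrite mulr_ge0 ?subr_ge0 ?Phi_le1// ltW.
lra.
Qed.

(** [x^-1], [x / (1 + x ^+ 2)] and [(x ^+ 2 + 2) / (x ^+ 3 + 3 * x)] are the first convergents of
    Laplace's continued fraction [1 / (x + 1 / (x + 2 / (x + ...)))]. Each difference [f] to [mills]
    solves [f' = y * f] up to a negative defect, here [- 2 / (1 + y ^+ 2) ^+ 2], so [gauss_ode_ge0]
    applies. *)
Lemma mills_lower x : 0 <= x -> x / (1 + x ^+ 2) <= mills x.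
Proof.
move=> x0; rewrite -subr_ge0.
pose f y := mills y - y / (1 + y ^+ 2).
have y1 y : 0 < 1 + y ^+ 2 by rewrite ltr_pwDl// sqr_ge0.
rewrite -[leRHS]/(f x).
apply: (@gauss_ode_ge0 R f (fun y => y * mills y - 1 -
   (1 - y ^+ 2) / (1 + y ^+ 2) ^+ 2) 0 _ _ _ x x0) => [y _|y _|e e0].
- have := is_derive_mills y => ?.
  apply: is_deriveB; apply: is_derive_eq.
    apply: is_deriveM; apply: is_deriveV; exact: lt0r_neq0.
  rewrite /GRing.scale/=; field; exact: lt0r_neq0.
- rewrite /f -subr_ge0 [leRHS](_ : _ = 2 / (1 + y ^+ 2) ^+ 2).
    by rewrite divr_ge0// exprn_ge0// ltW.
  by field; exact: lt0r_neq0.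
have [N hN] := @gauss_decay R 1 _ ler01 e0.
exists N => y /hN h; rewrite /f.
have : y / (1 + y ^+ 2) <= 1 by rewrite ler_pdivrMr//; nra.
have := mills_ge0 y; rewrite ltrNl -mulrN => ? ?; apply: le_lt_trans h.
by rewrite ler_pM2l ?expR_gt0//; lra.
Qed.

Lemma mills_upper1 x : 0 < x -> mills x <= x^-1.
Proof.
move=> x0; rewrite -subr_ge0.
pose f y := y^-1 - mills y.
rewrite -[leRHS]/(f x).
apply: (@gauss_ode_ge0 R f (fun y => - (y ^- 2) - (y * mills y - 1)) x _ _ _ x (lexx x)) => [y xy|y xy|e e0].
- have y0 := lt_le_trans x0 xy.
  have := is_derive_mills y => ?.
  apply: is_deriveB; apply: is_derive_eq.
    apply: is_deriveV; exact: lt0r_neq0.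
  rewrite /GRing.scale/=; field; exact: lt0r_neq0.
- have y0 := lt_le_trans x0 xy.
  rewrite /f mulrBr divff ?lt0r_neq0// -subr_ge0.
  by rewrite [leRHS](_ : _ = y ^- 2) ?invr_ge0 ?sqr_ge0//; ring.
have [N hN] := @mills_tail 1 _ ler01 e0.
exists (Num.max N x) => y; rewrite ge_max => /andP[/hN h xy]; rewrite /f.
have : 0 < y^-1 by rewrite invr_gt0 (lt_le_trans x0).
move=> ?; rewrite ltrNl -mulrN; apply: le_lt_trans h.
by rewrite ler_pM2l ?expR_gt0//; lra.
Qed.

Lemma mills_upper2 x : 0 < x -> mills x <= (x ^+ 2 + 2) / (x ^+ 3 + 3 * x).
Proof.
move=> x0; rewrite -subr_ge0.
pose f y := (y ^+ 2 + 2) / (y ^+ 3 + 3 * y) - mills y.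
have y3 y : 0 < y -> y ^+ 3 + 3 * y != 0.
  by move=> y0; rewrite lt0r_neq0// addr_gt0// ?exprn_gt0 ?mulr_gt0.
rewrite -[leRHS]/(f x).
apply: (@gauss_ode_ge0 R f (fun y =>
   (2 * y * (y ^+ 3 + 3 * y) - (y ^+ 2 + 2) * (3 * y ^+ 2 + 3)) /
     (y ^+ 3 + 3 * y) ^+ 2  - (y * mills y - 1)) x _ _ _ x (lexx x)) => [y xy|y xy|e e0].
- have y0 := lt_le_trans x0 xy.
  have := is_derive_mills y => ?.
  apply: is_deriveB; apply: is_derive_eq.
    apply: is_deriveM; apply: is_deriveV; exact: y3.
  rewrite /GRing.scale/=; field.
  by have := y3 _ y0; rewrite exprSr -mulrDl mulf_eq0 negb_or => /andP[-> ->].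
- have y0 := lt_le_trans x0 xy.
  rewrite /f -subr_ge0.
  rewrite [leRHS](_ : _ = 6 / (y ^+ 3 + 3 * y) ^+ 2); first by rewrite divr_ge0// sqr_ge0.
  by field; have := y3 _ y0; rewrite exprSr -mulrDl mulf_eq0 negb_or => /andP[-> ->].
have [N hN] := @mills_tail 1 _ ler01 e0.
exists (Num.max N x) => y; rewrite ge_max => /andP[/hN h xy]; rewrite /f.
have y0 := lt_le_trans x0 xy.
have : 0 < (y ^+ 2 + 2) / (y ^+ 3 + 3 * y).
  apply: divr_gt0; first by rewrite ltr_wpDl// sqr_ge0.
  by rewrite addr_gt0 ?mulr_gt0 ?exprn_gt0.
move=> ?; rewrite ltrNl -mulrN; apply: le_lt_trans h.
by rewrite ler_pM2l ?expR_gt0//; lra.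
Qed.
End mills.

(** * Numerical bounds for [e] and [pi] from Taylor polynomials *)

Section numerics.
Variable R : realType.
Implicit Types x : R.

Lemma expR_ge_deg2 x : 0 <= x -> 1 + x + x ^+ 2 / 2 <= expR x.
Proof.
move=> x0; pose f (y : R) := expR y - (1 + y + y ^+ 2 / 2).
rewrite -subr_ge0 -[leRHS]/(f x) (_ : 0 = f 0); last first.
  by rewrite /f expR0; field.
apply: (@derive_ge0_le _ f (fun y => expR y - (1 + y)) _ _ x0) => y _.
  by apply: is_derive_eq; rewrite /GRing.scale/=; field.
by rewrite subr_ge0 expR_ge1Dx.
Qed.

Lemma expRN_le_deg2 x : 0 <= x -> expR (- x) <= 1 - x + x ^+ 2 / 2.
Proof.
move=> x0; pose f (y : R) := 1 - y + y ^+ 2 / 2 - expR (- y).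
rewrite -subr_ge0 -[leRHS]/(f x) (_ : 0 = f 0); last first.
  by rewrite /f oppr0 expR0; field.
apply: (@derive_ge0_le _ f (fun y => expR (- y) - (1 - y)) _ _ x0) => y _.
  by apply: is_derive_eq; rewrite /GRing.scale/=; field.
by rewrite subr_ge0 expR_ge1Dx.
Qed.

Lemma expRN_ge_deg3 x : 0 <= x ->
  1 - x + x ^+ 2 / 2 - x ^+ 3 / 6 <= expR (- x).
Proof.
move=> x0; pose f (y : R) := expR (- y) - (1 - y + y ^+ 2 / 2 - y ^+ 3 / 6).
rewrite -subr_ge0 -[leRHS]/(f x) (_ : 0 = f 0); last first.
  by rewrite /f oppr0 expR0; field.
apply: (@derive_ge0_le _ f (fun y => (1 - y + y ^+ 2 / 2) - expR (- y)) _ _ x0) => y.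
  by move=> _; apply: is_derive_eq; rewrite /GRing.scale/=; field.
by move=> /andP[/ltW y0 _]; rewrite subr_ge0 expRN_le_deg2.
Qed.

Lemma expR1_bounds : 27 / 10 <= expR (1 : R) <= 272 / 100.
Proof.
(* At [1 / 8] Taylor polynomials of degree 2 and 3 are accurate enough; the eighth power carries the
   bounds over to [1]. *)
have e8 : expR (1 : R) = expR (1 / 8) ^+ 8.
  by rewrite -expRM_natl; congr expR; field.
have h8 : 0 <= 1 / 8 :> R by lra.
apply/andP; split.
  rewrite e8; apply: le_trans (_ : (1 + 1 / 8 + (1 / 8) ^+ 2 / 2) ^+ 8 <= _).
    lra.
  by rewrite lerXn2r ?nnegrE ?expR_ge0 ?expR_ge_deg2//; lra.
have : (1 - 1 / 8 + (1 / 8) ^+ 2 / 2 - (1 / 8) ^+ 3 / 6) ^+ 8 <= expR (- 1 : R).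
  have -> : expR (- 1 : R) = expR (- (1 / 8)) ^+ 8.
    by rewrite -expRM_natl; congr expR; field.
  rewrite lerXn2r ?nnegrE ?expR_ge0 ?expRN_ge_deg3//; lra.
rewrite expRN => h; have c0 : 0 < 272 / 100 :> R by lra.
have : (272 / 100)^-1 <= (expR 1)^-1 :> R.
  by apply: le_trans h; rewrite invf_div; lra.
by rewrite lef_pV2 ?posrE ?expR_gt0 ?c0.
Qed.

Lemma sin_le_deg1 x : 0 <= x -> sin x <= x.
Proof.
move=> x0; pose f (y : R) := y - sin y.
rewrite -subr_ge0 -[leRHS]/(f x) (_ : 0 = f 0); last first.
  by rewrite /f sin0; field.
apply: (@derive_ge0_le _ f (fun y => 1 - cos y) _ _ x0) => y _.
by rewrite subr_ge0 cos_le1.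
Qed.

Lemma cos_ge_deg2 x : 0 <= x -> 1 - x ^+ 2 / 2 <= cos x.
Proof.
move=> x0; pose f (y : R) := cos y - (1 - y ^+ 2 / 2).
rewrite -subr_ge0 -[leRHS]/(f x) (_ : 0 = f 0); last first.
  by rewrite /f cos0; field.
apply: (@derive_ge0_le _ f (fun y => y - sin y) _ _ x0) => y.
  by move=> _; apply: is_derive_eq; rewrite /GRing.scale/=; field.
by move=> /andP[/ltW y0 _]; rewrite subr_ge0 sin_le_deg1.
Qed.

Lemma sin_ge_deg3 x : 0 <= x -> x - x ^+ 3 / 6 <= sin x.
Proof.
move=> x0; pose f (y : R) := sin y - (y - y ^+ 3 / 6).
rewrite -subr_ge0 -[leRHS]/(f x) (_ : 0 = f 0); last first.
  by rewrite /f sin0; field.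
apply: (@derive_ge0_le _ f (fun y => cos y - (1 - y ^+ 2 / 2)) _ _ x0) => y.
  by move=> _; apply: is_derive_eq; rewrite /GRing.scale/=; field.
by move=> /andP[/ltW y0 _]; rewrite subr_ge0 cos_ge_deg2.
Qed.

Lemma cos_le_deg4 x : 0 <= x -> cos x <= 1 - x ^+ 2 / 2 + x ^+ 4 / 24.
Proof.
move=> x0; pose f (y : R) := 1 - y ^+ 2 / 2 + y ^+ 4 / 24 - cos y.
rewrite -subr_ge0 -[leRHS]/(f x) (_ : 0 = f 0); last first.
  by rewrite /f cos0; field.
apply: (@derive_ge0_le _ f (fun y => sin y - (y - y ^+ 3 / 6)) _ _ x0) => y.
  by move=> _; apply: is_derive_eq; rewrite /GRing.scale/=; field.
by move=> /andP[/ltW y0 _]; rewrite subr_ge0 sin_ge_deg3.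
Qed.

Lemma sin_le_deg5 x : 0 <= x -> sin x <= x - x ^+ 3 / 6 + x ^+ 5 / 120.
Proof.
move=> x0; pose f (y : R) := y - y ^+ 3 / 6 + y ^+ 5 / 120 - sin y.
rewrite -subr_ge0 -[leRHS]/(f x) (_ : 0 = f 0); last first.
  by rewrite /f sin0; field.
apply: (@derive_ge0_le _ f (fun y => (1 - y ^+ 2 / 2 + y ^+ 4 / 24) - cos y) _ _ x0) => y.
  by move=> _; apply: is_derive_eq; rewrite /GRing.scale/=; field.
by move=> /andP[/ltW y0 _]; rewrite subr_ge0 cos_le_deg4.
Qed.

(** With [c] and [s] the cosine and sine at [pi / 6], the addition formulas give
    [0 = cos (pi / 2) = c * (1 - 4 * s ^+ 2)], and both are positive. *)
Lemma sin_pi6 : sin (pi / 6 : R) = 1 / 2.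
Proof.
have p2 := @pi_ge2 R.
have c0 : 0 < cos (pi / 6 : R) by rewrite cos_gt0_pihalf//; lra.
have s0 : 0 < sin (pi / 6 : R) by rewrite sin_gt0_pihalf//; lra.
have : cos (pi / 2 : R) = 0 by exact: cos_pihalf.
have -> : pi / 2 = pi / 6 + (pi / 6 + pi / 6) :> R by field.
rewrite !cosD sinD => h; have := cos2Dsin2 (pi / 6 : R) => h2.
move: h; set c := cos _ in c0 h2 *; set s := sin _ in s0 h2 *.
have -> : c * (c * c - s * s) - s * (s * c + c * s) = c * (1 - 4 * s ^+ 2).
  rewrite (_ : 1 - 4 * s ^+ 2 = c ^+ 2 - 3 * s ^+ 2); [ring | lra].
move/eqP; rewrite mulf_eq0 (gt_eqF c0)/= => /eqP h.
have : (1 - 2 * s) * (1 + 2 * s) = 0 by rewrite -[RHS]h; ring.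
move/eqP; rewrite mulf_eq0 => /orP[/eqP|/eqP]; lra.
Qed.

(** The sine is inverted at [pi / 6]: Taylor polynomials give [sin 0.52 < 1 / 2 < sin 0.525]. *)
Lemma pi_bounds : 312 / 100 <= (pi : R) <= 315 / 100.
Proof.
have p2 := @pi_ge2 R.
have p3 := @pihalf_lt2 R.
have in6 : (pi / 6 : R) \in `[- (pi / 2), pi / 2] by rewrite in_itv/=; lra.
apply/andP; split.
  have : sin (52 / 100 : R) < sin (pi / 6).
    rewrite sin_pi6; apply: le_lt_trans (sin_le_deg5 _) _; lra.
  by rewrite ltr_sin// ?in_itv/=; lra.
have : sin (pi / 6) < sin (525 / 1000 : R).
  rewrite sin_pi6; apply: lt_le_trans (sin_ge_deg3 _); lra.
by rewrite ltr_sin// ?in_itv/=; lra.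
Qed.

Lemma sqrt2pi_bounds : 249 / 100 <= Num.sqrt (2 * pi : R) <= 251 / 100.
Proof.
have := pi_bounds => /andP[pl pu].
have s0 := @sqrt2pi_gt0 R; have p0 : 0 <= 2 * pi :> R by lra.
have := sqr_sqrtr p0; set s := Num.sqrt _ in s0 * => s2.
by apply/andP; split; rewrite leNgt; apply/negP => h; nra.
Qed.

End numerics.

(** * Stein's equation *)

(** Completing the square, this is [expR (w ^+ 2 / 2)] times the integral of
    [expR (- (a * u) - u ^+ 2 / 2)] over [u > w], the part of the Stein solution that comes from
    [h]. *)
HB.lock Definition tail_ratio (R : realType) (a w : R) : R :=
  expR (- (a * w)) * mills (w + a).

Section stein_solution.
Variable R : realType.
Implicit Types a w x y : R.

Local Notation mills := (@mills R).
Local Notation r0 := (mills 0).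

Lemma mills0_bounds : 1245 / 1000 <= r0 <= 1255 / 1000.
Proof. by have := @sqrt2pi_bounds R; rewrite mills0; lra. Qed.

Lemma mills_deriv_le0 x : 0 <= x -> x * mills x - 1 <= 0.
Proof.
rewrite le_eqVlt => /predU1P[<-|x0]; first by rewrite mul0r; lra.
by rewrite subr_le0 mulrC -ler_pdivlMr// mul1r mills_upper1.
Qed.

Lemma mills_deriv_ge x : 0 <= x -> - (1 + x ^+ 2)^-1 <= x * mills x - 1.
Proof.
move=> x0; have x1 : 0 < 1 + x ^+ 2 by rewrite ltr_pwDl// sqr_ge0.
have /(ler_wpM2l x0) := mills_lower x0.
have -> : x * (x / (1 + x ^+ 2)) = 1 - (1 + x ^+ 2)^-1.
  by field; exact: lt0r_neq0.
lra.
Qed.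

Lemma mills_nincr x y : 0 <= x -> x <= y -> mills y <= mills x.
Proof.
move=> x0 xy; apply: (@derive_le0_ge _ mills (fun z => z * mills z - 1) _ _ xy).
  by move=> z _; exact: is_derive_mills.
by move=> z /andP[/ltW xz _]; rewrite mills_deriv_le0// (le_trans x0).
Qed.

(* The second derivative of [mills], see [is_derive_mills]. *)
Definition mills2 w : R := (1 + w ^+ 2) * mills w - w.

Lemma mills2_ge0 w : 0 <= w -> 0 <= mills2 w.
Proof.
move=> w0; have w1 : 0 < 1 + w ^+ 2 by rewrite ltr_pwDl// sqr_ge0.
by have := mills_lower w0; rewrite ler_pdivrMr// mulrC /mills2; lra.
Qed.

(** The derivative of [mills2] is the third derivative of [mills], and its sign is exactly
    [mills_upper2]. *)
Lemma mills2_nincr x y : 0 <= x -> x <= y -> mills2 y <= mills2 x.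
Proof.
move=> x0 xy; apply: (@derive_le0_ge _ mills2
  (fun z => (z ^+ 3 + 3 * z) * mills z - (z ^+ 2 + 2)) _ _ xy) => z.
  move=> _; rewrite /mills2; have := is_derive_mills z => ?.
  by apply: is_derive_eq; rewrite /GRing.scale/=; ring.
move=> /andP[xz _]; have z0 : 0 < z by apply: le_lt_trans xz.
have z3 : 0 < z ^+ 3 + 3 * z by rewrite addr_gt0 ?exprn_gt0 ?mulr_gt0.
by rewrite subr_le0 mulrC -ler_pdivlMr// mills_upper2.
Qed.

Lemma mills2_le w : 0 <= w -> mills2 w <= r0.
Proof.
by move=> w0; apply: le_trans (mills2_nincr (lexx 0) w0) _; rewrite /mills2; lra.
Qed.

Lemma mills_ge_deg1 x : 0 <= x -> r0 - x <= mills x.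
Proof.
move=> x0; rewrite -subr_ge0.
pose f y := mills y - (r0 - y); rewrite -[leRHS]/(f x) (_ : 0 = f 0); last first.
  by rewrite /f; ring.
apply: (@derive_ge0_le _ f (fun y => y * mills y) _ _ x0) => y.
  move=> _; have := is_derive_mills y => ?.
  by apply: is_derive_eq; rewrite /GRing.scale/=; ring.
by move=> /andP[/ltW y0 _]; rewrite mulr_ge0 ?mills_ge0.
Qed.

Lemma mills_le_deg2 x : 0 <= x -> mills x <= r0 * (1 + x ^+ 2 / 2) - x.
Proof.
move=> x0; rewrite -subr_ge0.
have d1 y : 0 <= y -> y * mills y <= r0 * y.
  by move=> y0; rewrite mulrC ler_wpM2r// mills_nincr.
pose f y := r0 * (1 + y ^+ 2 / 2) - y - mills y.
rewrite -[leRHS]/(f x) (_ : 0 = f 0); last by rewrite /f; field.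
apply: (@derive_ge0_le _ f (fun y => r0 * y - y * mills y) _ _ x0) => y.
  move=> _; have := is_derive_mills y => ?.
  by apply: is_derive_eq; rewrite /GRing.scale/=; field.
by move=> /andP[/ltW y0 _]; rewrite subr_ge0 d1.
Qed.

Section fixed_a.
Variable a : R.
Hypothesis a0 : 0 <= a.
Variable nu : R.
Hypothesis nuE : nu = mills a / (2 * r0).

Local Notation rho := (tail_ratio a).

Lemma is_derive_tail_ratio w :
  is_derive w (1 : R) rho (w * rho w - expR (- (a * w))).
Proof.
rewrite tail_ratio.unlock; have := is_derive_mills (w + a) => ?.
by apply: is_derive_eq; rewrite /GRing.scale/=; ring.
Qed.

Lemma tail_ratio_ge0 w : 0 <= rho w.
Proof. by rewrite tail_ratio.unlock mulr_ge0 ?expR_ge0 ?mills_ge0. Qed.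

Lemma tail_ratio_le w : 0 <= w -> rho w <= r0.
Proof.
move=> w0; rewrite tail_ratio.unlock -[leRHS]mul1r ler_pM ?expR_ge0 ?mills_ge0//.
  by rewrite expR_le1 oppr_le0 mulr_ge0.
by rewrite mills_nincr// addr_ge0.
Qed.

Lemma nu_ge0 : 0 <= nu.
Proof. by rewrite nuE divr_ge0 ?mills_ge0// mulr_ge0// mills_ge0. Qed.

Lemma nu_mul : nu * r0 = mills a / 2.
Proof. by rewrite nuE; field; rewrite gt_eqF// mills0_gt0. Qed.

Lemma nu_le : nu <= 1 / 2.
Proof.
have m0 := @mills0_gt0 R.
rewrite -(ler_pM2r m0) nu_mul; have := mills_nincr (lexx 0) a0; lra.
Qed.

(* A bound for the derivative of [w |-> w * F w], where [F] is the Stein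
   solution [stein_F]. *)
Definition lip : R := mills a / 2 + (if a < 1 / 2 then 0 else 13 / 100).

Lemma lip_ge : mills a / 2 <= lip.
Proof. by rewrite /lip lerDl; case: ifP => _; lra. Qed.

(* The derivative of [w |-> w * stein_F w] for [w > 0]. *)
Definition dG w := nu * mills2 w - ((1 + w ^+ 2) * rho w - w * expR (- (a * w))).

(** Divided by [1 + w ^+ 2], the claim is [f w >= 0]. Here [f 0 = 0] and
    [f' = y * f + q y / (1 + y ^+ 2) ^+ 2], where [q] changes sign at most once, from positive to
    negative. Up to the change, [expR (- (y ^+ 2 / 2)) * f y] increases from [0]; beyond it,
    [gauss_ode_ge0] brings the sign back from infinity. *)
Lemma dG_ge w : 0 <= w -> - (mills a / 2) <= dG w.
Proof.
move=> w0.
pose E w := expR (- (a * w)) - nu.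
pose f w := (nu * r0 + w * E w) / (1 + w ^+ 2) - rho w + nu * mills w.
pose q w := 2 * E w - a * w * (1 + w ^+ 2) * expR (- (a * w))
            - nu * r0 * (w * (3 + w ^+ 2)).
have w1 y : 0 < 1 + y ^+ 2 by rewrite ltr_pwDl// sqr_ge0.
have fd y : is_derive y (1 : R) f (y * f y + q y / (1 + y ^+ 2) ^+ 2).
  have := is_derive_mills y => ?; have := is_derive_tail_ratio y => ?.
  have d1 : is_derive y (1 : R) (fun w => (1 + w ^+ 2)^-1) (- (2 * y) / (1 + y ^+ 2) ^+ 2).
    apply: is_derive_eq; first by apply: is_deriveV; exact: lt0r_neq0.
    by rewrite /GRing.scale/=; field; exact: lt0r_neq0.
  have dE : is_derive y (1 : R) E (- (a * expR (- (a * y)))).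
    by apply: is_derive_eq; rewrite /GRing.scale/=; ring.
  apply: is_derive_eq; rewrite /GRing.scale/= /q /f /E.
  field; exact: lt0r_neq0.
have f0 : f 0 = 0.
  rewrite /f /E mul0r expr0n/= !addr0 divr1.
  by rewrite tail_ratio.unlock mulr0 oppr0 expR0 mul1r add0r nu_mul; field.
(* If [q y > 0] then [2 - a * y * (1 + y ^+ 2) > 0]. On [[0, y]] the leading term of [q] is then a
   product of positive nonincreasing factors, while the subtracted terms are constant or
   nondecreasing. *)
have qmono u y : 0 <= u -> u <= y -> 0 < q y -> 0 < q u.
  move=> u0 uy; have y0 := le_trans u0 uy.
  have qE z : q z = expR (- (a * z)) * (2 - a * z * (1 + z ^+ 2)) - 2 * nu
              - nu * r0 * (z * (3 + z ^+ 2)) by rewrite /q /E; ring.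
  rewrite !qE.
  have n1 : 0 <= nu * r0 by rewrite nu_mul divr_ge0 ?mills_ge0.
  have n0 := nu_ge0.
  have u2 : u ^+ 2 <= y ^+ 2 by rewrite lerXn2r// nnegrE.
  have m1 : u * (3 + u ^+ 2) <= y * (3 + y ^+ 2).
    by apply: ler_pM => //; rewrite ?addr_ge0 ?sqr_ge0 ?lerD2l.
  have m2 : a * u * (1 + u ^+ 2) <= a * y * (1 + y ^+ 2).
    apply: ler_pM; rewrite ?mulr_ge0 ?addr_ge0 ?sqr_ge0 ?lerD2l//.
    exact: ler_wpM2l.
  have m3 : expR (- (a * y)) <= expR (- (a * u)) by rewrite ler_expR lerN2 ler_wpM2l.
  have m4 : nu * r0 * (u * (3 + u ^+ 2)) <= nu * r0 * (y * (3 + y ^+ 2)).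
    exact: ler_wpM2l.
  move=> qy.
  have m5 : 0 <= nu * r0 * (y * (3 + y ^+ 2)).
    by apply: mulr_ge0 => //; rewrite mulr_ge0 ?addr_ge0 ?sqr_ge0.
  have p0 : 0 < expR (- (a * y)) * (2 - a * y * (1 + y ^+ 2)) by lra.
  rewrite pmulr_rgt0 ?expR_gt0// in p0.
  have m6 : expR (- (a * y)) * (2 - a * y * (1 + y ^+ 2)) <=
            expR (- (a * u)) * (2 - a * u * (1 + u ^+ 2)).
    by apply: ler_pM; rewrite ?expR_ge0// ?(ltW p0)//; lra.
  lra.
have fge : 0 <= f w.
  have [qw|qw] := leP (q w) 0.
    apply: (@gauss_ode_ge0 R f (fun y => y * f y + q y / (1 + y ^+ 2) ^+ 2) w _ _ _ w (lexx w)).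
    - move=> y wy; rewrite gerDl pmulr_lle0; last by rewrite invr_gt0 exprn_gt0.
      by rewrite leNgt; apply/negP => /(qmono _ _ w0 wy); rewrite ltNge qw.
    move=> e e0; have r1 : 0 <= 1 + r0 by rewrite addr_ge0// mills_ge0.
    have [N hN] := gauss_decay r1 e0.
    exists (Num.max N w) => y; rewrite ge_max => /andP[/hN h wy].
    rewrite ltrNl -mulrN; apply: le_lt_trans h; rewrite ler_pM2l ?expR_gt0//.
    have y0 := le_trans w0 wy.
    have := tail_ratio_le y0; have := nu_ge0 => n0 hr.
    have : 0 <= nu * mills y by rewrite mulr_ge0 ?mills_ge0.
    have : - 1 <= (nu * r0 + y * E y) / (1 + y ^+ 2).
      rewrite ler_pdivlMr// mulN1r.
      have : 0 <= nu * r0 by rewrite mulr_ge0 ?mills_ge0.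
      have : 0 <= y * expR (- (a * y)) by rewrite mulr_ge0 ?expR_ge0.
      rewrite /E; have := nu_le; nra.
    by rewrite /f; lra.
  pose g y := expR (- (y ^+ 2 / 2)) * f y.
  have : g 0 <= g w.
    apply: (@derive_ge0_le _ g (fun y => expR (- (y ^+ 2 / 2)) * (q y / (1 + y ^+ 2) ^+ 2)) _ _ w0).
      move=> y _; have := fd y => ?; rewrite /g.
      by apply: is_derive_eq; rewrite /GRing.scale/=; field; exact: lt0r_neq0.
    move=> y /andP[/ltW y0 /ltW yw].
    rewrite mulr_ge0 ?expR_ge0// divr_ge0 ?sqr_ge0//.
    by rewrite ltW// (qmono _ _ y0 yw).
  by rewrite /g f0 mulr0 pmulr_rge0 ?expR_gt0.
have : rho w - nu * mills w <= (nu * r0 + w * E w) / (1 + w ^+ 2).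
  by move: fge; rewrite /f; set A := _ / _; lra.
rewrite ler_pdivlMr//.
rewrite /dG /mills2 -nu_mul /E; lra.
Qed.

(** [mills_lower] at [y = w + a] bounds [dG w] by [nu * mills2 w] plus a term with the sign of
    [w * y - 1]. When that term is positive, either [a < 1 / 2], which forces [w >= 3 / 4] and makes
    [mills2 w] small enough to absorb it, or it is at most [10 / 27 * 35 / 100 < 13 / 100], the
    extra constant in [lip]. *)
Lemma dG_le w : 0 <= w -> dG w <= lip.
Proof.
move=> w0; have n0 := nu_ge0; have w1 y : 0 < 1 + y ^+ 2 by rewrite ltr_pwDl// sqr_ge0.
pose y := w + a; have y0 : 0 <= y by rewrite addr_ge0.
have ge : - (expR (- (a * w)) * (a * (w * y - 1) / (1 + y ^+ 2))) <=
    (1 + w ^+ 2) * rho w - w * expR (- (a * w)).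
  rewrite tail_ratio.unlock -/y -mulrN.
  rewrite [leRHS](_ : _ = expR (- (a * w)) * ((1 + w ^+ 2) * mills y - w)); last by ring.
  rewrite ler_wpM2l ?expR_ge0// lerBrDr.
  apply: le_trans (_ : (1 + w ^+ 2) * (y / (1 + y ^+ 2)) <= _); last first.
    by rewrite ler_wpM2l ?mills_lower// ltW.
  rewrite le_eqVlt; apply/orP; left; apply/eqP; rewrite /y; field.
  exact: lt0r_neq0.
have dGle : dG w <= nu * mills2 w + expR (- (a * w)) * (a * (w * y - 1) / (1 + y ^+ 2)).
  by rewrite /dG; lra.
have [wy|wy] := leP (w * y) 1.
  apply: le_trans lip_ge; rewrite -nu_mul; apply: le_trans dGle _.
  have : nu * mills2 w <= nu * r0 by rewrite ler_wpM2l// mills2_le.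
  have : expR (- (a * w)) * (a * (w * y - 1) / (1 + y ^+ 2)) <= 0.
    rewrite pmulr_rle0 ?expR_gt0// pmulr_lle0 ?invr_gt0//.
    by rewrite mulr_ge0_le0// subr_le0.
  lra.
have y_gt0 : 0 < y by rewrite lt_neqAle y0 andbT; apply: contraTneq wy => <-; rewrite mulr0 ltr10.
pose c := a / y.
have c0 : 0 <= c by rewrite divr_ge0.
have /andP[e1 _] := @expR1_bounds R.
have eN1 : expR (- 1) <= 10 / 27 :> R.
  rewrite expRN -[leRHS]invf_div lef_pV2 ?posrE ?expR_gt0//; lra.
have b1 : expR (- (a * w)) * (a * (w * y - 1) / (1 + y ^+ 2)) <=
          10 / 27 * (y ^+ 2 / ((y + a) * (1 + y ^+ 2))).
  have -> : a * (w * y - 1) / (1 + y ^+ 2) = (a * w - c) * (y / (1 + y ^+ 2)).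
    rewrite /c; field; rewrite !lt0r_neq0//.
  have -> : y ^+ 2 / ((y + a) * (1 + y ^+ 2)) = (1 + c)^-1 * (y / (1 + y ^+ 2)).
    rewrite /c; field; rewrite !lt0r_neq0// ltr_wpDr//.
  rewrite [leLHS]mulrA [leRHS]mulrA ler_wpM2r ?divr_ge0 ?(ltW (w1 _))//.
  (* The inequality [z <= expR (z - 1)] at [z = a * w - c] removes the dependence on [w]. *)
  apply: le_trans (_ : expR (- 1) * expR (- c) <= _).
    rewrite -expRD; have : a * w - c <= expR (a * w - c - 1).
      by have := expR_ge1Dx (a * w - c - 1); lra.
    move=> /(ler_wpM2l (expR_ge0 (- (a * w)))); rewrite -expRD => /le_trans; apply.
    by rewrite ler_expR; lra.
  rewrite ler_pM ?expR_ge0// expRN lef_pV2 ?posrE ?expR_gt0//; last by lra.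
  exact: expR_ge1Dx.
have ya : 0 < (y + a) * (1 + y ^+ 2) by rewrite mulr_gt0// ltr_wpDr.
clear ge c c0 e1 eN1; have nr := nu_mul.
have {b1} dGle (b : R) : y ^+ 2 / ((y + a) * (1 + y ^+ 2)) <= b ->
    dG w <= nu * mills2 w + 10 / 27 * b.
  move=> yb; apply: le_trans dGle _; rewrite lerD2l; apply: le_trans b1 _.
  by apply: ler_wpM2l yb; lra.
rewrite /lip; case: ltP => a2.
  have b2 : y ^+ 2 / ((y + a) * (1 + y ^+ 2)) <= 1 / 2.
    rewrite ler_pdivrMr//.
    have : 0 <= a * (1 + y ^+ 2) by rewrite mulr_ge0// ltW.
    have : 0 <= y * (y - 1) ^+ 2 by rewrite mulr_ge0 ?sqr_ge0.
    clear dGle wy nr; lra.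
  have {dGle b2} dGle := dGle _ b2.
  have w34 : 3 / 4 <= w.
    rewrite leNgt; apply/negP => w34; move: wy; rewrite /y ltNge => /negP; apply.
    nra.
  clear wy y_gt0 ya y0 w1.
  have m34 : mills2 w <= mills2 (3 / 4) by rewrite mills2_nincr//; lra.
  have h34 : 0 <= 3 / 4 :> R by lra.
  have q34 := mills_le_deg2 h34.
  have /andP[r1 r2] := mills0_bounds; have ma := mills_ge_deg1 a0.
  have nul : 29 / 100 <= nu.
    rewrite leNgt; apply/negP => h.
    have : nu * r0 <= 29 / 100 * r0 by rewrite ler_wpM2r ?mills_ge0// ltW.
    clear m34 q34 dGle; lra.
  have m66 : 66 / 100 <= r0 - mills2 w.
    clear dGle nr nul ma; rewrite /mills2 in m34 *; lra.
  clear m34 q34 r1 r2 ma.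
  have : 29 / 100 * (66 / 100) <= nu * (r0 - mills2 w).
    by rewrite ler_pM//; clear dGle nr; lra.
  clear nul m66; lra.
have b2 : y ^+ 2 / ((y + a) * (1 + y ^+ 2)) <= 35 / 100.
  rewrite ler_pdivrMr//.
  have : 1 / 2 * (1 + y ^+ 2) <= a * (1 + y ^+ 2) by rewrite ler_wpM2r// ltW.
  have y99 : 0 <= y + 99 / 350 by lra.
  (* The cubic [35 / 100 * (y + 1 / 2) * (1 + y ^+ 2) - y ^+ 2] has its minimum near [y = 1.32],
     just above zero; the factor [y + 99 / 350] matches its quadratic coefficient. *)
  have : 0 <= (y - 132 / 100) ^+ 2 * (y + 99 / 350) by rewrite mulr_ge0 ?sqr_ge0.
  clear dGle nr; lra.
have {dGle b2} dGle := dGle _ b2; clear wy y_gt0 ya y0 w1.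
have : nu * mills2 w <= nu * r0 by rewrite ler_wpM2l// mills2_le.
lra.
Qed.
End fixed_a.
End stein_solution.

Section stein_functions.
Variable R : realType.
Implicit Types w x y : R.
Local Notation mills := (@mills R).
Local Notation r0 := (mills 0).
Variable a : R.
Hypothesis a0 : 0 <= a.
Variable nu : R.
Hypothesis nuE : nu = mills a / (2 * r0).
Local Notation rho := (tail_ratio a).
Local Notation K := (lip a).

(* The bounded solution of [F' w = w * F w + hexp w - nu] off [0]. *)
Definition stein_F w := if w <= 0 then - (nu * mills (- w)) else nu * mills w - rho w.

Definition stein_G w := w * stein_F w.

Definition hexp w : R := if 0 < w then expR (- (a * w)) else 0.

(** The primitive of [expR (- (a * w))] that vanishes at [0]. The value [a = 0] does occur, for
    [x = 0]. *)
Definition expint w : R := if a == 0 then w else (1 - expR (- (a * w))) / a.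

Definition hexp_int w : R := if w <= 0 then 0 else expint w.

(* Subtracting [hexp_int] removes the kink of [stein_F] at [0]: the derivative
   of [stein_Psi] is the Lipschitz function [stein_G - nu]. *)
Definition stein_Psi w := stein_F w - hexp_int w.

Lemma expint0 : expint 0 = 0.
Proof. by rewrite /expint; case: eqP => // _; rewrite mulr0 oppr0 expR0 subrr mul0r. Qed.

Lemma is_derive_expint w : is_derive w (1 : R) expint (expR (- (a * w))).
Proof.
rewrite /expint; have [->|an0] := eqVneq a 0.
  by rewrite mul0r oppr0 expR0; exact: is_derive_id.
apply: is_derive_eq; rewrite /GRing.scale/=.
by field; rewrite an0.
Qed.

(** The two branches agree at [0] because [rho 0 = mills a = 2 * nu * mills 0]. This is the
    condition that singles out [nu = Theta a], the Gaussian mean of [hexp]. *)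
Lemma stein_F_pos w : 0 <= w -> stein_F w = nu * mills w - rho w.
Proof.
rewrite /stein_F le_eqVlt => /predU1P[<-|w0]; last by rewrite leNgt w0.
rewrite lexx oppr0 tail_ratio.unlock mulr0 oppr0 expR0 mul1r add0r nuE.
by field; rewrite gt_eqF// mills0_gt0.
Qed.

Lemma is_derive_Gp w :
  is_derive w (1 : R) (fun w => w * (nu * mills w - rho w)) (dG a nu w).
Proof.
have := is_derive_mills w => ?; have := @is_derive_tail_ratio R a w => ?.
by apply: is_derive_eq; rewrite /GRing.scale/= /dG /mills2; ring.
Qed.

Lemma is_derive_Gm w :
  is_derive w (1 : R) (fun w => w * - (nu * mills (- w))) (- (nu * mills2 (- w))).
Proof.
have := is_derive_mills (- w) => ?.
by apply: is_derive_eq; rewrite /GRing.scale/= /mills2; ring.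
Qed.

Lemma lip_ge0 : 0 <= K.
Proof. by apply: le_trans (lip_ge _); rewrite divr_ge0 ?mills_ge0. Qed.

Lemma lip_glue (g A B : R -> R) (k : R) :
  (forall x, x <= 0 -> g x = A x) -> (forall x, 0 <= x -> g x = B x) ->
  (forall x y, x <= y -> y <= 0 -> `|A y - A x| <= k * (y - x)) ->
  (forall x y, 0 <= x -> x <= y -> `|B y - B x| <= k * (y - x)) ->
  forall x y, `|g x - g y| <= k * `|x - y|.
Proof.
move=> gA gB hA hB x y; wlog xy : x y / x <= y.
  move=> h; case/orP: (le_total x y) => xy; first exact: h.
  by rewrite distrC (distrC x); exact: h.
rewrite distrC (distrC x) (ger0_norm (_ : 0 <= y - x)) ?subr_ge0//.
have [y0|/ltW y0] := leP y 0; first by rewrite !gA ?hA// (le_trans xy).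
have [x0|/ltW x0] := leP x 0; last by rewrite !gB ?hB.
rewrite (gB y)// (gA x)// (_ : B y - A x = (B y - B 0) + (A 0 - A x)); last first.
  by rewrite -(gA 0)// (gB 0)//; ring.
apply: le_trans (ler_normD _ _) _.
have := hB 0 y (lexx _) y0; have := hA x 0 x0 (lexx _); lra.
Qed.

Lemma derive_lip (A dA : R -> R) (k x y : R) : x <= y ->
  (forall z, is_derive z (1 : R) A (dA z)) ->
  (forall z, x < z < y -> `|dA z| <= k) -> `|A y - A x| <= k * (y - x).
Proof.
move=> xy dAA hk; rewrite ler_norml; apply/andP; split.
  pose f z := A z + k * z.
  have : f x <= f y.
    apply: (@derive_ge0_le R f (fun z => dA z + k)) => // z xzy.
      have := dAA z => ?; apply: is_derive_eq; rewrite /GRing.scale/=; ring.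
    by have := hk _ xzy; rewrite ler_norml => /andP[]; lra.
  by rewrite /f; lra.
pose f z := k * z - A z.
have : f x <= f y.
  apply: (@derive_ge0_le R f (fun z => k - dA z)) => // z xzy.
    have := dAA z => ?; apply: is_derive_eq; rewrite /GRing.scale/=; ring.
  by have := hk _ xzy; rewrite ler_norml => /andP[]; lra.
by rewrite /f; lra.
Qed.

Lemma stein_G_lip x y : `|stein_G x - stein_G y| <= K * `|x - y|.
Proof.
apply: (@lip_glue _ (fun w => w * - (nu * mills (- w)))
                  (fun w => w * (nu * mills w - rho w))).
- by move=> z z0; rewrite /stein_G /stein_F z0.
- by move=> z z0; rewrite /stein_G stein_F_pos.
- move=> u v uv v0; apply: derive_lip uv is_derive_Gm _ => z /andP[_ zv].
  have z0 : 0 <= - z by rewrite oppr_ge0 ltW// (lt_le_trans zv).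
  have n0 := nu_ge0 nuE.
  rewrite normrN ger0_norm ?mulr_ge0 ?mills2_ge0//.
  apply: le_trans (lip_ge a); rewrite -(nu_mul nuE) ler_wpM2l// mills2_le//.
move=> u v u0 uv; apply: derive_lip uv is_derive_Gp _ => z /andP[uz _].
have z0 : 0 <= z by rewrite ltW// (le_lt_trans u0).
rewrite ler_norml (dG_le a0 nuE z0) andbT; apply: le_trans (dG_ge a0 nuE z0).
by rewrite lerN2 lip_ge.
Qed.

(** [stein_Psi] has derivative [stein_G - nu], and [Q] is a primitive of the pointwise error [q];
    the comparison is made through monotonicity rather than integrals. The formula for [stein_Psi]
    changes at [0], so the interval is cut there. *)
Lemma stein_Psi_incr (g : R) (q Q : R -> R) (x y : R) : x <= y ->
  (forall z, is_derive z (1 : R) Q (q z)) ->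
  (forall z, x <= z <= y -> `|stein_G z - g| <= q z) ->
  `|stein_Psi y - stein_Psi x - (g - nu) * (y - x)| <= Q y - Q x.
Proof.
move=> xy dQ hq.
have gen (A dA : R -> R) u v : u <= v -> x <= u -> v <= y ->
    (forall z, is_derive z (1 : R) A (dA z - nu)) ->
    (forall z, u <= z <= v -> dA z = stein_G z) ->
    `|A v - A u - (g - nu) * (v - u)| <= Q v - Q u.
  move=> uv xu vy dAA dAG.
  have h z : u < z < v -> `|dA z - g| <= q z.
    move=> /andP[uz zv]; rewrite dAG ?(ltW uz) ?(ltW zv)//.
    by rewrite hq// (le_trans xu (ltW uz)) (le_trans (ltW zv)).
  rewrite ler_norml; apply/andP; split.
    pose f z := A z - (g - nu) * z + Q z.
    have : f u <= f v.
      apply: (@derive_ge0_le R f (fun z => dA z - nu - (g - nu) + q z)) => // z uzv.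
        have := dAA z => ?; have := dQ z => ?.
        by apply: is_derive_eq; rewrite /GRing.scale/=; ring.
      by have := h _ uzv; rewrite ler_norml => /andP[]; lra.
    by rewrite /f; lra.
  pose f z := (g - nu) * z + Q z - A z.
  have : f u <= f v.
    apply: (@derive_ge0_le R f (fun z => (g - nu) + q z - (dA z - nu))) => // z uzv.
      have := dAA z => ?; have := dQ z => ?.
      by apply: is_derive_eq; rewrite /GRing.scale/=; ring.
    by have := h _ uzv; rewrite ler_norml => /andP[]; lra.
  by rewrite /f; lra.
have Pm z : z <= 0 -> stein_Psi z = - (nu * mills (- z)).
  by move=> z0; rewrite /stein_Psi /stein_F /hexp_int z0 subr0.
have Pp z : 0 <= z -> stein_Psi z = nu * mills z - rho z - expint z.
  move=> z0; rewrite /stein_Psi stein_F_pos//; congr (_ - _).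
  rewrite /hexp_int; case: ifP => // z0'.
  by have -> : z = 0; [apply/le_anti/andP | rewrite expint0].
have genm u v : u <= v -> x <= u -> v <= y -> v <= 0 ->
    `|stein_Psi v - stein_Psi u - (g - nu) * (v - u)| <= Q v - Q u.
  move=> uv xu vy v0; rewrite !Pm//; last exact: le_trans uv v0.
  apply: (gen (fun z => - (nu * mills (- z))) (fun z => z * - (nu * mills (- z))) _ _ uv xu vy).
    move=> z; have := is_derive_mills (- z) => ?.
    by apply: is_derive_eq; rewrite /GRing.scale/=; ring.
  by move=> z /andP[_ zv]; rewrite /stein_G /stein_F (le_trans zv).
have genp u v : u <= v -> x <= u -> v <= y -> 0 <= u ->
    `|stein_Psi v - stein_Psi u - (g - nu) * (v - u)| <= Q v - Q u.
  move=> uv xu vy u0; rewrite !Pp//; last exact: le_trans uv.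
  apply: (gen (fun z => nu * mills z - rho z - expint z)
              (fun z => z * (nu * mills z - rho z)) _ _ uv xu vy).
    move=> z; have := is_derive_mills z => ?; have := is_derive_tail_ratio a z => ?.
    have := is_derive_expint z => ?.
    by apply: is_derive_eq; rewrite /GRing.scale/=; ring.
  by move=> z /andP[uz _]; rewrite /stein_G stein_F_pos// (le_trans u0).
have [y0|/ltW y0] := leP y 0; first exact: genm.
have [x0|/ltW x0] := leP x 0; last exact: genp.
rewrite (_ : _ - _ = (stein_Psi y - stein_Psi 0 - (g - nu) * (y - 0)) +
   (stein_Psi 0 - stein_Psi x - (g - nu) * (0 - x))); last by ring.
apply: le_trans (ler_normD _ _) _.
have := genp _ _ y0 x0 (lexx y) (lexx 0); have := genm _ _ x0 (lexx x) y0 (lexx 0); lra.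
Qed.

Definition pos w : R := Num.max 0 w.

(* For [d > 0] its derivative at [w] is the supremum of [hexp] over
   [[w - d, w + d]]; for [d < 0] it is a lower bound of [hexp] there. *)
Definition smooth_int (d w : R) := pos (w + d) - pos (w - d) + hexp_int (w - d).

(* [pos - hexp_int] is the primitive of the nondecreasing function
   [w |-> 1 - expR (- (a * pos w))]. *)
Lemma pos_hexp_int_incr x y : x <= y ->
  (1 - expR (- (a * pos x))) * (y - x) <=
    (pos y - hexp_int y) - (pos x - hexp_int x) <=
  (1 - expR (- (a * pos y))) * (y - x).
Proof.
pose gam z := z - expint z.
have gamd z : is_derive z (1 : R) gam (1 - expR (- (a * z))).
  by have := is_derive_expint z => ?; apply: is_derive_eq.
have key u v : 0 <= u -> u <= v ->
    (1 - expR (- (a * u))) * (v - u) <= gam v - gam u <= (1 - expR (- (a * v))) * (v - u).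
  move=> u0 uv; apply/andP; split.
    pose f z := gam z - (1 - expR (- (a * u))) * z.
    have : f u <= f v.
      apply: (@derive_ge0_le R f (fun z => (1 - expR (- (a * z))) - (1 - expR (- (a * u))))) => // z.
        move=> _; have := gamd z => ?.
        by apply: is_derive_eq; rewrite /GRing.scale/=; ring.
      move=> /andP[/ltW uz _]; rewrite subr_ge0 lerD2l lerN2 ler_expR lerN2.
      exact: ler_wpM2l.
    by rewrite /f; lra.
  pose f z := (1 - expR (- (a * v))) * z - gam z.
  have : f u <= f v.
    apply: (@derive_ge0_le R f (fun z => (1 - expR (- (a * v))) - (1 - expR (- (a * z))))) => // z.
      move=> _; have := gamd z => ?.
      by apply: is_derive_eq; rewrite /GRing.scale/=; ring.
    move=> /andP[_ /ltW zv]; rewrite subr_ge0 lerD2l lerN2 ler_expR lerN2.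
    exact: ler_wpM2l.
  by rewrite /f; lra.
have Em z : z <= 0 -> pos z - hexp_int z = 0.
  by move=> z0; rewrite /pos /hexp_int z0 max_l// subrr.
have Ep z : 0 <= z -> pos z - hexp_int z = gam z.
  rewrite le_eqVlt => /predU1P[<-|z0]; first by rewrite Em// /gam expint0 subrr.
  by rewrite /pos /hexp_int leNgt z0/= max_r// ltW.
have gam0 : gam 0 = 0 by rewrite /gam expint0 subrr.
have p0 z : z <= 0 -> pos z = 0 by move=> z0; rewrite /pos max_l.
have p1 z : 0 <= z -> pos z = z by move=> z0; rewrite /pos max_r.
move=> xy; have [y0|/ltW y0] := leP y 0.
  by rewrite !Em ?(le_trans xy)// !p0 ?(le_trans xy)// !mulr0 !oppr0 !expR0 !subrr !mul0r addr0 lexx.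
have [x0|/ltW x0] := leP x 0; last first.
  by rewrite !Ep// !p1// key.
rewrite (Em x)// (Ep y)// (p0 x)// (p1 y)// mulr0 oppr0 expR0 subrr mul0r addr0.
have /andP[k1 k2] := key 0 y (lexx 0) y0.
rewrite mulr0 oppr0 expR0 subrr mul0r gam0 oppr0 !addr0 in k1 k2.
rewrite k1/=; apply: le_trans k2 _; rewrite ler_wpM2l//; last by lra.
by rewrite subr_ge0 expR_le1 oppr_le0 mulr_ge0.
Qed.

Lemma pos_incr x y : x <= y -> 0 <= pos y - pos x <= y - x.
Proof. by move=> xy; rewrite /pos; case: (leP 0 x); case: (leP 0 y); lra. Qed.

Lemma pos_incr_ge0 x y : 0 <= x -> x <= y -> pos y - pos x = y - x.
Proof. by move=> x0 xy; rewrite /pos !max_r// (le_trans x0). Qed.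

Lemma pos_incr_le0 x y : x <= y -> y <= 0 -> pos y - pos x = 0.
Proof. by move=> xy y0; rewrite /pos !max_l ?subrr// (le_trans xy). Qed.

(** [hexp] jumps up at [0] and then decreases. As a difference of two nondecreasing functions it can
    be smoothed by shifting each of them in its own unfavourable direction, which is what
    [smooth_int] does to their primitives. *)
Lemma hexpE w : hexp w = (0 < w)%R%:R - (1 - expR (- (a * pos w))).
Proof.
rewrite /hexp /pos; case: ltP => w0; last by rewrite mulr0 oppr0 expR0 !subrr.
by rewrite opprB addrC subrK.
Qed.

Lemma one_sub_exp_incr x y : x <= y ->
  1 - expR (- (a * pos x)) <= 1 - expR (- (a * pos y)).
Proof.
move=> xy; rewrite lerD2l lerN2 ler_expR lerN2 ler_wpM2l//.
by have := pos_incr xy; lra.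
Qed.

(** For [z] in [[x, y]] the window condition gives [z - d <= w <= z + d], so the indicator part at
    [z + d] dominates that at [w], and the other part at [z - d] is dominated. *)
Lemma smooth_int_ge d x y w : x <= y -> y - d <= w <= x + d ->
  hexp w * (y - x) <= smooth_int d y - smooth_int d x.
Proof.
move=> xy /andP[yw wx].
have /pos_hexp_int_incr/andP[_ h] : x - d <= y - d by lra.
have g : (1 - expR (- (a * pos (y - d)))) * (y - x) <= (1 - expR (- (a * pos w))) * (y - x).
  by rewrite ler_wpM2r ?subr_ge0// one_sub_exp_incr.
have p : (0 < w)%R%:R * (y - x) <= pos (y + d) - pos (x + d).
  case: ltP => w0; first by rewrite mul1r pos_incr_ge0; lra.
  rewrite mul0r; have /pos_incr : x + d <= y + d by lra.
  by case/andP.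
rewrite hexpE /smooth_int; lra.
Qed.

Lemma smooth_int_le d x y w : x <= y -> y - d <= w <= x + d ->
  smooth_int (- d) y - smooth_int (- d) x <= hexp w * (y - x).
Proof.
move=> xy /andP[yw wx].
have /pos_hexp_int_incr/andP[h _] : x + d <= y + d by lra.
have g : (1 - expR (- (a * pos w))) * (y - x) <= (1 - expR (- (a * pos (x + d)))) * (y - x).
  by rewrite ler_wpM2r ?subr_ge0// one_sub_exp_incr.
have p : pos (y - d) - pos (x - d) <= (0 < w)%R%:R * (y - x).
  case: ltP => w0; last by rewrite mul0r pos_incr_le0; lra.
  rewrite mul1r; have /pos_incr : x - d <= y - d by lra.
  by case/andP; lra.
rewrite hexpE /smooth_int !opprK; lra.
Qed.

(** Both monotone parts take values in [[0, 1]], so each shift changes a primitive by an amount in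
    [[0, d]]. What matters later is the form [d] up to an error [d]: the constant is invisible to a
    centred variable. *)
Lemma smooth_int_range d w : 0 <= d ->
  0 <= smooth_int d w - hexp_int w <= 2 * d /\
  - (2 * d) <= smooth_int (- d) w - hexp_int w <= 0.
Proof.
move=> d0.
have e01 z : 0 <= 1 - expR (- (a * pos z)) <= 1.
  rewrite subr_ge0 expR_le1 oppr_le0 mulr_ge0//; last by rewrite le_max lexx.
  by rewrite lerBlDr lerDl expR_ge0.
have /andP[e1 _] := e01 (w - d); have /andP[_ e2] := e01 w.
have /andP[e3 _] := e01 w; have /andP[_ e4] := e01 (w + d).
have /pos_hexp_int_incr/andP[h1 h2] : w - d <= w by lra.
have /pos_hexp_int_incr/andP[h3 h4] : w <= w + d by lra.
have /pos_incr/andP[p1 p2] : w - d <= w by lra.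
have /pos_incr/andP[p3 p4] : w <= w + d by lra.
rewrite /smooth_int opprK; split; apply/andP; split; nra.
Qed.
End stein_functions.

(** * Bounded measurable functions and independence *)

Section bounded_measurable.
Context d (T : measurableType d) (R : realType) (P : probability T R).
Implicit Types f g : T -> R.

(** The bound is required at every point, so that the class is closed under the algebraic operations
    and exponentials used below and integrability is automatic. *)
Definition bmeas f := measurable_fun [set: T] f /\ exists C, forall w, `|f w| <= C.

Definition Ex f : R := \int[P]_w f w.

Lemma bmeas_integrable f : bmeas f -> P.-integrable [set: T] (EFin \o f).
Proof.
move=> [mf [C fC]]; apply: measurable_bounded_integrable => //.
  by rewrite (le_lt_trans (probability_le1 _ _)) ?ltry.
exists C; split; first exact: num_real.
by move=> M CM w _; apply: le_trans (fC w) (ltW CM).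
Qed.

Lemma bmeas_cst c : bmeas (fun=> c).
Proof. by split; [exact: measurable_cst | exists `|c|]. Qed.

Lemma bmeasD f g : bmeas f -> bmeas g -> bmeas (fun w => f w + g w).
Proof.
move=> [mf [C fC]] [mg [D gD]]; split; first exact: measurable_funD.
by exists (C + D) => w; rewrite (le_trans (ler_normD _ _))// lerD.
Qed.

Lemma bmeasN f : bmeas f -> bmeas (fun w => - f w).
Proof.
move=> [mf [C fC]]; split; first exact: measurableT_comp.
by exists C => w; rewrite normrN.
Qed.

Lemma bmeasB f g : bmeas f -> bmeas g -> bmeas (fun w => f w - g w).
Proof. by move=> bf bg; apply: bmeasD => //; exact: bmeasN. Qed.

Lemma bmeasM f g : bmeas f -> bmeas g -> bmeas (fun w => f w * g w).
Proof.
move=> [mf [C fC]] [mg [D gD]]; split; first exact: measurable_funM.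
by exists (C * D) => w; rewrite normrM ler_pM.
Qed.

Lemma bmeasX f n : bmeas f -> bmeas (fun w => f w ^+ n).
Proof.
move=> bf; elim: n => [|n IHn]; first exact: bmeas_cst.
under [X in bmeas X]eq_fun do rewrite exprS.
exact: bmeasM.
Qed.

Lemma bmeas_sum (I : Type) (s : seq I) (F : I -> T -> R) :
  (forall i, bmeas (F i)) -> bmeas (fun w => \sum_(i <- s) F i w).
Proof.
move=> bF; elim: s => [|i s IHs].
  under [X in bmeas X]eq_fun do rewrite big_nil.
  exact: bmeas_cst.
under [X in bmeas X]eq_fun do rewrite big_cons.
exact: bmeasD.
Qed.

Lemma bmeas_comp (h : R -> R) f : measurable_fun [set: R] h ->
  (forall M, exists C, forall x, `|x| <= M -> `|h x| <= C) ->
  bmeas f -> bmeas (fun w => h (f w)).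
Proof.
move=> mh hb [mf [C fC]]; split; first exact: measurableT_comp.
by have [D hD] := hb C; exists D => w; exact/hD/fC.
Qed.

Lemma bmeas_expR f : bmeas f -> bmeas (fun w => expR (f w)).
Proof.
apply: bmeas_comp; first exact: measurable_expR.
move=> M; exists (expR M) => x xM; rewrite ger0_norm ?expR_ge0// ler_expR.
exact: le_trans (ler_norm _) xM.
Qed.

Lemma bmeas_ind (A : set T) : measurable A -> bmeas \1_A.
Proof.
move=> mA; split; first exact: measurable_indic.
by exists 1 => w; rewrite indicE ger0_norm//; case: (_ \in _).
Qed.

Lemma eq_Ex f g : (forall w, f w = g w) -> Ex f = Ex g.
Proof. by move=> fg; congr Ex; apply/funext. Qed.

Lemma Ex_cst c : Ex (fun=> c) = c.
Proof.
have PT : P [set: T] = 1%E by exact: probability_setT.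
rewrite /Ex Rintegral_cst// -[RHS]mulr1; congr (_ * _).
exact: (congr1 fine PT).
Qed.

Lemma ExD f g : bmeas f -> bmeas g -> Ex (fun w => f w + g w) = Ex f + Ex g.
Proof. by move=> bf bg; rewrite /Ex RintegralD//; exact: bmeas_integrable. Qed.

Lemma ExB f g : bmeas f -> bmeas g -> Ex (fun w => f w - g w) = Ex f - Ex g.
Proof. by move=> bf bg; rewrite /Ex RintegralB//; exact: bmeas_integrable. Qed.

Lemma ExZl c f : bmeas f -> Ex (fun w => c * f w) = c * Ex f.
Proof. by move=> bf; rewrite /Ex RintegralZl//; exact: bmeas_integrable. Qed.

Lemma ExZr c f : bmeas f -> Ex (fun w => f w * c) = Ex f * c.
Proof. by move=> bf; rewrite /Ex RintegralZr//; exact: bmeas_integrable. Qed.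

Lemma ExN f : bmeas f -> Ex (fun w => - f w) = - Ex f.
Proof.
by move=> bf; rewrite -mulN1r -ExZl//; apply: eq_Ex => w; rewrite mulN1r.
Qed.

Lemma Ex_sum (I : Type) (s : seq I) (F : I -> T -> R) : (forall i, bmeas (F i)) ->
  Ex (fun w => \sum_(i <- s) F i w) = \sum_(i <- s) Ex (F i).
Proof.
move=> bF; elim: s => [|i s IHs].
  by rewrite big_nil -[RHS](Ex_cst 0); apply: eq_Ex => w; rewrite big_nil.
rewrite big_cons -IHs -ExD//; first by apply: eq_Ex => w; rewrite big_cons.
exact: bmeas_sum.
Qed.

Lemma Ex_le f g : bmeas f -> bmeas g -> (forall w, f w <= g w) -> Ex f <= Ex g.
Proof.
by move=> bf bg fg; apply: le_Rintegral => //; exact: bmeas_integrable.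
Qed.

Lemma Ex_ge0 f : (forall w, 0 <= f w) -> 0 <= Ex f.
Proof. by move=> f0; apply: Rintegral_ge0. Qed.

Lemma Ex_EFin f : bmeas f -> (\int[P]_w (f w)%:E)%E = (Ex f)%:E.
Proof.
by move=> bf; rewrite fineK//; apply: integrable_fin_num => //; exact: bmeas_integrable.
Qed.

End bounded_measurable.

Ltac bmeas_tac := repeat first
  [ assumption
  | apply: bmeas_cst | apply: bmeasD | apply: bmeasN | apply: bmeasM
  | apply: bmeasX | apply: bmeas_expR ].

Section independence.
Context d (T : measurableType d) (R : realType) (P : probability T R).

(** Rectangles are stable under intersection and generate the product sigma-algebra, and the whole
    space is one of them. *)
Lemma rect_measure_unique (m1 m2 : {measure set (R * R) -> \bar R}) :
  (m1 setT < +oo)%E ->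
  (forall A B : set R, measurable A -> measurable B -> m1 (A `*` B) = m2 (A `*` B)) ->
  forall Z, measurable Z -> m1 Z = m2 Z.
Proof.
move=> fin1 m12 Z mZ.
pose G : set (set (R * R)) :=
  [set C | exists A, measurable A /\ exists B, measurable B /\ C = A `*` B].
apply: (measure_unique G (fun=> setT)) => //.
- rewrite measurable_prod_measurableType; congr (<<s _ >>).
  rewrite predeqE; split => [[A mA [B mB <-]]|[A [mA [B [mB ->]]]]].
    by exists A; split => //; exists B.
  by exists A => //; exists B.
- move=> /= _ _ [X1 [mX1 [X2 [mX2 ->]]]] [Y1 [mY1 [Y2 [mY2 ->]]]].
  rewrite -setXI; exists (X1 `&` Y1); split; first exact: measurableI.
  by exists (X2 `&` Y2); split => //; exact: measurableI.
- by move=> _; exists setT; split => //; exists setT; split => //; rewrite setXTT.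
- by rewrite bigcup_const//; exists 0%N.
- by move=> A [A1 [mA1 [A2 [mA2 ->]]]]; exact: m12.
Qed.

Definition indep2 (U V : T -> R) := forall A B : set R, measurable A -> measurable B ->
  P (U @^-1` A `&` V @^-1` B) = (P (U @^-1` A) * P (V @^-1` B))%E.

Section pair.
Variables (U V : T -> R) (Psi : R * R -> R) (C : R).
Hypotheses (mU : measurable_fun [set: T] U) (mV : measurable_fun [set: T] V).
Hypothesis mPsi : measurable_fun [set: R * R] Psi.
Hypothesis PsiC : forall w z, `|Psi (U w, V z)| <= C.

Let phi2 (wz : T * T) := (U wz.1, V wz.2).

Let mphi2 : measurable_fun [set: T * T] phi2.
Proof. by apply/measurable_fun_pair; apply: measurableT_comp. Qed.

Let int_phi2 : (P \x P)%E.-integrable [set: T * T] ((EFin \o Psi) \o phi2).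
Proof.
apply: (@measurable_bounded_integrable _ _ _ _ (Psi \o phi2)) => //.
- apply: (@le_lt_trans _ _ ((P \x P)%E ([set: T] `*` [set: T]))); first by rewrite setXTT.
  rewrite product_measure1E//; apply: le_lt_trans (ltry 1).
  by rewrite -[leRHS]mule1; apply: lee_pmul => //; exact: probability_le1.
- exact: measurableT_comp.
exists C; split; first exact: num_real.
by move=> M CM [w z] _; apply: le_trans (PsiC w z) (ltW CM).
Qed.

Lemma bmeas_section z : bmeas (fun w => Psi (U w, V z)).
Proof.
split; last by exists C => w; exact: PsiC.
by apply: (measurableT_comp mPsi); apply/measurable_fun_pair => //; exact: measurable_cst.
Qed.

Lemma bmeas_Ex_section : bmeas (fun z => Ex P (fun w => Psi (U w, V z))).
Proof.
split; last first.
  exists C => z; have b := bmeas_section z.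
  rewrite ler_norml -[- C](Ex_cst P) -{2}[C](Ex_cst P); apply/andP; split.
    apply: Ex_le => //; first exact: bmeas_cst.
    by move=> w; have := PsiC w z; rewrite ler_norml => /andP[].
  apply: Ex_le => //; first exact: bmeas_cst.
  by move=> w; have := PsiC w z; rewrite ler_norml => /andP[].
apply/measurable_EFinP.
have := measurable_fubini_G int_phi2; apply: eq_measurable_fun => z _.
by rewrite /fubini_G /= -Ex_EFin//; exact: bmeas_section.
Qed.

(** The law of [(U, V)] agrees with the product law on rectangles, hence everywhere; a change of
    variables and Fubini give the iterated mean. The outer variable [z] acts as an independent
    second sample. *)
Lemma Ex_indep2 : indep2 U V ->
  Ex P (fun w => Psi (U w, V w)) = Ex P (fun z => Ex P (fun w => Psi (U w, V z))).
Proof.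
move=> UV.
pose phi w := (U w, V w); have mphi : measurable_fun [set: T] phi by exact/measurable_fun_pair.
have mf : measurable_fun [set: R * R] (EFin \o Psi) by exact/measurable_EFinP.
have bd1 : bmeas (fun w => Psi (phi w)).
  by split; [exact: measurableT_comp | exists C => w; exact: PsiC].
have i1 : P.-integrable (phi @^-1` setT) ((EFin \o Psi) \o phi).
  by rewrite preimage_setT; exact: bmeas_integrable.
have i2 : (P \x P)%E.-integrable (phi2 @^-1` setT) ((EFin \o Psi) \o phi2).
  by rewrite preimage_setT.
have E1 := integral_pushforward mphi mf i1 measurableT.
have E2 := integral_pushforward mphi2 mf i2 measurableT.
rewrite preimage_setT in E1; rewrite preimage_setT in E2.
rewrite /Ex /Rintegral; congr fine.
have -> : (\int[P]_z (fine (\int[P]_w (Psi (U w, V z))%:E))%:E =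
         \int[P]_z \int[P]_w (((EFin \o Psi) \o phi2) (w, z)))%E.
  by apply: eq_integral => z _; rewrite Ex_EFin//; exact: bmeas_section.
rewrite -[LHS]/(\int[P]_w ((EFin \o Psi) \o phi) w)%E -E1.
have := @integral21_prod_meas1 _ _ _ _ _ P P _ int_phi2.
rewrite /fubini_G => ->; rewrite -E2.
apply: eq_measure_integral => Z mZ _; apply: rect_measure_unique => // [|A B mA mB].
  rewrite -[X in (X < _)%E]/(P (phi @^-1` setT)) (le_lt_trans (probability_le1 _ _)) ?ltry//.
  by rewrite preimage_setT.
rewrite /pushforward -[RHS]/((P \x P)%E ((U @^-1` A) `*` (V @^-1` B))).
rewrite product_measure1E; last 2 first.
- by rewrite -[X in measurable X]setTI; exact: mU.
- by rewrite -[X in measurable X]setTI; exact: mV.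
exact: UV.
Qed.
End pair.
End independence.

Section sums.
Context d (T : measurableType d) (R : realType) (P : probability T R).
Variables (n : nat) (X : 'I_n -> T -> R).
Hypothesis mX : forall i, measurable_fun [set: T] (X i).
Hypothesis indep : mutually_independent P X.

Definition sumX (s : seq 'I_n) (w : T) : R := \sum_(i <- s) X i w.

Definition cylinder (J : {set 'I_n}) (B : 'I_n -> set R) : set T :=
  \bigcap_(i in [set` J]) (X i @^-1` B i).

Lemma measurable_preimage (U : T -> R) (A : set R) :
  measurable_fun [set: T] U -> measurable A -> measurable (U @^-1` A).
Proof. by move=> mU mA; rewrite -[X in measurable X]setTI; exact: mU. Qed.

Lemma measurable_cylinder (J : {set 'I_n}) (B : 'I_n -> set R) :
  (forall i, measurable (B i)) -> measurable (cylinder J B).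
Proof.
move=> mB; apply: fin_bigcap_measurable; first exact: finite_finset.
by move=> i _; exact: measurable_preimage.
Qed.

Lemma measurable_sum_seq (s : seq 'I_n) :
  measurable_fun [set: T] (sumX s).
Proof. by apply: measurable_sum. Qed.

Lemma cylinderU1 (k : 'I_n) (J : {set 'I_n}) (B : 'I_n -> set R) (A : set R) : k \notin J ->
  cylinder (k |: J) (fun i => if i == k then A else B i) = X k @^-1` A `&` cylinder J B.
Proof.
move=> kJ; apply/seteqP; split => w /=.
  move=> h; split; first by have := h k; rewrite /= !inE eqxx; apply.
  move=> i /= iJ; have := h i; rewrite /= !inE iJ orbT.
  by rewrite ifN; [apply | apply: contraNneq kJ => <-].
move=> [hk h] i /=; rewrite !inE; have [->//|ik /= iJ] := eqVneq i k.
by apply: h.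
Qed.

Lemma indep_sum_cylinder (s : seq 'I_n) : uniq s ->
  forall (J : {set 'I_n}) (B : 'I_n -> set R) (A : set R),
  (forall i, i \in s -> i \notin J) -> (forall i, measurable (B i)) -> measurable A ->
  P ((sumX s) @^-1` A `&` cylinder J B) =
  (P ((sumX s) @^-1` A) * P (cylinder J B))%E.
Proof.
elim: s => [_|k s IHs /= /andP[ks us]] J B A sJ mB mA.
  have [A0|A0] := pselect (A 0).
    have -> : sumX [::] @^-1` A = setT.
      by apply/seteqP; split => w //= _; rewrite /sumX big_nil.
    by rewrite setTI probability_setT mul1e.
  have -> : sumX [::] @^-1` A = set0.
    by apply/seteqP; split => w //=; rewrite /sumX big_nil.
  by rewrite set0I measure0 mul0e.
pose U := sumX s.
have mU : measurable_fun [set: T] U by exact: measurable_sum_seq.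
pose phi w := (X k w, U w).
have mphi : measurable_fun [set: T] phi by exact/measurable_fun_pair.
have mC := measurable_cylinder J mB.
have kJ : k \notin J by apply: sJ; rewrite inE eqxx.
have sJ' i : i \in s -> i \notin J by move=> si; apply: sJ; rewrite inE si orbT.
have [m1 m1E] : exists m : {measure set (R * R) -> \bar R},
    forall Z, m Z = P (phi @^-1` Z `&` cylinder J B).
  by unshelve eexists (pushforward (mrestr P mC) phi : {measure set (R * R) -> \bar R}).
have pC0 : 0 <= fine (P (cylinder J B)) by rewrite fine_ge0.
have [m2 m2E] : exists m : {measure set (R * R) -> \bar R},
    forall Z, m Z = (P (cylinder J B) * P (phi @^-1` Z))%E.
  unshelve eexists (mscale (NngNum pC0) (pushforward P phi) : {measure set (R * R) -> \bar R}) => //.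
  by move=> Z; rewrite /= /mscale /= fineK ?fin_num_measure.
pose Z := [set xu : R * R | A (xu.1 + xu.2)].
have mZ : measurable Z.
  have mD : measurable_fun [set: R * R] (fun xu : R * R => xu.1 + xu.2).
    by apply: measurable_funD.
  by rewrite -[Z]setTI; exact: mD.
have preZ : sumX (k :: s) @^-1` A = phi @^-1` Z.
  by apply/seteqP; split => w; rewrite /Z /phi /U /sumX /= big_cons.
have cyl1 (A' : set R) : cylinder [set k]%SET (fun=> A') = X k @^-1` A'.
  apply/seteqP; split => w /=; first by move=> /(_ k) /=; rewrite inE eqxx; apply.
  by move=> h i /=; rewrite inE => /eqP ->.
have cylP J' B' : (forall i, measurable (B' i)) ->
    P (cylinder J' B') = (\prod_(i in J') P (X i @^-1` B' i))%E.
  by move=> mB'; exact: indep.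
rewrite preZ -m1E muleC -m2E; apply: rect_measure_unique => // [|A' B' mA' mB'].
  rewrite m1E (le_lt_trans (probability_le1 _ _)) ?ltry// preimage_setT setTI.
  exact: mC.
have pre : phi @^-1` (A' `*` B') = X k @^-1` A' `&` U @^-1` B' by [].
rewrite m1E m2E pre; pose B1 i := if i == k then A' else B i.
have mB1 i : measurable (B1 i) by rewrite /B1; case: ifP.
have k1s i : i \in s -> i \notin k |: J.
  move=> si; rewrite !inE negb_or sJ'// andbT.
  by apply: contraNneq ks => <-.
have k0s i : i \in s -> i \notin [set k]%SET.
  by move=> si; rewrite inE; apply: contraNneq ks => <-.
rewrite setIAC setIC -cylinderU1// (IHs us _ B1 _ k1s mB1 mB') cylP//.
rewrite (big_setU1 _ kJ)/= /B1 eqxx -cyl1 setIC (IHs us _ _ _ k0s (fun=> mA') mB').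
rewrite (eq_bigr (fun i => P (X i @^-1` B i))) => [|i iJ]; last first.
  by rewrite ifN//; apply: contraNneq kJ => <-.
by rewrite -cylP// muleA [RHS]muleC.
Qed.

Lemma indep_sum_one (s : seq 'I_n) (k : 'I_n) : uniq s -> k \notin s ->
  indep2 P (sumX s) (X k).
Proof.
move=> us ks A B mA mB.
have cyl1 : cylinder [set k]%SET (fun=> B) = X k @^-1` B.
  apply/seteqP; split => w /=; first by move=> /(_ k) /=; rewrite inE eqxx; apply.
  by move=> h i /=; rewrite inE => /eqP ->.
rewrite -cyl1 indep_sum_cylinder// => i si.
by rewrite inE; apply: contraNneq ks => <-.
Qed.
End sums.

(** * One summand: its increment against the target at the resampled sum *)

Section stein_step.
Variable R : realType.
Local Notation mills := (@mills R).
Variable a : R.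
Hypothesis a0 : 0 <= a.
Variable nu : R.
Hypothesis nuE : nu = mills a / (2 * mills 0).
Local Notation K := (lip a).

(** By Stein's equation this is the derivative of [stein_F] off [0]. *)
Definition stein_target (w : R) := hexp a w - nu + stein_G a nu w.

(** [stein_F] with the primitive [hexp_int] replaced by a smoothed one. Positive and negative [d]
    serve the two directions of the estimate. *)
Definition stein_smooth (d w : R) := stein_Psi a nu w + smooth_int a d w.

(* For [u] and [v] in [b - 1, b + 1], this dominates [`|u - v|]; as a function
   of [v] it is the chord of [v |-> `|u - v|], and unlike the latter it has an
   explicit mean when [v] is centred. *)
Definition chord (b u v : R) := 1 - b ^+ 2 + b * (u + v) - u * v.

Lemma chord_ge b u v : b - 1 <= u <= b + 1 -> b - 1 <= v <= b + 1 ->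
  `|u - v| <= chord b u v.
Proof.
move=> /andP[u1 u2] /andP[v1 v2]; rewrite ler_norml /chord.
have h1 : 0 <= (b + 1 - u) * (v - (b - 1)) by rewrite mulr_ge0 ?subr_ge0.
have h2 : 0 <= (b + 1 - v) * (u - (b - 1)) by rewrite mulr_ge0 ?subr_ge0.
by apply/andP; split; lra.
Qed.

Variables s b : R.
Hypothesis s0 : 0 < s.
Local Notation d := (2 / s).

(** This is [u] times the integral of [K / s * chord b (s * (w - c)) v] for [w] from [c] to
    [c + u / s]. It is affine in [v], so for a centred [v] only the terms free of [v] survive on
    average. *)
Definition step_error (u v : R) :=
  K / s ^+ 2 * ((1 - b ^+ 2 + b * v) * u ^+ 2 + (b - v) * (u ^+ 3 / 2)).

Lemma window_dist (u v c : R) : b - 1 <= 0 <= b + 1 ->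
  b - 1 <= u <= b + 1 -> b - 1 <= v <= b + 1 ->
  [/\ c + u / s - d <= c + v / s <= c + d,
      c - d <= c + v / s <= c + u / s + d &
      c + 0 / s - d <= c + v / s <= c + u / s + d].
Proof.
move=> /andP[b1 b2] /andP[u1 u2] /andP[v1 v2].
have si : 0 < s^-1 by rewrite invr_gt0.
rewrite mul0r; split; apply/andP; split; nra.
Qed.

(** In the application [c] is the sum without one summand, [u] the removed centred summand and [v]
    an independent copy. The derivative of [stein_Psi] along the increment is compared with its
    value at [c + v / s], at a cost [K / s] times the distance of [u]-scaled positions to [v], which
    [chord] dominates. *)
Lemma stein_Psi_step (u v c : R) : b - 1 <= 0 <= b + 1 ->
  b - 1 <= u <= b + 1 -> b - 1 <= v <= b + 1 ->
  `| u * (stein_Psi a nu (c + u / s) - stein_Psi a nu c)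
     - u ^+ 2 / s * (stein_G a nu (c + v / s) - nu) | <= step_error u v.
Proof.
move=> b0 hu hv; have si : 0 < s^-1 by rewrite invr_gt0.
have sn0 : s != 0 by rewrite gt_eqF.
pose g := stein_G a nu (c + v / s).
pose q w := K / s * chord b (s * (w - c)) v.
pose Q w := K / s ^+ 2 * ((1 - b ^+ 2 + b * v) * (s * (w - c))
                          + (b - v) * ((s * (w - c)) ^+ 2 / 2)).
have dQ w : is_derive w (1 : R) Q (q w).
  apply: is_derive_eq; rewrite /GRing.scale/= /q /chord; field.
  by rewrite sn0.
have Qc : Q c = 0 by rewrite /Q subrr mulr0 expr0n/= mul0r !mulr0 addr0 mulr0.
have Qu : u * Q (c + u / s) = step_error u v.
  by rewrite /Q /step_error; field; rewrite sn0.
have qG w : b - 1 <= s * (w - c) <= b + 1 -> `|stein_G a nu w - g| <= q w.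
  move=> hw; apply: le_trans (stein_G_lip a0 nuE _ _) _.
  rewrite /q -mulrA ler_wpM2l ?lip_ge0//.
  have -> : w - (c + v / s) = s^-1 * (s * (w - c) - v) by field.
  by rewrite normrM (gtr0_norm si) ler_wpM2l ?(ltW si)// chord_ge.
have [u0|/ltW u0] := leP 0 u.
  have cu : c <= c + u / s by rewrite lerDl divr_ge0// ltW.
  have hG w : c <= w <= c + u / s -> `|stein_G a nu w - g| <= q w.
    move=> /andP[cw wu]; apply: qG.
    have : 0 <= s * (w - c) by rewrite mulr_ge0 ?subr_ge0// ltW.
    have : s * (w - c) <= u by rewrite mulrC -ler_pdivlMr//; lra.
    by lra.
  have := stein_Psi_incr nuE cu dQ hG; rewrite Qc subr0 => h.
  have := ler_wpM2l u0 h; rewrite Qu -{1}(ger0_norm u0) -normrM.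
  apply: le_trans; rewrite le_eqVlt; apply/orP; left; apply/eqP; congr (`|_|).
  by rewrite /g; field.
have cu : c + u / s <= c by rewrite gerDl pmulr_lle0.
have hG w : c + u / s <= w <= c -> `|stein_G a nu w - g| <= q w.
  move=> /andP[cw wu]; apply: qG.
  have : s * (w - c) <= 0 by rewrite pmulr_rle0// subr_le0.
  have : u <= s * (w - c) by rewrite mulrC -ler_pdivrMr//; lra.
  by lra.
have := stein_Psi_incr nuE cu dQ hG; rewrite Qc sub0r => h.
have u0' : 0 <= - u by rewrite oppr_ge0.
have := ler_wpM2l u0' h; rewrite mulrNN Qu -{1}(ger0_norm u0') -normrM.
apply: le_trans; rewrite le_eqVlt; apply/orP; left; apply/eqP; congr (`|_|).
by rewrite /g; field.
Qed.

(** For [u < 0] the increment over [[c + u / s, c]] is taken with factor [- u], so the same lower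
    bound serves both signs of [u]. *)
Lemma stein_step_ge (u v c : R) : b - 1 <= 0 <= b + 1 ->
  b - 1 <= u <= b + 1 -> b - 1 <= v <= b + 1 ->
  u ^+ 2 / s * stein_target (c + v / s) - step_error u v <=
  u * (stein_smooth d (c + u / s) - stein_smooth d c).
Proof.
move=> b0 hu hv; have si : 0 < s^-1 by rewrite invr_gt0.
have := stein_Psi_step c b0 hu hv; rewrite ler_norml => /andP[+ _].
have : u ^+ 2 / s * hexp a (c + v / s) <=
       u * (smooth_int a d (c + u / s) - smooth_int a d c).
  have [w1 w2 _] := window_dist c b0 hu hv.
  have [u0|/ltW u0] := leP 0 u.
    have cu : c <= c + u / s by rewrite lerDl divr_ge0// ltW.
    have /(ler_wpM2l u0) := smooth_int_ge a0 cu w1.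
    by apply: le_trans; rewrite le_eqVlt; apply/orP; left; apply/eqP; ring.
  have cu : c + u / s <= c by rewrite gerDl pmulr_lle0.
  have u0' : 0 <= - u by rewrite oppr_ge0.
  have /(ler_wpM2l u0') := smooth_int_ge a0 cu w2.
  rewrite (_ : - u * (smooth_int a d c - _) =
    u * (smooth_int a d (c + u / s) - smooth_int a d c)); last by ring.
  by apply: le_trans; rewrite le_eqVlt; apply/orP; left; apply/eqP; ring.
rewrite /stein_target /stein_smooth; lra.
Qed.

Lemma stein_step_le (u v c : R) : b - 1 <= 0 <= b + 1 ->
  b - 1 <= u <= b + 1 -> b - 1 <= v <= b + 1 ->
  u * (stein_smooth (- d) (c + u / s) - stein_smooth (- d) c) <=
  u ^+ 2 / s * stein_target (c + v / s) + step_error u v.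
Proof.
move=> b0 hu hv; have si : 0 < s^-1 by rewrite invr_gt0.
have := stein_Psi_step c b0 hu hv; rewrite ler_norml => /andP[_ +].
have : u * (smooth_int a (- d) (c + u / s) - smooth_int a (- d) c) <=
       u ^+ 2 / s * hexp a (c + v / s).
  have [w1 w2 _] := window_dist c b0 hu hv.
  have [u0|/ltW u0] := leP 0 u.
    have cu : c <= c + u / s by rewrite lerDl divr_ge0// ltW.
    have /(ler_wpM2l u0)/le_trans := smooth_int_le a0 cu w1; apply.
    by rewrite le_eqVlt; apply/orP; left; apply/eqP; ring.
  have cu : c + u / s <= c by rewrite gerDl pmulr_lle0.
  have u0' : 0 <= - u by rewrite oppr_ge0.
  have /(ler_wpM2l u0') := smooth_int_le a0 cu w2.
  rewrite (_ : - u * (smooth_int a (- d) c - _) =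
    u * (smooth_int a (- d) (c + u / s) - smooth_int a (- d) c)); last by ring.
  move=> /le_trans; apply.
  by rewrite le_eqVlt; apply/orP; left; apply/eqP; ring.
rewrite /stein_target /stein_smooth; lra.
Qed.

Lemma stein_smooth_center (w : R) (eps : R) : 0 <= eps ->
  `|stein_smooth eps w - stein_F a nu w - eps| <= eps /\
  `|stein_smooth (- eps) w - stein_F a nu w + eps| <= eps.
Proof.
move=> e0; have [/andP[h1 h2] /andP[h3 h4]] := smooth_int_range a0 w e0.
by rewrite !ler_norml /stein_smooth /stein_Psi; split; apply/andP; split; lra.
Qed.
End stein_step.

(** * Exponential tilting *)

Section stein_measurable.
Variable R : realType.
Local Notation mills := (@mills R).
Variable a : R.
Hypothesis a0 : 0 <= a.
Variable nu : R.
Hypothesis nuE : nu = mills a / (2 * mills 0).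

Lemma is_derive_measurable (f df : R -> R) :
  (forall x, is_derive x (1 : R) f (df x)) -> measurable_fun [set: R] f.
Proof.
move=> fd; apply: continuous_measurable_fun => x.
exact: is_derive_continuous (fd x).
Qed.

Lemma measurable_le0 : measurable_fun [set: R] (fun w : R => w <= 0).
Proof. by apply: measurable_fun_ler => //; exact: measurable_cst. Qed.

Lemma measurable_stein_F : measurable_fun [set: R] (stein_F a nu).
Proof.
have mm : measurable_fun [set: R] mills := is_derive_measurable (@is_derive_mills R).
apply: measurable_fun_ifT; first exact: measurable_le0.
  apply: measurableT_comp => //; apply: measurable_funM => //.
  by apply: (measurableT_comp mm); exact: oppr_measurable.
apply: measurable_funB; first by apply: measurable_funM.
exact: is_derive_measurable (is_derive_tail_ratio a).
Qed.

Lemma measurable_hexp_int : measurable_fun [set: R] (hexp_int a).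
Proof.
apply: measurable_fun_ifT; first exact: measurable_le0.
  exact: measurable_cst.
exact: is_derive_measurable (is_derive_expint a).
Qed.

Lemma measurable_hexp : measurable_fun [set: R] (hexp a).
Proof.
apply: measurable_fun_ifT.
- by apply: measurable_fun_ltr => //; exact: measurable_cst.
- apply: measurableT_comp; first exact: measurable_expR.
  by apply: measurableT_comp => //; exact: measurable_funM.
- exact: measurable_cst.
Qed.

Lemma measurable_pos : measurable_fun [set: R] (@pos R).
Proof. by apply: measurable_maxr => //; exact: measurable_cst. Qed.

Lemma measurable_smooth d : measurable_fun [set: R] (stein_smooth a nu d).
Proof.
have mD c : measurable_fun [set: R] (fun w : R => w + c).
  by apply: measurable_funD => //; exact: measurable_cst.
apply: measurable_funD; first apply: measurable_funB.
- exact: measurable_stein_F.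
- exact: measurable_hexp_int.
apply: measurable_funD; first apply: measurable_funB.
- exact: measurableT_comp measurable_pos (mD d).
- exact: measurableT_comp measurable_pos (mD (- d)).
exact: measurableT_comp measurable_hexp_int (mD (- d)).
Qed.

Lemma stein_F_bound w : `|stein_F a nu w| <= 2 * mills 0.
Proof.
have n0 := nu_ge0 nuE; have n1 := nu_le a0 nuE; have m0 := @mills0_gt0 R.
have b x : 0 <= x -> 0 <= nu * mills x <= mills 0.
  move=> x0; rewrite mulr_ge0 ?mills_ge0//= -[leRHS]mul1r ler_pM ?mills_ge0//.
    lra.
  by rewrite mills_nincr.
rewrite /stein_F; case: (leP w 0) => w0.
  have wn : 0 <= - w by rewrite oppr_ge0.
  have /andP[b1 b2] := b _ wn.
  by rewrite normrN ger0_norm//; lra.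
have /andP[b1 b2] := b w (ltW w0).
have := tail_ratio_ge0 a w; have := tail_ratio_le a0 (ltW w0).
by rewrite ler_norml => *; apply/andP; split; lra.
Qed.

Lemma hexp_bound w : 0 <= hexp a w <= 1.
Proof.
rewrite /hexp; case: ltP => w0; last by rewrite lexx ler01.
by rewrite expR_ge0 expR_le1 oppr_le0 mulr_ge0// ltW.
Qed.

Context d (T : measurableType d).

Lemma bmeas_bounded (h : R -> R) (C : R) (Y : T -> R) : measurable_fun [set: R] h ->
  (forall x, `|h x| <= C) -> bmeas Y -> bmeas (fun w => h (Y w)).
Proof.
by move=> mh hC bY; apply: bmeas_comp => // M; exists C.
Qed.

Lemma bmeas_stein_F (Y : T -> R) : bmeas Y -> bmeas (fun w => stein_F a nu (Y w)).
Proof. exact: bmeas_bounded measurable_stein_F stein_F_bound. Qed.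

Lemma bmeas_hexp (Y : T -> R) : bmeas Y -> bmeas (fun w => hexp a (Y w)).
Proof.
apply: (@bmeas_bounded _ 1) => [|x]; first exact: measurable_hexp.
by have /andP[h0 h1] := hexp_bound x; rewrite ger0_norm.
Qed.

Lemma stein_smooth_bound e w : 0 <= e ->
  `|stein_smooth a nu e w| <= 2 * mills 0 + 2 * e /\
  `|stein_smooth a nu (- e) w| <= 2 * mills 0 + 2 * e.
Proof.
move=> e0; have := stein_F_bound w; have [h1 h2] := stein_smooth_center a0 nu w e0.
by move: h1 h2; rewrite !ler_norml => /andP[? ?] /andP[? ?] /andP[? ?]; split; apply/andP; split; lra.
Qed.
End stein_measurable.

Section tilting.
Context d (T : measurableType d) (R : realType) (P : probability T R).
Variables (n : nat) (X : 'I_n -> T -> R).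
Hypothesis mX : forall i, measurable_fun [set: T] (X i).
Hypothesis X1 : forall i w, `|X i w| <= 1.
Hypothesis indep : mutually_independent P X.
Variable lam : R.

Local Notation E := (Ex P).

Definition total w := \sum_i X i w.
Definition total_but i w := \sum_(j | j != i) X j w.
Definition exp_weight i w := expR (lam * X i w).
Definition exp_total w := expR (lam * total w).
Definition mgf i := E (exp_weight i).
Definition tilt_mean i := E (fun w => exp_weight i w * X i w) / mgf i.
Definition tilt_centered i w := X i w - tilt_mean i.
Definition tilt_var i := E (fun w => exp_weight i w * tilt_centered i w ^+ 2) / mgf i.

Lemma bmeas_X i : bmeas (X i).
Proof. by split => //; exists 1. Qed.

Lemma S_split i w : total w = total_but i w + X i w.
Proof. by rewrite /total /total_but (bigD1 i)//= addrC. Qed.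

Lemma W_split i w : exp_total w = expR (lam * total_but i w) * exp_weight i w.
Proof. by rewrite /exp_total (S_split i) mulrDr expRD. Qed.

Lemma bmeas_S : bmeas total.
Proof. by apply: bmeas_sum; exact: bmeas_X. Qed.

Lemma SrE i w : total_but i w = sumX X [seq j <- index_enum 'I_n | j != i] w.
Proof. by rewrite /sumX big_filter. Qed.

Lemma bmeas_Sr i : bmeas (total_but i).
Proof.
rewrite (_ : total_but i = sumX X [seq j <- index_enum 'I_n | j != i]).
  by apply: bmeas_sum; exact: bmeas_X.
by apply/funext => w; exact: SrE.
Qed.

Lemma bmeas_ew i : bmeas (exp_weight i).
Proof. by apply: bmeas_expR; apply: bmeasM (bmeas_X i); exact: bmeas_cst. Qed.

Lemma bmeas_W : bmeas exp_total.
Proof. by apply: bmeas_expR; apply: bmeasM bmeas_S; exact: bmeas_cst. Qed.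

Lemma bmeas_cX i : bmeas (tilt_centered i).
Proof. by apply: bmeasB (bmeas_X i) _; exact: bmeas_cst. Qed.

Lemma mgf_gt0 i : 0 < mgf i.
Proof.
apply: (@lt_le_trans _ _ (expR (- `|lam|))); first exact: expR_gt0.
rewrite -[leLHS](Ex_cst P); apply: Ex_le; [exact: bmeas_cst | exact: bmeas_ew |].
move=> w; rewrite ler_expR lerNl -mulrN.
apply: le_trans (ler_norm _) _; rewrite normrM normrN.
by rewrite -[leRHS]mulr1 ler_wpM2l.
Qed.

Lemma indep_Sr i : indep2 P (total_but i) (X i).
Proof.
have h := indep_sum_one mX indep (s := [seq j <- index_enum 'I_n | j != i]) (k := i).
have -> : total_but i = sumX X [seq j <- index_enum 'I_n | j != i].
  by apply/funext => w; exact: SrE.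
apply: h; first by rewrite filter_uniq// index_enum_uniq.
by rewrite mem_filter eqxx.
Qed.

Lemma Ex_indep_prod i (f g : R -> R) : measurable_fun [set: R] f ->
  measurable_fun [set: R] g -> bmeas (fun w => f (total_but i w)) ->
  bmeas (fun w => g (X i w)) ->
  E (fun w => f (total_but i w) * g (X i w)) = E (fun w => f (total_but i w)) * E (fun w => g (X i w)).
Proof.
move=> mf mg bf bg; have [_ [Cf fC]] := bf; have [_ [Cg gC]] := bg.
pose Psi (ux : R * R) := f ux.1 * g ux.2.
rewrite -[LHS]/(E (fun w => Psi (total_but i w, X i w))).
rewrite (@Ex_indep2 _ _ _ P (total_but i) (X i) Psi (Cf * Cg) (bmeas_Sr i).1 (mX i) _ _ (indep_Sr i)).
- rewrite -ExZl//; apply: eq_Ex => z.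
  by rewrite /Psi /= -ExZr//; apply: eq_Ex.
- by apply: measurable_funM; apply: measurableT_comp.
by move=> w z; rewrite /Psi /= normrM ler_pM.
Qed.

(** [exp_total] factors into a function of [total_but i] and [exp_weight i]. Once [X i] is frozen at
    a second sample [z], the weight [exp_weight i w] is independent of everything else and
    contributes [mgf i]. Keeping it inside [exp_total] lets [X i w] and [X i z] be two independent
    tilted copies of the same summand. *)
Lemma tilt_split i (Psi : R * R -> R) (C : R) : measurable_fun [set: R * R] Psi ->
  (forall w z, `|Psi (total_but i w, X i z)| <= C) ->
  bmeas (fun z => E (fun w => exp_total w * (exp_weight i z * Psi (total_but i w, X i z)))) /\
  E (fun w => exp_total w * Psi (total_but i w, X i w)) * mgf i =
  E (fun z => E (fun w => exp_total w * (exp_weight i z * Psi (total_but i w, X i z)))).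
Proof.
move=> mPsi PsiC; have [_ [Cs sC]] := bmeas_Sr i.
pose Phi (ux : R * R) := expR (lam * ux.1) * (expR (lam * ux.2) * Psi ux).
have mPhi : measurable_fun [set: R * R] Phi.
  by apply: measurable_funM; [|apply: measurable_funM => //];
    (apply: measurableT_comp; [exact: measurable_expR|apply: measurable_funM => //; exact: measurable_cst]).
have sub z : bmeas (fun w => expR (lam * total_but i w) * Psi (total_but i w, X i z)).
  apply: bmeasM.
    by apply: bmeas_expR; apply: bmeasM; [exact: bmeas_cst | exact: bmeas_Sr].
  split; last by exists C.
  apply: (measurableT_comp mPsi); apply/measurable_fun_pair; last exact: measurable_cst.
  exact: (bmeas_Sr i).1.
have key z : E (fun w => exp_total w * (exp_weight i z * Psi (total_but i w, X i z))) =
             E (fun w => Phi (total_but i w, X i z)) * mgf i.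
  rewrite -[LHS](_ : exp_weight i z * E (fun w =>
      (expR (lam * total_but i w) * Psi (total_but i w, X i z)) * exp_weight i w) = _).
    rewrite (@Ex_indep_prod i (fun u => expR (lam * u) * Psi (u, X i z)) (fun x => expR (lam * x))) //.
    - rewrite -/(mgf i) mulrA; congr (_ * mgf i); rewrite -(ExZl P (exp_weight i z) (sub z)).
      by apply: eq_Ex => w; rewrite /Phi /exp_weight/=; ring.
    - apply: measurable_funM.
        by apply: measurableT_comp; [exact: measurable_expR|apply: measurable_funM => //; exact: measurable_cst].
      by apply: (measurableT_comp mPsi); apply/measurable_fun_pair => //; exact: measurable_cst.
    - by apply: measurableT_comp; [exact: measurable_expR|apply: measurable_funM => //; exact: measurable_cst].
    - exact: bmeas_ew.
  rewrite -ExZl; last by apply: bmeasM => //; exact: bmeas_ew.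
  by apply: eq_Ex => w; rewrite (W_split i); ring.
have PhiC w z : `|Phi (total_but i w, X i z) * mgf i| <=
    expR (`|lam| * Cs) * (expR `|lam| * C) * `|mgf i|.
  rewrite normrM ler_wpM2r//.
  rewrite /Phi !normrM !(ger0_norm (expR_ge0 _)) ler_pM ?expR_ge0 ?mulr_ge0 ?expR_ge0//.
    by rewrite ler_expR (le_trans (ler_norm _))// normrM ler_wpM2l ?normr_ge0 ?sC.
  rewrite ler_pM ?expR_ge0 ?normr_ge0 ?PsiC//.
  by rewrite ler_expR (le_trans (ler_norm _))// normrM -[leRHS]mulr1 ler_wpM2l ?normr_ge0 ?X1.
have mPhi' : measurable_fun [set: R * R] (fun ux => Phi ux * mgf i).
  by apply: measurable_funM => //; exact: measurable_cst.
have bX : bmeas (fun w => exp_total w * Psi (total_but i w, X i w)).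
  apply: bmeasM bmeas_W _; split; last by exists C.
  apply: (measurableT_comp mPsi); apply/measurable_fun_pair => //.
  exact: (bmeas_Sr i).1.
have PhiE z w : expR (lam * total_but i w) * (exp_weight i z * Psi (total_but i w, X i z)) =
  Phi (total_but i w, X i z).
  by [].
have keyf : (fun z => E (fun w => exp_total w * (exp_weight i z * Psi (total_but i w, X i z)))) =
            (fun z => E (fun w => Phi (total_but i w, X i z) * mgf i)).
  apply/funext => z; rewrite key -ExZr//.
  rewrite (_ : (fun w => Phi (total_but i w, X i z)) = fun w =>
    (expR (lam * total_but i w) * Psi (total_but i w, X i z)) * exp_weight i z).
    by apply: bmeasM => //; exact: bmeas_cst.
  by apply/funext => w; rewrite -PhiE; ring.
rewrite keyf; split.
  exact: (@bmeas_Ex_section _ _ _ P (total_but i) (X i) (fun ux => Phi ux * mgf i) _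
           (bmeas_Sr i).1 (mX i) mPhi' PhiC).
rewrite -ExZr//.
have -> : E (fun w => exp_total w * Psi (total_but i w, X i w) * mgf i) =
          E (fun w => Phi (total_but i w, X i w) * mgf i).
  by apply: eq_Ex => w; rewrite (W_split i) -PhiE; ring.
exact: (Ex_indep2 (bmeas_Sr i).1 (mX i) mPhi' PhiC (indep_Sr i)).
Qed.
End tilting.

(** For [m >= 0] the worst case of [1 - m ^+ 2 - m * u / 2] is [u = - m - 1], where it equals
    [1 + m / 2 - m ^+ 2 / 2], with maximum [9 / 8] at [m = 1 / 2]. Negative [m] is symmetric. *)
Lemma cubic_coef_le (R : realFieldType) (m u : R) :
  - m - 1 <= u -> u <= - m + 1 ->
  (1 - m ^+ 2) * u ^+ 2 - m * (u ^+ 3 / 2) <= 9 / 8 * u ^+ 2.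
Proof.
move=> u1 u2.
have -> : (1 - m ^+ 2) * u ^+ 2 - m * (u ^+ 3 / 2) = u ^+ 2 * (1 - m ^+ 2 - m * u / 2).
  by field.
rewrite mulrC ler_wpM2r ?sqr_ge0//; have [mp|/ltW mn] := leP 0 m.
  have : 0 <= m * (u + m + 1) by apply: mulr_ge0 => //; lra.
  have := sqr_ge0 (m - 1 / 2); lra.
have : 0 <= - m * (1 - m - u) by rewrite mulr_ge0 ?oppr_ge0//; lra.
have := sqr_ge0 (m + 1 / 2); lra.
Qed.

(** * Normal approximation under the tilted law *)

Section tilted_berry_esseen.
Context d (T : measurableType d) (R : realType) (P : probability T R).
Variables (n : nat) (X : 'I_n -> T -> R).
Hypothesis mX : forall i, measurable_fun [set: T] (X i).
Hypothesis X1 : forall i w, `|X i w| <= 1.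
Hypothesis indep : mutually_independent P X.
Variable lam : R.
Local Notation E := (Ex P).
Local Notation S := (total X).
Local Notation Sr := (total_but X).
Local Notation ew := (exp_weight X lam).
Local Notation W := (exp_total X lam).
Local Notation mgf := (mgf P X lam).
Local Notation tmean := (tilt_mean P X lam).
Local Notation cX := (tilt_centered P X lam).
Local Notation tvar := (tilt_var P X lam).
Local Notation M := (E W).
Local Notation c := (\sum_i tmean i).

Let bX i : bmeas (X i) := bmeas_X mX X1 i.
Let bS : bmeas S := bmeas_S mX X1.
Let bSr i : bmeas (Sr i) := bmeas_Sr mX X1 i.
Let bew i : bmeas (ew i) := bmeas_ew mX X1 lam i.
Let bW : bmeas W := bmeas_W mX X1 lam.
Let bcX i : bmeas (cX i) := bmeas_cX P mX X1 lam i.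
Let mgf0 i : 0 < mgf i := mgf_gt0 P mX X1 lam i.

(** Expectations below are computed by bringing the integrand into this shape, padded with a zero
    term where needed. *)
Lemma Ex_lin3 (c1 c2 c3 : R) (F1 F2 F3 : T -> R) : bmeas F1 -> bmeas F2 -> bmeas F3 ->
  E (fun w => c1 * F1 w + c2 * F2 w + c3 * F3 w) = c1 * E F1 + c2 * E F2 + c3 * E F3.
Proof.
move=> b1 b2 b3; rewrite ExD; [rewrite ExD| |]; try by bmeas_tac.
  by rewrite !ExZl.
Qed.

Lemma Ex_ew_cX i : E (fun w => ew i w * cX i w) = 0.
Proof.
rewrite (_ : (fun _ => _) = fun w => ew i w * X i w - ew i w * tmean i); last first.
  by apply/funext => w; rewrite /cX mulrBr.
rewrite ExB; [|by bmeas_tac|by bmeas_tac].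
rewrite ExZr// -/(mgf i) /tmean mulrCA divff ?mulr1 ?subrr//.
by rewrite gt_eqF.
Qed.

Lemma Ex_ew_cX2 i : E (fun w => ew i w * cX i w ^+ 2) = tvar i * mgf i.
Proof. by rewrite /tvar divfK// gt_eqF. Qed.

Lemma tvar_ge0 i : 0 <= tvar i.
Proof.
rewrite divr_ge0 ?(ltW (mgf0 i))//; apply: Ex_ge0 => w.
by rewrite mulr_ge0 ?expR_ge0 ?sqr_ge0.
Qed.

Lemma tmean_bound i : -1 <= tmean i <= 1.
Proof.
have h w : - ew i w <= ew i w * X i w <= ew i w.
  have := X1 i w; rewrite ler_norml => /andP[x1 x2].
  have := expR_ge0 (lam * X i w); rewrite -/(ew i w) => e0.
  by apply/andP; split; nra.
rewrite ler_pdivlMr// ler_pdivrMr// mul1r mulN1r -(ExN P (bew i)).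
by apply/andP; split; apply: Ex_le; try (by bmeas_tac);
  move=> w; have /andP[] := h w.
Qed.

Lemma cX_bound i w : - tmean i - 1 <= cX i w <= - tmean i + 1.
Proof.
by have := X1 i w; rewrite ler_norml /cX => /andP[? ?]; apply/andP; split; lra.
Qed.

Lemma sum_cX w : S w - c = \sum_i cX i w.
Proof. by rewrite -sumrB. Qed.

Let mx1 : measurable_fun [set: R * R] (fun ux : R * R => ux.1).
Proof. exact: measurable_fst. Qed.

Let mx2 : measurable_fun [set: R * R] (fun ux : R * R => ux.2).
Proof. exact: measurable_snd. Qed.

Lemma cX_norm i w : `|cX i w| <= 2.
Proof.
have := cX_bound i w; have := tmean_bound i => /andP[? ?] /andP[? ?].
by rewrite ler_norml; apply/andP; split; lra.
Qed.

Lemma Ex_W_cX i : E (fun w => W w * cX i w) = 0.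
Proof.
have mPsi : measurable_fun [set: R * R] (fun ux : R * R => ux.2 - tmean i).
  by apply: measurable_funB => //; exact: measurable_cst.
have PsiC w z : `|(fun ux : R * R => ux.2 - tmean i) (Sr i w, X i z)| <= 2.
  exact: cX_norm i z.
have [_ /= h] := tilt_split mX X1 indep lam mPsi PsiC.
have : E (fun w => W w * cX i w) * mgf i = 0.
  rewrite h -[RHS](mulr0 M) -(Ex_ew_cX i) -ExZl; last by bmeas_tac.
  by apply: eq_Ex => z; rewrite -ExZr.
by move/eqP; rewrite mulf_eq0 (gt_eqF (mgf0 i)) orbF => /eqP.
Qed.

Lemma Ex_W_S : E (fun w => W w * (S w - c)) = 0.
Proof.
rewrite (_ : (fun _ => _) = fun w => \sum_i W w * cX i w); last first.
  by apply/funext => w; rewrite sum_cX mulr_sumr.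
by rewrite Ex_sum => [|i]; [rewrite big1// => i _; exact: Ex_W_cX | bmeas_tac].
Qed.

(** After resampling, the rest of the sum multiplies the weighted mean of [cX i], which is [0]; only
    the square of [cX i] remains. *)
Lemma Ex_W_cX_S i : E (fun w => W w * (cX i w * (S w - c))) = tvar i * M.
Proof.
pose Psi (ux : R * R) := (ux.2 - tmean i) * (ux.1 + ux.2 - c).
have mPsi : measurable_fun [set: R * R] Psi.
  apply: measurable_funM; first by apply: measurable_funB => //; exact: measurable_cst.
  by apply: measurable_funB; [exact: measurable_funD | exact: measurable_cst].
have [_ [Cs sC]] := bSr i.
have PsiC w z : `|Psi (Sr i w, X i z)| <= 2 * (Cs + 1 + `|c|).
  rewrite /Psi normrM ler_pM//; first exact: cX_norm i z.
  apply: le_trans (ler_normB _ _) _; rewrite lerD2r.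
  by apply: le_trans (ler_normD _ _) _; rewrite lerD ?sC ?X1.
have [_ h] := tilt_split mX X1 indep lam mPsi PsiC.
have : E (fun w => W w * (cX i w * (S w - c))) * mgf i = tvar i * M * mgf i.
  rewrite (_ : (fun w => W w * (cX i w * _)) = fun w => W w * Psi (Sr i w, X i w)); last first.
    by apply/funext => w; rewrite /Psi /= (S_split X i).
  rewrite h; pose A := E (fun w => W w * (Sr i w - (c - tmean i))).
  transitivity (E (fun z => A * (ew i z * cX i z) + M * (ew i z * cX i z ^+ 2) + 0 * cX i z)).
    apply: eq_Ex => z.
    rewrite -[RHS](_ : E (fun w => (ew i z * cX i z) * (W w * (Sr i w - (c - tmean i)))
       + (ew i z * cX i z ^+ 2) * W w + 0 * W w) = _); last first.
      by rewrite Ex_lin3//; [rewrite -/A; ring | bmeas_tac].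
    by apply: eq_Ex => w; rewrite /Psi /cX /=; ring.
  rewrite Ex_lin3; [|by bmeas_tac..].
  by rewrite Ex_ew_cX Ex_ew_cX2; ring.
by move/eqP; rewrite -subr_eq0 -mulrBl mulf_eq0 (gt_eqF (mgf0 i)) orbF subr_eq0 => /eqP.
Qed.

Lemma Ex_W_S2 : E (fun w => W w * (S w - c) ^+ 2) = (\sum_i tvar i) * M.
Proof.
rewrite mulr_suml -(eq_bigr _ (fun i _ => Ex_W_cX_S i)) -Ex_sum => [|i]; last first.
  by bmeas_tac.
apply: eq_Ex => w; rewrite -mulr_sumr expr2 {1}sum_cX; congr (_ * _).
by rewrite mulr_suml.
Qed.

(** [tilt_split] turns the right-hand side into a double mean of [u * f (e + u / s)], with
    [u = cX i z] and [e] the normalized sum without its centred [i]-th term; [u * f e] can be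
    subtracted since [u] has weighted mean [0]. The hypothesis compares the increment with
    [u ^+ 2 / s * g (e + v / s)] for [v = cX i w]. There [e + v / s] is the full normalized sum at
    [w], free of [u], so the mean factors. *)
Lemma tilt_step i (f g : R -> R) (s Cf Kc : R) : 0 < s -> 0 <= Kc ->
  measurable_fun [set: R] f -> (forall x, `|f x| <= Cf) ->
  bmeas (fun w => g ((S w - c) / s)) ->
  (forall u v e, - tmean i - 1 <= u <= - tmean i + 1 ->
     - tmean i - 1 <= v <= - tmean i + 1 ->
     u ^+ 2 / s * g (e + v / s) -
       Kc / s ^+ 2 * ((1 - (- tmean i) ^+ 2 + - tmean i * v) * u ^+ 2
                     + (- tmean i - v) * (u ^+ 3 / 2))
       <= u * (f (e + u / s) - f e)) ->
  tvar i / s * E (fun w => W w * g ((S w - c) / s)) - 9 / 8 * Kc / s ^+ 2 * tvar i * M <=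
  E (fun w => W w * (cX i w * f ((S w - c) / s))).
Proof.
move=> s0 K0 mf fC bg step.
pose Psi (ux : R * R) := (ux.2 - tmean i) * f ((ux.1 + ux.2 - c) / s).
have mPsi : measurable_fun [set: R * R] Psi.
  apply: measurable_funM; first by apply: measurable_funB => //; exact: measurable_cst.
  apply: (measurableT_comp mf); apply: measurable_funM; last exact: measurable_cst.
  by apply: measurable_funB; [exact: measurable_funD | exact: measurable_cst].
have PsiC w z : `|Psi (Sr i w, X i z)| <= 2 * Cf.
  by rewrite /Psi normrM ler_pM ?normr_ge0 ?fC//; exact: cX_norm i z.
have [bh h] := tilt_split mX X1 indep lam mPsi PsiC.
pose v w := (Sr i w - (c - tmean i)) / s.
have bfv : bmeas (fun w => f (v w)).
  split; last by exists Cf.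
  apply: (measurableT_comp mf); apply: measurable_funM; last exact: measurable_cst.
  by apply: measurable_funB; [exact: (bSr i).1 | exact: measurable_cst].
pose A1 := E (fun w => W w * f (v w)).
pose A2 := E (fun w => W w * g ((S w - c) / s)).
have M0 : 0 <= M by apply: Ex_ge0 => w; exact: expR_ge0.
rewrite -(ler_pM2r (mgf0 i)).
rewrite [leRHS](_ : _ = E (fun w => W w * Psi (Sr i w, X i w)) * mgf i); last first.
  by congr (_ * _); apply: eq_Ex => w; rewrite /Psi /= (S_split X i).
rewrite h.
(* The term in [A1] has mean [0]; it stands for the subtracted [u * f e]. *)
rewrite [leLHS](_ : _ = E (fun z => A1 * (ew i z * cX i z)
   + (A2 / s - 9 / 8 * Kc / s ^+ 2 * M) * (ew i z * cX i z ^+ 2) + 0 * cX i z)); last first.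
  rewrite Ex_lin3; [|by bmeas_tac..].
  by rewrite Ex_ew_cX Ex_ew_cX2 -/A2; ring.
apply: Ex_le => [|//|z]; first by bmeas_tac.
pose m := tmean i; pose u := cX i z.
have /andP[m1 m2] := tmean_bound i; have ub := cX_bound i z.
pose al := (1 - m ^+ 2) * u ^+ 2 - m * (u ^+ 3 / 2).
pose ga := - m * u ^+ 2 - u ^+ 3 / 2.
have alle : al <= 9 / 8 * u ^+ 2.
  by move/andP: ub => [u1 u2]; exact: cubic_coef_le.
apply: le_trans (_ : ew i z * (u * A1 + u ^+ 2 / s * A2 - Kc / s ^+ 2 * (al * M)) <= _).
  have e0 : 0 <= ew i z by exact: expR_ge0.
  have k0 : 0 <= Kc / s ^+ 2 * M by rewrite mulr_ge0 ?divr_ge0 ?sqr_ge0.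
  have : Kc / s ^+ 2 * M * al <= Kc / s ^+ 2 * M * (9 / 8 * u ^+ 2) by rewrite ler_wpM2l.
  move/(ler_wpM2l e0); rewrite -/u; lra.
have bWv : bmeas (fun w => W w * f (v w)) by bmeas_tac.
have bWg : bmeas (fun w => W w * g ((S w - c) / s)) by bmeas_tac.
have bWa : bmeas (fun w => W w * (al + ga * cX i w)) by bmeas_tac.
(* The error is affine in [cX i w]; its slope [ga] is annihilated by [Ex_W_cX], and [al] is left for
   [cubic_coef_le]. *)
have EWa : E (fun w => W w * (al + ga * cX i w)) = al * M.
  transitivity (E (fun w => al * W w + ga * (W w * cX i w) + 0 * W w)).
    by apply: eq_Ex => w; ring.
  rewrite Ex_lin3; [|by bmeas_tac..].
  by rewrite Ex_W_cX; ring.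
rewrite [leLHS](_ : _ = E (fun w => (ew i z * u) * (W w * f (v w))
    + (ew i z * (u ^+ 2 / s)) * (W w * g ((S w - c) / s))
    + (- (ew i z * (Kc / s ^+ 2))) * (W w * (al + ga * cX i w)))); last first.
  by rewrite Ex_lin3// EWa -/A1 -/A2; ring.
have bz : bmeas (fun w => Psi (Sr i w, X i z)).
  exact: bmeas_section (bSr i).1 mPsi PsiC z.
apply: Ex_le => [||w]; [by bmeas_tac|by bmeas_tac|].
have := step u (cX i w) (v w) ub (cX_bound i w).
have -> : v w + cX i w / s = (S w - c) / s.
  by rewrite /v /cX (S_split X i) -mulrDl; congr (_ / _); ring.
have -> : v w + u / s = (Sr i w + X i z - c) / s.
  by rewrite /v /u /cX -mulrDl; congr (_ / _); ring.
have e0 : 0 <= W w * ew i z by rewrite mulr_ge0 ?expR_ge0.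
move/(ler_wpM2l e0); rewrite /Psi /al /ga -/m /=; rewrite -/u.
set fv := f (v w); set fu := f (_ / s); set gg := g _.
rewrite (_ : X i z - tmean i = u)//; lra.
Qed.
Section sum_steps.
Variable s : R.
Hypotheses (s0 : 0 < s) (s2 : s ^+ 2 = \sum_i tvar i).
Local Notation Y := (fun w => (S w - c) / s).

Let bY : bmeas Y.
Proof. by bmeas_tac. Qed.

Lemma Ex_W_Y : E (fun w => W w * Y w) = 0.
Proof.
rewrite (_ : (fun _ => _) = fun w => s^-1 * (W w * (S w - c))).
  by rewrite ExZl ?Ex_W_S ?mulr0//; bmeas_tac.
by apply/funext => w; ring.
Qed.

Lemma Ex_W_Y2 : E (fun w => W w * Y w ^+ 2) = M.
Proof.
rewrite (_ : (fun _ => _) = fun w => s^-2 * (W w * (S w - c) ^+ 2)).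
  rewrite ExZl; last by bmeas_tac.
  by rewrite Ex_W_S2 -s2 mulrA mulVf ?mul1r// sqrf_eq0 gt_eqF.
by apply/funext => w; rewrite expr_div_n; ring.
Qed.

Lemma tilt_sum_steps (f g : R -> R) (Cf Kc : R) : 0 <= Kc ->
  measurable_fun [set: R] f -> (forall x, `|f x| <= Cf) -> bmeas (fun w => g (Y w)) ->
  (forall b u v e, b - 1 <= 0 <= b + 1 -> b - 1 <= u <= b + 1 -> b - 1 <= v <= b + 1 ->
     u ^+ 2 / s * g (e + v / s) -
       Kc / s ^+ 2 * ((1 - b ^+ 2 + b * v) * u ^+ 2 + (b - v) * (u ^+ 3 / 2))
       <= u * (f (e + u / s) - f e)) ->
  E (fun w => W w * g (Y w)) - 9 / 8 * Kc / s * M <= E (fun w => W w * (Y w * f (Y w))).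
Proof.
move=> K0 mf fC bg step.
have bf : bmeas (fun w => f (Y w)) by apply: bmeas_bounded mf fC bY.
have sn0 : s != 0 by rewrite gt_eqF.
rewrite -(ler_pM2l s0).
rewrite [leRHS](_ : _ = \sum_i E (fun w => W w * (cX i w * f (Y w)))); last first.
  rewrite -ExZl; last by bmeas_tac.
  rewrite -Ex_sum => [|i]; last by bmeas_tac.
  apply: eq_Ex => w; rewrite -mulr_sumr -mulr_suml -sum_cX; field.
  by rewrite sn0.
rewrite [leLHS](_ : _ = \sum_i (tvar i / s * E (fun w => W w * g (Y w))
    - 9 / 8 * Kc / s ^+ 2 * tvar i * M)); last first.
  rewrite sumrB -!mulr_suml -mulr_sumr -s2; field.
  by rewrite sn0.
apply: ler_sum => i _; apply: (tilt_step s0 K0 mf fC bg) => u v e hu hv.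
apply: step => //; have /andP[? ?] := tmean_bound i; apply/andP; split; lra.
Qed.

Hypothesis lam0 : 0 <= lam.
Local Notation a := (lam * s).
Local Notation nu := (Theta a).
Local Notation dl := (2 / s).

Theorem tilted_normal_approx :
  `|E (fun w => W w * hexp a (Y w)) - nu * M| <= (2 + 9 / 8 * lip a) / s * M.
Proof.
have a0 : 0 <= a by rewrite mulr_ge0// ltW.
have nuE := ThetaE a.
have d0 : 0 <= dl by rewrite divr_ge0// ltW.
have bF := bmeas_stein_F a0 nuE bY.
have bH := bmeas_hexp a0 bY.
have bT : bmeas (fun w => stein_target a nu (Y w)).
  by rewrite /stein_target /stein_G; bmeas_tac.
have M0 : 0 <= M by apply: Ex_ge0 => w; exact: expR_ge0.
have ET : E (fun w => W w * stein_target a nu (Y w)) =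
    E (fun w => W w * hexp a (Y w)) - nu * M + E (fun w => W w * (Y w * stein_F a nu (Y w))).
  transitivity (E (fun w => 1 * (W w * hexp a (Y w)) + (- nu) * W w
                  + 1 * (W w * (Y w * stein_F a nu (Y w))))).
    by apply: eq_Ex => w; rewrite /stein_target /stein_G; ring.
  by rewrite Ex_lin3 ?mul1r ?mulNr//; bmeas_tac.
(* Subtracting the constant [e] is free because [W * Y] has mean [0]. Then the norm of [Y] is at
   most [(1 + Y ^+ 2) / 2], and [Ex_W_Y2] yields [dl * M], the summand [2] of the final constant. *)
have bound (e : R) (q : T -> R) : bmeas q -> (forall w, `|q w - stein_F a nu (Y w) - e| <= dl) ->
    `|E (fun w => W w * (Y w * q w)) - E (fun w => W w * (Y w * stein_F a nu (Y w)))| <= dl * M.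
  move=> bq hq.
  have -> : E (fun w => W w * (Y w * q w)) - E (fun w => W w * (Y w * stein_F a nu (Y w))) =
      E (fun w => W w * (Y w * (q w - stein_F a nu (Y w) - e))).
    transitivity (E (fun w => 1 * (W w * (Y w * q w)) + (-1) * (W w * (Y w * stein_F a nu (Y w)))
                     + (- e) * (W w * Y w))).
      by rewrite Ex_lin3; [rewrite Ex_W_Y; ring | bmeas_tac..].
    by apply: eq_Ex => w; ring.
  have E1 : E (fun w => dl / 2 * W w + dl / 2 * (W w * Y w ^+ 2) + 0 * W w) = dl * M.
    rewrite Ex_lin3; [|by bmeas_tac..].
    by rewrite Ex_W_Y2; field; rewrite gt_eqF.
  have hp w : `|W w * (Y w * (q w - stein_F a nu (Y w) - e))| <=
              dl / 2 * W w + dl / 2 * (W w * Y w ^+ 2) + 0 * W w.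
    have W0 : 0 <= W w by exact: expR_ge0.
    rewrite normrM (ger0_norm W0) normrM.
    have -> : dl / 2 * W w + dl / 2 * (W w * Y w ^+ 2) + 0 * W w =
              W w * (dl * ((1 + Y w ^+ 2) / 2)) by field; rewrite gt_eqF.
    rewrite ler_wpM2l// mulrC ler_pM//.
    rewrite -real_normK ?num_real//; have := sqr_ge0 (`|Y w| - 1); lra.
  rewrite ler_norml -E1 -ExN; last by bmeas_tac.
  apply/andP; split; apply: Ex_le; try by bmeas_tac.
    by move=> w; have := hp w; rewrite ler_norml => /andP[].
  by move=> w; have := hp w; rewrite ler_norml => /andP[].
have dE : (2 + 9 / 8 * lip a) / s * M = dl * M + 9 / 8 * lip a / s * M by ring.
rewrite ler_norml dE; apply/andP; split.
  (* The lower bound takes the lower smoothing with all signs reversed, so that the one-sided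
     [tilt_sum_steps] serves both directions. *)
  pose f x := - stein_smooth a nu (- dl) x.
  have mf : measurable_fun [set: R] f.
    by apply: measurableT_comp => //; exact: measurable_smooth.
  have fC x : `|f x| <= 2 * mills 0 + 2 * dl.
    by rewrite normrN; have [_] := stein_smooth_bound a0 nuE x d0.
  have bT' : bmeas (fun w => - stein_target a nu (Y w)) by bmeas_tac.
  have := @tilt_sum_steps f (fun x => - stein_target a nu x) _ _ (lip_ge0 a) mf fC bT'.
  have h : forall b u v e, b - 1 <= 0 <= b + 1 -> b - 1 <= u <= b + 1 -> b - 1 <= v <= b + 1 ->
     u ^+ 2 / s * - stein_target a nu (e + v / s) -
       lip a / s ^+ 2 * ((1 - b ^+ 2 + b * v) * u ^+ 2 + (b - v) * (u ^+ 3 / 2))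
       <= u * (f (e + u / s) - f e).
    move=> b u v e hb hu hv; have := stein_step_le a0 nuE s0 e hb hu hv.
    by rewrite /f /step_error; lra.
  move=> /(_ h).
  have bq : bmeas (fun w => stein_smooth a nu (- dl) (Y w)).
    apply: (@bmeas_bounded _ _ _ _ (2 * mills 0 + 2 * dl)) => //.
      exact: measurable_smooth.
    by move=> x; have [_] := stein_smooth_bound a0 nuE x d0.
  have hq w : `|stein_smooth a nu (- dl) (Y w) - stein_F a nu (Y w) - - dl| <= dl.
    by rewrite opprK; have [_] := stein_smooth_center a0 nu (Y w) d0.
  have := bound _ _ bq hq.
  rewrite (_ : E (fun w => W w * - stein_target a nu (Y w)) =
    - E (fun w => W w * stein_target a nu (Y w))); last first.
    rewrite -ExN; last by bmeas_tac.
    by apply: eq_Ex => w; rewrite mulrN.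
  rewrite (_ : E (fun w => W w * (Y w * f (Y w))) =
    - E (fun w => W w * (Y w * stein_smooth a nu (- dl) (Y w)))); last first.
    rewrite -ExN; last by bmeas_tac.
    by apply: eq_Ex => w; rewrite /f; ring.
  rewrite ET ler_norml => /andP[+ _]; lra.
have mf : measurable_fun [set: R] (stein_smooth a nu dl) by exact: measurable_smooth.
have fC x : `|stein_smooth a nu dl x| <= 2 * mills 0 + 2 * dl.
  by have [] := stein_smooth_bound a0 nuE x d0.
have := @tilt_sum_steps _ _ _ _ (lip_ge0 a) mf fC bT.
have h : forall b u v e, b - 1 <= 0 <= b + 1 -> b - 1 <= u <= b + 1 -> b - 1 <= v <= b + 1 ->
   u ^+ 2 / s * stein_target a nu (e + v / s) -
     lip a / s ^+ 2 * ((1 - b ^+ 2 + b * v) * u ^+ 2 + (b - v) * (u ^+ 3 / 2))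
     <= u * (stein_smooth a nu dl (e + u / s) - stein_smooth a nu dl e).
  move=> b u v e hb hu hv; have := stein_step_ge a0 nuE s0 e hb hu hv.
  by rewrite /step_error.
move=> /(_ h).
have bq : bmeas (fun w => stein_smooth a nu dl (Y w)) by apply: bmeas_bounded mf fC bY.
have hq w : `|stein_smooth a nu dl (Y w) - stein_F a nu (Y w) - dl| <= dl.
  by have [] := stein_smooth_center a0 nu (Y w) d0.
have := bound _ _ bq hq; rewrite ET ler_norml => /andP[_ +]; lra.
Qed.
End sum_steps.
End tilted_berry_esseen.

Section exp_facts.
Variable R : realType.

Lemma expR_tangent (u v : R) : expR u * (1 + (v - u)) <= expR v.
Proof.
have -> : expR v = expR u * expR (v - u) by rewrite -expRD addrC subrK.
by rewrite ler_wpM2l ?expR_ge0// expR_ge1Dx.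
Qed.

Lemma expR_chord (p u : R) : 0 <= p <= 1 -> expR (p * u) <= 1 - p + p * expR u.
Proof.
move=> /andP[p0 p1].
have := ler_wpM2l p0 (expR_tangent (p * u) u).
have p1' : 0 <= 1 - p by lra.
have := ler_wpM2l p1' (expR_tangent (p * u) 0).
rewrite expR0; lra.
Qed.

Lemma expR_dist (u v : R) : `|expR u - expR v| <= `|u - v| * (expR u + expR v).
Proof.
have h1 := expR_tangent u v; have h2 := expR_tangent v u.
have eu := expR_gt0 u; have ev := expR_gt0 v.
have [uv|/ltW uv] := leP u v.
  rewrite ler0_norm ?subr_le0 ?ler_expR// ler0_norm ?subr_le0//; nra.
rewrite ger0_norm ?subr_ge0 ?ler_expR// ger0_norm ?subr_ge0//; nra.
Qed.

(** This is the monotonicity of [(expR (mu * y) - 1) / y]. The factors [y] and [y - b] clear the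
    denominator, admit [y = 0] and let one inequality cover both sides of [b]. *)
Lemma expR_slope_mono (b y mu : R) : 0 < b -> 0 <= y ->
  (y - b) * (y * ((expR (mu * b) - 1) / b)) <= (y - b) * (expR (mu * y) - 1).
Proof.
move=> b0 y0; have [yb|by_] := leP y b.
  have yb0 : 0 <= b - y by rewrite subr_ge0.
  rewrite -lerN2 -!mulNr opprB ler_wpM2l//.
  have p : 0 <= y / b <= 1 by rewrite divr_ge0 ?(ltW b0)//= ler_pdivrMr// mul1r.
  have := expR_chord (mu * b) p.
  rewrite (_ : y / b * (mu * b) = mu * y); last by field; rewrite gt_eqF.
  lra.
have yb0 : 0 <= y - b by rewrite subr_ge0 ltW.
have ygt0 := lt_trans b0 by_.
rewrite ler_wpM2l//.
have p : 0 <= b / y <= 1 by rewrite divr_ge0 ?(ltW b0)//= ler_pdivrMr// mul1r ltW.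
have := expR_chord (mu * y) p.
rewrite (_ : b / y * (mu * y) = mu * b); last by field; rewrite gt_eqF.
move=> h; rewrite mulrA ler_pdivrMr//.
have h2 : expR (mu * b) - 1 <= b / y * (expR (mu * y) - 1) by lra.
have := ler_wpM2l (ltW ygt0) h2.
rewrite (_ : y * (b / y * _) = (expR (mu * y) - 1) * b)//; last by field; rewrite gt_eqF.
Qed.
End exp_facts.

(** * Bounds for the tilted means and variances *)

Section tilt_bounds.
Context d (T : measurableType d) (R : realType) (P : probability T R).
Variables (n : nat) (X : 'I_n -> T -> R).
Hypothesis mX : forall i, measurable_fun [set: T] (X i).
Hypothesis X1 : forall i w, `|X i w| <= 1.
Hypothesis indep : mutually_independent P X.
Local Notation E := (Ex P).
Local Notation q i := (E (fun w => X i w ^+ 2)).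
Hypothesis X0 : forall i, E (X i) = 0.

Let bX i : bmeas (X i) := bmeas_X mX X1 i.
Let X1l i w : -1 <= X i w. Proof. by have := X1 i w; rewrite ler_norml => /andP[]. Qed.
Let X1r i w : X i w <= 1. Proof. by have := X1 i w; rewrite ler_norml => /andP[]. Qed.

Let Ex_lin3 := @Ex_lin3 d T R P.

Lemma var_ge0 i : 0 <= q i.
Proof. by apply: Ex_ge0 => w; exact: sqr_ge0. Qed.

(* The integrand is minorized using the monotonicity of
   [y |-> (expR (mu * y) - 1) / y] with [y = 1 + Z]; the minorant has
   mean [- q]. *)
Lemma biased_exp_ge (Z : T -> R) (mu : R) : bmeas Z -> (forall w, -1 <= Z w) ->
  E Z = 0 ->
  - E (fun w => Z w ^+ 2) <= E (fun w => (Z w - E (fun w => Z w ^+ 2)) * expR (mu * (1 + Z w))).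
Proof.
move=> bZ Z1 Z0; set v := E _.
have v0 : 0 <= v by apply: Ex_ge0 => w; exact: sqr_ge0.
have b0 : 0 < 1 + v by rewrite ltr_pwDl.
pose k := (expR (mu * (1 + v)) - 1) / (1 + v).
rewrite [leLHS](_ : _ = E (fun w => k * Z w ^+ 2 + (1 + k * (1 - v)) * Z w
    + (- (k + 1) * v) * 1)); last first.
  rewrite Ex_lin3; [|by bmeas_tac..].
  by rewrite Z0 (Ex_cst P) -/v; ring.
apply: Ex_le; [by bmeas_tac|by bmeas_tac|] => w.
have y0 : 0 <= 1 + Z w by have := Z1 w; lra.
have := expR_slope_mono mu b0 y0; rewrite -/k.
set e := expR (mu * (1 + Z w)); lra.
Qed.

Variable lam : R.
Hypothesis lam0 : 0 <= lam.
Local Notation S := (total X).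
Local Notation ew := (exp_weight X lam).
Local Notation W := (exp_total X lam).
Local Notation mgf := (mgf P X lam).
Local Notation tmean := (tilt_mean P X lam).
Local Notation cX := (tilt_centered P X lam).
Local Notation tvar := (tilt_var P X lam).

Let bew i : bmeas (ew i) := bmeas_ew mX X1 lam i.
Let mgf0 i : 0 < mgf i := mgf_gt0 P mX X1 lam i.

Lemma mgf_ge1 i : 1 <= mgf i.
Proof.
rewrite -[leLHS](_ : E (fun w => lam * X i w + 1 * 1 + 0 * 1) = _); last first.
  rewrite Ex_lin3; [|by bmeas_tac..].
  by rewrite X0 (Ex_cst P); ring.
apply: Ex_le; [by bmeas_tac|by bmeas_tac|] => w.
by have := expR_ge1Dx (lam * X i w); rewrite /ew; lra.
Qed.

Lemma tmeanE i : E (fun w => ew i w * X i w) = tmean i * mgf i.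
Proof. by rewrite /tilt_mean divfK// gt_eqF. Qed.

(** [biased_exp_ge] with [mu = lam], divided by [expR lam], reads [(tmean i - q i) * mgf i >= - q i
    * expR (- lam)]; then [mgf i >= 1] is used. *)
Lemma tmean_ge i : q i * (1 - expR (- lam)) <= tmean i.
Proof.
have := biased_exp_ge lam (bX i) (X1l i) (X0 i).
rewrite [leRHS](_ : _ = expR lam * (tmean i * mgf i - q i * mgf i)); last first.
  rewrite -tmeanE.
  transitivity (E (fun w => expR lam * (ew i w * X i w) + (- expR lam * q i) * ew i w + 0 * 1)).
    by apply: eq_Ex => w; rewrite mulrDr expRD mulr1 /ew; ring.
  rewrite Ex_lin3; [|by bmeas_tac..].
  by rewrite /mgf; ring.
move=> h; have := ler_wpM2l (expR_ge0 (- lam)) h.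
rewrite mulrA -expRD addNr expR0 mul1r => h2.
have m1 := mgf_ge1 i; have e0 := expR_gt0 (- lam); have q0 := var_ge0 i.
rewrite -(ler_pM2r (mgf0 i)).
have : 0 <= q i * expR (- lam) * (mgf i - 1) by rewrite !mulr_ge0 ?subr_ge0// ltW.
lra.
Qed.

(** [biased_exp_ge] for [- X i] with [mu = - lam] gives [(tmean i + q i) * mgf i <= q i * expR lam],
    and [mgf i >= 1]. *)
Lemma tmean_le i : tmean i <= q i * (expR lam - 1).
Proof.
have bN : bmeas (fun w => - X i w) by bmeas_tac.
have N1 w : -1 <= - X i w by rewrite lerN2.
have N0 : E (fun w => - X i w) = 0 by rewrite ExN// X0 oppr0.
have N2 : E (fun w => (- X i w) ^+ 2) = q i by apply: eq_Ex => w; rewrite sqrrN.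
have := biased_exp_ge (- lam) bN N1 N0; rewrite N2.
rewrite [leRHS](_ : _ = - (expR (- lam) * (tmean i * mgf i + q i * mgf i))); last first.
  rewrite -tmeanE.
  transitivity (E (fun w => - expR (- lam) * (ew i w * X i w) + (- expR (- lam) * q i) * ew i w + 0 * 1)).
    apply: eq_Ex => w; rewrite (_ : - lam * (1 - X i w) = - lam + lam * X i w); last by ring.
    by rewrite expRD /ew; ring.
  rewrite Ex_lin3; [|by bmeas_tac..].
  by rewrite /mgf; ring.
rewrite lerN2 => h; have := ler_wpM2l (expR_ge0 lam) h.
rewrite mulrA -expRD subrr expR0 mul1r => h2.
have m1 := mgf_ge1 i; have e0 := expR_gt0 lam; have q0 := var_ge0 i.
rewrite -(ler_pM2r (mgf0 i)).
have : 0 <= expR lam * q i * (mgf i - 1) by rewrite !mulr_ge0 ?subr_ge0// ltW.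
lra.
Qed.

Lemma tmean_ge0 i : 0 <= tmean i.
Proof.
apply: le_trans (tmean_ge i); rewrite mulr_ge0 ?var_ge0// subr_ge0.
by rewrite expR_le1 oppr_le0.
Qed.

Let A2 i := E (fun w => ew i w * X i w ^+ 2) / mgf i.

Let A2E i : E (fun w => ew i w * X i w ^+ 2) = A2 i * mgf i.
Proof. by rewrite /A2 divfK// gt_eqF. Qed.

Let tvarE i : tvar i = A2 i - tmean i ^+ 2.
Proof.
apply/eqP; rewrite -(inj_eq (mulIf (lt0r_neq0 (mgf0 i)))) -(Ex_ew_cX2 P mX X1) mulrBl -A2E.
apply/eqP.
transitivity (E (fun w => 1 * (ew i w * X i w ^+ 2) + (- 2 * tmean i) * (ew i w * X i w)
   + tmean i ^+ 2 * ew i w)).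
  by apply: eq_Ex => w; rewrite /cX; ring.
rewrite Ex_lin3; [|by bmeas_tac..].
by rewrite tmeanE /mgf; ring.
Qed.

Lemma exp_mono_prod (k x y : R) : 0 <= (x - y) * (expR (lam * x) - expR (lam * y)).
Proof.
have [xy|/ltW xy] := leP x y.
  by rewrite mulr_le0 ?subr_le0 ?ler_expR ?ler_wpM2l.
by rewrite mulr_ge0 ?subr_ge0 ?ler_expR ?ler_wpM2l.
Qed.

(** [(1 + X i) * (X i - q i)] has mean [0], and tilting can only increase it because [X i - q i] and
    the weight are ordered alike. This bounds the tilted second moment from below. The square of the
    tilted mean is absorbed when [tmean i <= q i]; otherwise the claim follows from positivity of
    the variance. *)
Lemma tvar_ge i : q i - tmean i <= tvar i.
Proof.
have h : 0 <= A2 i + tmean i - q i * tmean i - q i.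
  rewrite -(pmulr_lge0 _ (mgf0 i)).
  rewrite [leRHS](_ : _ = E (fun w => 1 * (ew i w * X i w ^+ 2) + (1 - q i) * (ew i w * X i w)
     + (- q i) * ew i w)); last first.
    rewrite Ex_lin3; [|by bmeas_tac..].
    by rewrite A2E tmeanE /mgf; ring.
  rewrite [leLHS](_ : _ = E (fun w => expR (lam * q i) * X i w ^+ 2
     + (expR (lam * q i) * (1 - q i)) * X i w + (- (expR (lam * q i) * q i)) * 1)); last first.
    rewrite Ex_lin3; [|by bmeas_tac..].
    by rewrite X0 (Ex_cst P); ring.
  apply: Ex_le; [by bmeas_tac|by bmeas_tac|] => w.
  have x1 : 0 <= 1 + X i w by have := X1l i w; lra.
  have := mulr_ge0 x1 (exp_mono_prod 0 (X i w) (q i)); rewrite -/(ew i w); lra.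
have m0 := tmean_ge0 i; have tv := tvar_ge0 P mX X1 lam i.
rewrite tvarE in tv *.
have [qm|/ltW qm] := leP (q i) (tmean i); first lra.
have : 0 <= tmean i * (q i - tmean i) by rewrite mulr_ge0// subr_ge0.
lra.
Qed.

(** As for [tvar_ge], with the product [(1 - X i) * (X i + q i)], which also has mean [0]. *)
Lemma tvar_le i : tvar i <= q i + tmean i.
Proof.
have h : 0 <= tmean i + q i - A2 i - q i * tmean i.
  rewrite -(pmulr_lge0 _ (mgf0 i)).
  rewrite [leRHS](_ : _ = E (fun w => (-1) * (ew i w * X i w ^+ 2) + (1 - q i) * (ew i w * X i w)
     + q i * ew i w)); last first.
    rewrite Ex_lin3; [|by bmeas_tac..].
    by rewrite A2E tmeanE /mgf; ring.
  rewrite [leLHS](_ : _ = E (fun w => - expR (lam * - q i) * X i w ^+ 2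
     + (expR (lam * - q i) * (1 - q i)) * X i w + (expR (lam * - q i) * q i) * 1)); last first.
    rewrite Ex_lin3; [|by bmeas_tac..].
    by rewrite X0 (Ex_cst P); ring.
  apply: Ex_le; [by bmeas_tac|by bmeas_tac|] => w.
  have x1 : 0 <= 1 - X i w by have := X1r i w; lra.
  have := mulr_ge0 x1 (exp_mono_prod 0 (X i w) (- q i)); rewrite -/(ew i w); lra.
have m0 := tmean_ge0 i; rewrite tvarE.
have : 0 <= q i * tmean i by rewrite mulr_ge0 ?var_ge0.
have := sqr_ge0 (tmean i); lra.
Qed.
End tilt_bounds.

(** * Comparison with the normal tail *)

Section error_budget.
Variable R : realType.
Local Notation mills := (@mills R).
Implicit Types a r x : R.

Lemma inv_sqrt_pi_ge : 563 / 1000 <= (Num.sqrt pi)^-1 :> R.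
Proof.
have /andP[_ pu] := pi_bounds R; have p0 := @pi_gt0 R.
have s0 : 0 < Num.sqrt pi :> R by rewrite sqrtr_gt0.
have s2 := sqr_sqrtr (ltW p0).
rewrite -[leRHS]mul1r (ler_pdivlMr _ _ s0) leNgt; apply/negP => h.
have : 0 < (563 / 1000 * Num.sqrt pi - 1) * (563 / 1000 * Num.sqrt pi + 1) :> R.
  apply: mulr_gt0; lra.
move: s2; set s := Num.sqrt pi => s2; lra.
Qed.

(** [803 / 1000] is [2.24 + 0.563 - 2], with [0.563] below [1 / sqrt pi]; the second term is the
    price of replacing [Theta a] by [Theta x]. Small [a] use the quadratic majorant of [mills],
    large [a] the convergent [mills_upper2]. *)
Lemma lip_budget a : 0 <= a ->
  9 / 8 * lip a + 201 / 500 * (a ^+ 2 / (1 + a ^+ 2)) <= 803 / 1000.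
Proof.
move=> a0; have /andP[r1 r2] := mills0_bounds R.
have y1 : 0 < 1 + a ^+ 2 by rewrite ltr_pwDl// sqr_ge0.
have a2 := sqr_ge0 a.
have mq : mills a <= 1255 / 1000 * (1 + a ^+ 2 / 2) - a.
  apply: le_trans (mills_le_deg2 a0) _; rewrite lerD2r ler_wpM2r//; lra.
have yle (b : R) : 0 <= b -> a <= b -> a ^+ 2 / (1 + a ^+ 2) <= b ^+ 2 / (1 + b ^+ 2).
  move=> b0 ab; have b1 : 0 < 1 + b ^+ 2 by rewrite ltr_pwDl// sqr_ge0.
  have ab2 : a ^+ 2 <= b ^+ 2 by rewrite lerXn2r ?nnegrE.
  rewrite ler_pdivrMr// mulrAC ler_pdivlMr//; clear mq r1 r2 a0 a2 b0 ab; lra.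
have yb (b c : R) : 0 <= b -> a <= b -> b ^+ 2 <= c * (1 + b ^+ 2) -> a ^+ 2 / (1 + a ^+ 2) <= c.
  move=> b0 ab bc; apply: le_trans (yle b b0 ab) _.
  by rewrite ler_pdivrMr// ltr_pwDl// sqr_ge0.
rewrite /lip; case: ltP => h1.
  (* On each subinterval the increasing ratio is bounded by its value at the right end, rounded up,
     and the convex quadratic [mq] by its chord, which is what [ab] encodes. *)
  have ay : a ^+ 2 / (1 + a ^+ 2) <= 1 / 5 by apply: (yb (1 / 2)) (ltW h1) _; clear; lra.
  have ab : 0 <= a * (1 / 2 - a) by rewrite mulr_ge0// subr_ge0 ltW.
  clear -mq ay ab a0 h1; lra.
have [h2|h2] := leP a (7 / 10).
  have ay : a ^+ 2 / (1 + a ^+ 2) <= 33 / 100.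
    by apply: (yb (7 / 10)) h2 _; clear; lra.
  have ab : 0 <= (a - 1 / 2) * (7 / 10 - a) by apply: mulr_ge0; clear -h1 h2; lra.
  clear -mq ay ab h1 h2; lra.
have [h3|h3] := leP a (8 / 10).
  have ay : a ^+ 2 / (1 + a ^+ 2) <= 392 / 1000.
    by apply: (yb (8 / 10)) h3 _; clear; lra.
  have ab : 0 <= (a - 7 / 10) * (8 / 10 - a) by apply: mulr_ge0; clear -h2 h3; lra.
  clear -mq ay ab h2 h3; lra.
have [h4|h4] := leP a (85 / 100).
  have ay : a ^+ 2 / (1 + a ^+ 2) <= 420 / 1000.
    by apply: (yb (85 / 100)) h4 _; clear; lra.
  have ab : 0 <= (a - 8 / 10) * (85 / 100 - a) by apply: mulr_ge0; clear -h3 h4; lra.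
  clear -mq ay ab h3 h4; lra.
have agt0 : 0 < a by clear -h4; lra.
have mu := mills_upper2 agt0.
clear mq a0 yle yb h1 h2 h3 r1 r2.
(* [6567 / 10000] rounds down [803 / 1000 - 9 / 8 * 13 / 100]. *)
suff : 9 / 16 * ((a ^+ 2 + 2) / (a ^+ 3 + 3 * a)) + 201 / 500 * (a ^+ 2 / (1 + a ^+ 2)) <= 6567 / 10000.
  by clear h4; lra.
clear mu.
have d0 : 0 < a ^+ 3 + 3 * a by rewrite addr_gt0 ?exprn_gt0 ?mulr_gt0.
(* Expanded at [85 / 100], the numerator obtained below has only nonnegative coefficients in [h]. *)
pose h := a - 85 / 100.
have hE : a = h + 85 / 100 by rewrite /h; ring.
have h0 : 0 <= h by rewrite subr_ge0 ltW.
clearbody h; clear h4 a2 agt0.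
rewrite -subr_ge0.
have -> : 6567 / 10000 - (9 / 16 * ((a ^+ 2 + 2) / (a ^+ 3 + 3 * a)) + 201 / 500 * (a ^+ 2 / (1 + a ^+ 2))) =
   (6567 / 10000 * ((a ^+ 3 + 3 * a) * (1 + a ^+ 2)) - 9 / 16 * ((a ^+ 2 + 2) * (1 + a ^+ 2))
     - 201 / 500 * (a ^+ 2 * (a ^+ 3 + 3 * a))) / ((a ^+ 3 + 3 * a) * (1 + a ^+ 2)).
  by field; rewrite gt_eqF//= gt_eqF//.
apply: divr_ge0; last by rewrite mulr_ge0// ltW.
have k2 := exprn_ge0 2 h0; have k3 := exprn_ge0 3 h0.
have k4 := exprn_ge0 4 h0; have k5 := exprn_ge0 5 h0.
clear d0 y1; rewrite hE; lra.
Qed.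
End error_budget.

Section error_bound.
Variable R : realType.
Local Notation mills := (@mills R).
Implicit Types a r x l : R.

Lemma expR_pade l : 0 <= l -> expR l * (2 - l) <= 2 + l.
Proof.
move=> l0; rewrite -subr_ge0.
pose f y : R := 2 + y - expR y * (2 - y).
rewrite -[leRHS]/(f l) (_ : 0 = f 0); last by rewrite /f expR0; ring.
apply: (@derive_ge0_le R f (fun y => 1 - (1 - y) * expR y)) l0 _ _ => y _.
  by apply: is_derive_eq; rewrite /GRing.scale/=; ring.
have := ler_wpM2r (expR_ge0 y) (expR_ge1Dx (- y)).
by rewrite -expRD addNr expR0; lra.
Qed.

Lemma expR_sinh l : 0 <= l -> 2 * l <= expR l - expR (- l).
Proof.
move=> l0; rewrite -subr_ge0.
pose f y : R := expR y - expR (- y) - 2 * y.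
rewrite -[leRHS]/(f l) (_ : 0 = f 0); last by rewrite /f oppr0 expR0; ring.
apply: (@derive_ge0_le R f (fun y => expR y + expR (- y) - 2)) l0 _ _ => y _.
  by apply: is_derive_eq; rewrite /GRing.scale/=; ring.
have := expR_gt0 y; have := expR_gt0 (- y).
have : expR y * expR (- y) = 1 by rewrite -expRD subrr expR0.
set u := expR y; set v := expR (- y) => uv v0 u0.
have : 0 <= (u - v) ^+ 2 by exact: sqr_ge0.
have : 0 <= (u + v) by lra.
nra.
Qed.

Lemma mills_dist a x : 0 <= a -> a <= x -> `|mills a - mills x| <= (x - a) / (1 + a ^+ 2).
Proof.
move=> a0 ax; have a1 : 0 < 1 + a ^+ 2 by rewrite ltr_pwDl// sqr_ge0.
rewrite distrC mulrC; apply: (@derive_lip R mills _ _ a x ax (@is_derive_mills R)).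
move=> z /andP[/ltW az _]; have z0 := le_trans a0 az.
rewrite ler0_norm ?mills_deriv_le0// lerNl; apply: le_trans (mills_deriv_ge z0).
have z1 : 0 < 1 + z ^+ 2 by rewrite ltr_pwDl// sqr_ge0.
by rewrite lerN2 lef_pV2 ?posrE// lerD2l lerXn2r// nnegrE.
Qed.

(** [201 / 500] bounds [1 / (2 * mills 0)] from above. *)
Lemma Theta_dist a x : `|Theta a - Theta x| <= 201 / 500 * `|mills a - mills x|.
Proof.
have /andP[r1 _] := mills0_bounds R; have r0 := @mills0_gt0 R.
rewrite !ThetaE -mulrBl normrM mulrC ler_wpM2r//.
rewrite ger0_norm; last by rewrite invr_ge0; lra.
rewrite -[leLHS]mul1r (ler_pdivrMr _ _ (_ : 0 < 2 * mills 0)); lra.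
Qed.

(** [p] is [(1 - r) ^ (- 1 / 2)]. At [r = 0] the claim is the budget [2 + 0.803 = 2.24 + 0.563]; in
    general [p ^+ 2 <= 1 + r + 2.6 * r ^+ 2], valid for [r <= 0.61], makes the right-hand side grow
    fast enough. *)
Lemma normal_budget r p y k e1 e2 i1 i2 w :
  0 <= r -> r <= 61 / 100 -> 0 < p -> p ^+ 2 * (1 - r) = 1 -> 0 <= y -> y <= 1 ->
  9 / 8 * k + 201 / 500 * y <= 803 / 1000 ->
  1 + r ^+ 2 / 2 <= e1 -> 1 + r + 3 / 2 * r ^+ 2 <= e2 ->
  p <= i1 -> p ^+ 2 <= i2 -> 563 / 1000 <= w ->
  (2 + 9 / 8 * k) * p + 201 / 500 * y * p ^+ 3 * p <=
  224 / 100 * e1 * i1 + e2 * (w * i2).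
Proof.
move=> r0 r61 p0 p2 y0 y1 kb e1r e2r i1p i2p w0.
have t1 : 0 < 1 - r by clear -r61; lra.
have r2 := sqr_ge0 r.
have c3 : (1 + r ^+ 2 / 2) * p <= e1 * i1.
  by apply: ler_pM e1r i1p; [clear -r2; lra|exact: ltW].
have pp0 := sqr_ge0 p.
have c4 : 563 / 1000 * p ^+ 2 <= w * i2 by apply: ler_pM w0 i2p; [clear; lra|exact: pp0].
have c5 : (1 + r + 3 / 2 * r ^+ 2) * (563 / 1000 * p ^+ 2) <= e2 * (w * i2).
  by apply: ler_pM e2r c4; [clear -r0 r2; lra|clear -pp0; lra].
have p1 : 1 <= p.
  rewrite leNgt; apply/negP => h.
  have h1 : 0 < (1 - p) * (1 + p) by rewrite mulr_gt0 ?subr_gt0// addr_gt0.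
  have := mulr_gt0 h1 t1; clear -p2 r0; lra.
have p2u : p ^+ 2 <= 1 + r + 26 / 10 * r ^+ 2.
  rewrite -(ler_pM2r t1) p2.
  have : 0 <= r ^+ 2 * (61 / 100 - r) by rewrite mulr_ge0 ?subr_ge0.
  clear -r0 r2; lra.
have p3 : 0 <= (1 + r + 26 / 10 * r ^+ 2 - p ^+ 2) * p.
  by rewrite mulr_ge0 ?subr_ge0 ?(ltW p0).
have p31 : 0 <= p ^+ 3 - 1 by rewrite subr_ge0 exprn_ege1.
(* As [y <= 1], [y * p ^+ 3 <= y + (p ^+ 3 - 1)], so [y] enters only through the budget [kb]. *)
have yp : 0 <= (1 - y) * (p ^+ 3 - 1) by apply: mulr_ge0 p31; rewrite subr_ge0.
(* [161 / 1000] is [563 / 1000 - 201 / 500], the slack left by the two terms that carry powers of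
   [p]. *)
have fin : 0 <= (p - 1) * (161 / 1000 + 161 / 1000 * r - 201 / 1000 * r ^+ 2).
  apply: mulr_ge0; first by rewrite subr_ge0.
  have : 0 <= r * (1 - r) by rewrite mulr_ge0 ?(ltW t1).
  clear -r0 r61; lra.
have main : 0 <= (224 / 100 * (1 + r ^+ 2 / 2) + 563 / 1000 * (1 + r + 3 / 2 * r ^+ 2) * p
    - (2 + 9 / 8 * k + 201 / 500 * y * p ^+ 3)) * p.
  apply: mulr_ge0; last exact: ltW.
  have rp : 0 <= r ^+ 2 * p by rewrite mulr_ge0 ?(ltW p0).
  by clear -kb p3 yp fin r0 r2 rp; lra.
by clear -c3 c5 main; lra.
Qed.

Variables x r sg lam s : R.
Hypotheses (x0 : 0 <= x) (sg0 : 0 < sg) (lam0 : 0 <= lam) (s0 : 0 < s).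
Hypotheses (r0 : 0 <= r) (xE : x = r * sg).
Hypothesis r61 : r <= 61 / 100.
Hypotheses (lam_lo : r <= expR lam - 1) (lam_hi : 1 - expR (- lam) <= r).
Hypotheses (s_lo : sg ^+ 2 * (1 - r) <= s ^+ 2) (s_hi : s ^+ 2 <= sg ^+ 2 * (1 + r)).
Local Notation a := (lam * s).

(** [expR_pade] turns [lam_lo] into [lam >= 2 * r / (2 + r)]; with [s_lo] the claim reduces to
    [(2 + r) ^+ 2 * (1 - r) <= 4]. *)
Lemma slope_ge : x * (1 - r) <= a.
Proof.
move: r0 r61 lam_lo lam_hi s_lo s_hi; move: r xE => t xt tr0 tr61 tlo thi tslo tshi.
rewrite xt.
have l2 : 2 * t <= lam * (2 + t).
  have [h|h] := leP lam 2; last first.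
    have : 0 <= (lam - 2) * (2 + t) by apply: mulr_ge0; lra.
    lra.
  have := expR_pade lam0.
  have : 0 <= (expR lam - (1 + t)) * (2 - lam) by apply: mulr_ge0; lra.
  lra.
have a0 : 0 <= a by rewrite mulr_ge0// ltW.
rewrite leNgt; apply/negP => h.
have : a ^+ 2 < (t * sg * (1 - t)) ^+ 2 by rewrite ltrXn2r ?nnegrE//; lra.
apply/negP; rewrite -leNgt.
have t2 : 0 < (2 + t) ^+ 2 by rewrite exprn_gt0//; lra.
rewrite -(ler_pM2r t2).
have h1 : (2 * t) ^+ 2 <= (lam * (2 + t)) ^+ 2 by rewrite lerXn2r ?nnegrE//; lra.
have t1 : 0 <= 1 - t by lra.
have h2 : (2 * t) ^+ 2 * (sg ^+ 2 * (1 - t)) <= (lam * (2 + t)) ^+ 2 * s ^+ 2.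
  by apply: ler_pM => //; rewrite ?sqr_ge0// mulr_ge0 ?sqr_ge0.
rewrite [leRHS](_ : _ = (lam * (2 + t)) ^+ 2 * s ^+ 2); last by ring.
apply: le_trans h2.
have : 0 <= t ^+ 2 * sg ^+ 2 * (1 - t) * (4 - (2 + t) ^+ 2 * (1 - t)).
  apply: mulr_ge0; first by rewrite mulr_ge0// mulr_ge0 ?sqr_ge0.
  have : 0 <= t ^+ 2 by exact: sqr_ge0.
  have : 0 <= t ^+ 2 * t by rewrite mulr_ge0 ?sqr_ge0.
  lra.
lra.
Qed.

(** [expR_sinh] at [lam / 2] and [lam_hi] give [lam <= r * expR (lam / 2)], hence
    [lam ^+ 2 * (1 - r) <= r ^+ 2]; with [s_hi] the claim reduces to [(1 + r) * (1 - r) <= 1]. *)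
Lemma slope_le : a * (1 - r) <= x.
Proof.
move: r0 r61 lam_lo lam_hi s_lo s_hi; move: r xE => t xt tr0 tr61 tlo thi tslo tshi.
rewrite xt.
have t1 : 0 < 1 - t by lra.
have a0 : 0 <= a by rewrite mulr_ge0// ltW.
have l1 : lam <= t * expR (lam / 2).
  have h2 : 0 <= lam / 2 by rewrite divr_ge0.
  have := expR_sinh h2.
  rewrite (_ : 2 * (lam / 2) = lam); last by field.
  move=> /le_trans; apply.
  have := ler_wpM2r (expR_ge0 (lam / 2)) thi.
  rewrite mulrBl mul1r -expRD (_ : - lam + lam / 2 = - (lam / 2)) //; by field.
have l2 : lam ^+ 2 * (1 - t) <= t ^+ 2.
  have : lam ^+ 2 <= (t * expR (lam / 2)) ^+ 2.
    by rewrite lerXn2r ?nnegrE ?mulr_ge0 ?expR_ge0.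
  rewrite exprMn -expRM_natl (_ : 2%:R * (lam / 2) = lam); last by field.
  move=> h; have := ler_wpM2r (ltW t1) h; move=> /le_trans; apply.
  rewrite -mulrA -[leRHS]mulr1 ler_wpM2l ?sqr_ge0//.
  have : 1 - t <= expR (- lam) by lra.
  move/(ler_wpM2l (expR_ge0 lam)); rewrite -expRD subrr expR0; lra.
rewrite leNgt; apply/negP => h.
have : (t * sg) ^+ 2 < (a * (1 - t)) ^+ 2.
  by rewrite ltrXn2r ?nnegrE ?mulr_ge0 ?(ltW t1)// ltW.
apply/negP; rewrite -leNgt.
have h2 : lam ^+ 2 * (1 - t) * s ^+ 2 <= t ^+ 2 * (sg ^+ 2 * (1 + t)).
  by apply: ler_pM => //; rewrite ?sqr_ge0// mulr_ge0 ?sqr_ge0// ltW.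
have h3 := ler_wpM2r (ltW t1) h2.
rewrite [leLHS](_ : _ = lam ^+ 2 * (1 - t) * s ^+ 2 * (1 - t)); last by ring.
apply: le_trans h3 _.
have : 0 <= t ^+ 2 * sg ^+ 2 * t ^+ 2 by rewrite -!exprMn sqr_ge0.
lra.
Qed.

Local Notation q := (Num.sqrt (1 - r)).

Let t1 : 0 < 1 - r. Proof. by move: r61; lra. Qed.

Let q0 : 0 < q. Proof. by rewrite sqrtr_gt0. Qed.

Let q2 : q ^+ 2 = 1 - r. Proof. exact: sqr_sqrtr (ltW t1). Qed.

Let p := q^-1.

(** [a] and [x] differ by a relative error of order [r], and [r * sg = x]; so [sg] times their
    distance is at most quadratic in them. Dividing by [1 + z ^+ 2] at the smaller point [z], the
    slope bound of [mills], produces [a ^+ 2 / (1 + a ^+ 2)]; for [x < a] this uses that the ratio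
    is increasing. *)
Lemma Theta_error :
  sg * q * `|Theta a - Theta x| <= 201 / 500 * (a ^+ 2 / (1 + a ^+ 2)) * p ^+ 3.
Proof.
have a0 : 0 <= a by rewrite mulr_ge0// ltW.
have a1 : 0 < 1 + a ^+ 2 by rewrite ltr_pwDl// sqr_ge0.
have x1 : 0 < 1 + x ^+ 2 by rewrite ltr_pwDl// sqr_ge0.
have sq0 : 0 <= sg * q by rewrite mulr_ge0 ?ltW.
apply: le_trans (ler_wpM2l sq0 (Theta_dist a x)) _.
rewrite (_ : sg * q * (201 / 500 * _) = 201 / 500 * (sg * q * `|mills a - mills x|)); last by ring.
rewrite -[leRHS]mulrA; apply: ler_wpM2l; first lra.
have p0 : 0 < p by rewrite invr_gt0.
have qp : q * p = 1 by rewrite divff// gt_eqF.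
have p2 : p ^+ 2 * (1 - r) = 1 by rewrite -q2 -exprMn mulrC qp expr1n.
have p1 : 1 <= p ^+ 2.
  have : 0 <= p ^+ 2 * r by rewrite mulr_ge0// sqr_ge0.
  lra.
have [ax|/ltW xa] := leP a x.
  have sx : sg * (x - a) <= (a * p ^+ 2) ^+ 2.
    have h := slope_ge.
    have xr : sg * (x - a) <= x ^+ 2.
      rewrite (_ : x ^+ 2 = sg * (x * r)); last by rewrite xE; ring.
      rewrite ler_wpM2l ?(ltW sg0)//; lra.
    apply: le_trans xr _; rewrite lerXn2r// ?nnegrE; first by apply: mulr_ge0 => //; exact: sqr_ge0.
    have := ler_wpM2r (sqr_ge0 p) h; move=> h2.
    by have := congr1 ( *%R x) p2; rewrite /=; lra.
  apply: le_trans (ler_wpM2l sq0 (mills_dist a0 ax)) _.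
  rewrite (_ : sg * q * ((x - a) / (1 + a ^+ 2)) = (sg * (x - a)) * (q / (1 + a ^+ 2))); last by ring.
  have qa : 0 <= q / (1 + a ^+ 2) by rewrite divr_ge0 ?ltW.
  apply: le_trans (ler_wpM2r qa sx) _.
  rewrite (_ : (a * p ^+ 2) ^+ 2 * (q / (1 + a ^+ 2)) =
    a ^+ 2 / (1 + a ^+ 2) * p ^+ 3 * (q * p)); last by ring.
  by rewrite qp mulr1.
have h := slope_le.
have ax2 : x ^+ 2 / (1 + x ^+ 2) <= a ^+ 2 / (1 + a ^+ 2).
  have : x ^+ 2 <= a ^+ 2 by rewrite lerXn2r ?nnegrE.
  rewrite ler_pdivrMr// mulrAC ler_pdivlMr//; lra.
have sx : sg * (a - x) <= x ^+ 2 * p ^+ 2.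
  have : (a - x) * (1 - r) <= x * r by lra.
  move/(ler_wpM2l (sqr_ge0 p)) => h2.
  have {}h2 : a - x <= p ^+ 2 * (x * r).
    by have := congr1 ( *%R (a - x)) p2; rewrite /=; lra.
  have := ler_wpM2l (ltW sg0) h2.
  rewrite (_ : sg * (p ^+ 2 * (x * r)) = x ^+ 2 * p ^+ 2)//; by rewrite xE; ring.
have md : `|mills a - mills x| <= (a - x) / (1 + x ^+ 2).
  by rewrite distrC; exact: mills_dist.
apply: le_trans (ler_wpM2l sq0 md) _.
rewrite (_ : sg * q * ((a - x) / (1 + x ^+ 2)) = (sg * (a - x)) * (q / (1 + x ^+ 2))); last by ring.
have qx : 0 <= q / (1 + x ^+ 2) by rewrite divr_ge0 ?ltW.
apply: le_trans (ler_wpM2r qx sx) _.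
rewrite (_ : x ^+ 2 * p ^+ 2 * (q / (1 + x ^+ 2)) = x ^+ 2 / (1 + x ^+ 2) * p * (q * p)); last by ring.
rewrite qp mulr1; apply: ler_pM => //.
- by rewrite divr_ge0 ?sqr_ge0// ltW.
- exact: ltW.
by rewrite [leRHS]exprS -[leLHS]mulr1 ler_wpM2l// ltW.
Qed.

Variable t : R.
Hypotheses (rt : r <= t) (tlt1 : t < 1).

Lemma normal_error_le :
  (2 + 9 / 8 * lip a) / s + `|Theta a - Theta x| <=
  ((224 / 100) * expR (t ^+ 2 / 2) / Num.sqrt (1 - t)
     + expR (t + t ^+ 2) / (Num.sqrt pi * (1 - t))) / sg.
Proof.
have a0 : 0 <= a by rewrite mulr_ge0// ltW.
have a1 : 0 < 1 + a ^+ 2 by rewrite ltr_pwDl// sqr_ge0.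
have p0 : 0 < p by rewrite invr_gt0.
have qp : q * p = 1 by rewrite divff// gt_eqF.
have p2 : p ^+ 2 * (1 - r) = 1 by rewrite -q2 -exprMn mulrC qp expr1n.
have t0 : 0 <= t by exact: le_trans rt.
have tr1 : 0 < 1 - t by rewrite subr_gt0.
have rt' := rt; have r0' := r0; have r61' := r61; have t1' := t1.
have st0 : 0 < Num.sqrt (1 - t) by rewrite sqrtr_gt0.
have t2r : r ^+ 2 <= t ^+ 2 by rewrite lerXn2r ?nnegrE.
rewrite ler_pdivlMr//.
have K0 : 0 <= 2 + 9 / 8 * lip a by have := lip_ge0 a; lra.
have sq : sg * q <= s.
  rewrite leNgt; apply/negP => h.
  have : s ^+ 2 < (sg * q) ^+ 2 by rewrite ltrXn2r ?nnegrE ?mulr_ge0 ?ltW.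
  by rewrite exprMn q2 ltNge s_lo.
have c1 : (2 + 9 / 8 * lip a) / s * sg <= (2 + 9 / 8 * lip a) * p.
  rewrite -mulrA ler_wpM2l// mulrC ler_pdivrMr//.
  have := ler_wpM2l (ltW p0) sq.
  rewrite (_ : p * (sg * q) = sg * (q * p)); last by ring.
  by rewrite qp mulr1.
have Te := Theta_error.
have c2 : `|Theta a - Theta x| * sg <= 201 / 500 * (a ^+ 2 / (1 + a ^+ 2)) * p ^+ 3 * p.
  have := ler_wpM2r (ltW p0) Te.
  rewrite (_ : sg * q * `|_| * p = `|Theta a - Theta x| * sg * (q * p)); last by ring.
  by rewrite qp mulr1.
have e1 : 1 + r ^+ 2 / 2 <= expR (t ^+ 2 / 2).
  by apply: le_trans (expR_ge1Dx _); rewrite lerD2l ler_wpM2r.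
have e2 : 1 + r + 3 / 2 * r ^+ 2 <= expR (t + t ^+ 2).
  have tt : 0 <= t + t ^+ 2 by rewrite addr_ge0 ?sqr_ge0.
  apply: le_trans (expR_ge_deg2 tt).
  have : 0 <= t ^+ 2 * t by rewrite mulr_ge0 ?sqr_ge0.
  have : 0 <= t ^+ 2 * t ^+ 2 by rewrite mulr_ge0 ?sqr_ge0.
  clear Te c1 c2 e1 K0; lra.
have p_st : p <= (Num.sqrt (1 - t))^-1.
  by rewrite lef_pV2 ?posrE// ler_wsqrtr// lerD2l lerN2.
have p2_st : p ^+ 2 <= (1 - t)^-1.
  rewrite -[p ^+ 2]mulr1 -(ler_pM2r t1) mulrAC p2 mul1r mulrC ler_pdivlMr//.
  clear Te c1 c2 e1 e2 sq K0 p_st; lra.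
rewrite mulrDl; apply: le_trans (lerD c1 c2) _; rewrite invfM.
apply: normal_budget (lip_budget a0) e1 e2 p_st p2_st (inv_sqrt_pi_ge R) => //.
  by rewrite divr_ge0 ?sqr_ge0// ltW.
by rewrite ler_pdivrMr ?mul1r ?lerDr.
Qed.
End error_bound.

(** * The saddlepoint *)

Section saddlepoint.
Context d (T : measurableType d) (R : realType) (P : probability T R).
Variables (n : nat) (X : 'I_n -> T -> R).
Hypothesis mX : forall i, measurable_fun [set: T] (X i).
Hypothesis X1 : forall i w, `|X i w| <= 1.
Hypothesis indep : mutually_independent P X.
Local Notation E := (Ex P).
Hypothesis X0 : forall i, E (X i) = 0.
Local Notation q i := (E (fun w => X i w ^+ 2)).
Local Notation S := (total X).
Local Notation W := (exp_total X).
Local Notation tmean := (tilt_mean P X).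
Local Notation tvar := (tilt_var P X).

Let bS : bmeas S := bmeas_S mX X1.
Let bW lam : bmeas (W lam) := bmeas_W mX X1 lam.

Lemma Ex_W_gt0 lam : 0 < E (W lam).
Proof.
have [_ [C SC]] := bS.
have := @Ex_le d T R P (fun=> expR (- (`|lam| * C))) (W lam) (@bmeas_cst _ _ _ _) (bW lam).
rewrite (Ex_cst P) => /(_ _)/(lt_le_trans (expR_gt0 _)); apply => w.
rewrite /W ler_expR lerNl -mulrN; apply: le_trans (ler_norm _) _.
by rewrite normrM normrN ler_wpM2l.
Qed.

Lemma Ex_S0 : E S = 0.
Proof. by rewrite Ex_sum ?big1// => i; exact: bmeas_X. Qed.

Lemma tilted_drift_continuous c : continuous (fun l => E (fun w => W l w * (S w - c))).
Proof.
move=> u; apply/cvgrPdist_le => e e0.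
have [_ [C SC]] := bS.
have C0 : 0 <= C by apply: le_trans (SC point).
pose K := 2 * expR ((`|u| + 1) * C) * C * (C + `|c|) + 1.
have K0 : 0 < K by rewrite ltr_wpDl// !mulr_ge0 ?addr_ge0 ?expR_ge0.
apply/nbhs_ballP; exists (Num.min 1 (e / K)) => /= [|v].
  by rewrite lt_min ltr01 divr_gt0.
rewrite /ball/= lt_min => /andP[/ltW uv1 /ltW uve].
have vu : `|v| <= `|u| + 1.
  by have := ler_distD u 0 v; rewrite !sub0r !normrN; lra.
have bWS l : bmeas (fun w => W l w * (S w - c)).
  by apply: bmeasM => //; apply: bmeasB => //; exact: bmeas_cst.
rewrite -ExB//.
have Wb l w : `|l| <= `|u| + 1 -> W l w <= expR ((`|u| + 1) * C).
  move=> lu; rewrite /W ler_expR; apply: le_trans (ler_norm _) _.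
  by rewrite normrM; apply: ler_pM.
suff pw w : `|W u w * (S w - c) - W v w * (S w - c)| <= e.
  rewrite ler_norml -[e](Ex_cst P) -(ExN P); last exact: bmeas_cst.
  apply/andP; split; apply: Ex_le; try (by bmeas_tac); try (by apply: bmeasB).
    by move=> w; have := pw w; rewrite ler_norml => /andP[].
  by move=> w; have := pw w; rewrite ler_norml => /andP[].
rewrite -mulrBl normrM.
have h1 : `|W u w - W v w| <= `|u - v| * C * (2 * expR ((`|u| + 1) * C)).
  apply: le_trans (expR_dist _ _) _; rewrite -mulrBl normrM.
  apply: ler_pM; rewrite ?mulr_ge0 ?addr_ge0 ?expR_ge0//.
    by rewrite ler_wpM2l.
  rewrite mulr_natl mulr2n; apply: lerD; last exact: Wb.
  by apply: Wb; rewrite lerDl.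
have h2 : `|S w - c| <= C + `|c|.
  by apply: le_trans (ler_normB _ _) _; rewrite lerD2r.
apply: le_trans (ler_pM (normr_ge0 _) (normr_ge0 _) h1 h2) _.
rewrite (_ : _ * (C + `|c|) = `|u - v| * (K - 1)); last by rewrite /K; ring.
apply: (@le_trans _ _ (`|u - v| * K)); first by rewrite ler_wpM2l// gerBl.
by rewrite -ler_pdivlMr.
Qed.

Variables (sg x r : R).
Hypotheses (sg0 : 0 < sg) (sg2 : sg ^+ 2 = \sum_i q i) (x0 : 0 <= x).
Hypotheses (r0 : 0 <= r) (xE : x = r * sg).

Let drift c l : E (fun w => W l w * (S w - c)) = (\sum_i tmean l i - c) * E (W l).
Proof.
transitivity (E (fun w => 1 * (W l w * (S w - \sum_i tmean l i))
    + (\sum_i tmean l i - c) * W l w + 0 * 1)).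
  by apply: eq_Ex => w; ring.
rewrite Ex_lin3//; first by rewrite Ex_W_S//; ring.
- by apply: bmeasM => //; apply: bmeasB => //; exact: bmeas_cst.
- exact: bmeas_cst.
Qed.

(** The drift is [- (x * sg)] at [0]. At [l1 = - ln (1 - r)] the bounds [tmean_ge] add up to
    [sg ^+ 2 * r = x * sg], so it is nonnegative there, and the intermediate value theorem
    applies. *)
Lemma saddlepoint_exists : r < 1 ->
  exists2 lam, 0 <= lam & \sum_i tmean lam i = x * sg.
Proof.
move=> r1; have r1' : 0 < 1 - r by rewrite subr_gt0.
pose J l := E (fun w => W l w * (S w - x * sg)).
pose l1 := - ln (1 - r).
have el1 : expR (- l1) = 1 - r by rewrite opprK lnK.
have l10 : 0 <= l1 by rewrite oppr_ge0 ln_le0// gerBl.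
have J0 : J 0 <= 0.
  have -> : J 0 = - (x * sg).
    transitivity (E S + E (fun=> - (x * sg))); last by rewrite Ex_S0 (Ex_cst P) add0r.
    rewrite /J -ExD//; last exact: bmeas_cst.
    by apply: eq_Ex => w; rewrite /W mul0r expR0 mul1r.
  by rewrite oppr_le0 mulr_ge0// ltW.
have J1 : 0 <= J l1.
  rewrite /J drift mulr_ge0 ?(ltW (Ex_W_gt0 _))// subr_ge0.
  rewrite (_ : x * sg = \sum_i (q i * (1 - expR (- l1)))).
    by apply: ler_sum => i _; exact: tmean_ge.
  by rewrite -mulr_suml -sg2 el1 xE; ring.
have [||lam /[!in_itv]/= /andP[lam0 _] Jlam] := @IVT R J 0 l1 0 l10.
- by apply: continuous_subspaceT; exact: tilted_drift_continuous.
- by move: (J 0) (J l1) J0 J1 => u v u0 v0; rewrite ge_min u0 le_max v0 orbT.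
exists lam => //; apply/eqP; rewrite -subr_eq0.
by move/eqP: Jlam; rewrite /J drift mulf_eq0 (gt_eqF (Ex_W_gt0 _)) orbF.
Qed.

Variable lam : R.
Hypotheses (lam0 : 0 <= lam) (lamE : \sum_i tmean lam i = x * sg).
Local Notation m l := (E (fun w => expR (l * (S w - x * sg)))).

Let mE l : m l = expR (- (l * (x * sg))) * E (W l).
Proof.
by rewrite -ExZl//; apply: eq_Ex => w; rewrite /W -expRD; congr expR; ring.
Qed.

(** The tangent inequality for [expR] is integrated; its linear term has mean [0] by the saddlepoint
    equation. The minimum is over all real [l]. *)
Lemma saddlepoint_inf l : m lam <= m l.
Proof.
have bm k : bmeas (fun w => expR (k * (S w - x * sg))).
  by apply: bmeas_expR; apply: bmeasM; [exact: bmeas_cst|apply: bmeasB => //; exact: bmeas_cst].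
have h := drift (x * sg) lam; rewrite lamE subrr mul0r in h.
rewrite [leLHS](_ : _ = E (fun w => 1 * expR (lam * (S w - x * sg))
   + ((l - lam) * expR (- (lam * (x * sg)))) * (W lam w * (S w - x * sg)) + 0 * 1)).
  apply: Ex_le => [|//|w].
    apply: bmeasD; last by bmeas_tac.
    apply: bmeasD; first by apply: bmeasM => //; exact: bmeas_cst.
    apply: bmeasM; first exact: bmeas_cst.
    by apply: bmeasM => //; apply: bmeasB => //; exact: bmeas_cst.
  have := expR_tangent (lam * (S w - x * sg)) (l * (S w - x * sg)).
  apply: le_trans; rewrite le_eqVlt; apply/orP; left; apply/eqP.
  rewrite (_ : expR (lam * (S w - x * sg)) = expR (- (lam * (x * sg))) * W lam w); first ring.
  by rewrite /W -expRD; congr expR; ring.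
rewrite Ex_lin3//; first by rewrite h; ring.
- by apply: bmeasM => //; apply: bmeasB => //; exact: bmeas_cst.
- exact: bmeas_cst.
Qed.

Hypothesis r61 : r <= 61 / 100.
Variable t : R.
Hypotheses (rt : r <= t) (tlt1 : t < 1).

Lemma saddlepoint_approx :
  `|E \1_[set w | x * sg < S w] - Theta x * m lam| <=
  ((224 / 100) * expR (t ^+ 2 / 2) / Num.sqrt (1 - t)
     + expR (t + t ^+ 2) / (Num.sqrt pi * (1 - t))) / sg * m lam.
Proof.
have r1 : r < 1 by exact: le_lt_trans rt tlt1.
have sg20 : 0 < sg ^+ 2 by rewrite exprn_gt0.
(* The bounds for single summands are proportional to [q i], or to [tmean i] where variances are
   compared; after summation they depend on [r] alone. *)
have tm : \sum_i tmean lam i = sg ^+ 2 * r by rewrite lamE xE; ring.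
pose s := Num.sqrt (\sum_i tvar lam i).
have s2 : s ^+ 2 = \sum_i tvar lam i.
  by rewrite sqr_sqrtr// sumr_ge0// => i _; exact: tvar_ge0.
have s_lo : sg ^+ 2 * (1 - r) <= s ^+ 2.
  rewrite mulrBr mulr1 -tm sg2 s2 -sumrB; apply: ler_sum => i _.
  exact: tvar_ge.
have s_hi : s ^+ 2 <= sg ^+ 2 * (1 + r).
  rewrite mulrDr mulr1 -tm sg2 s2 -big_split; apply: ler_sum => i _.
  exact: tvar_le.
have s0 : 0 < s.
  rewrite lt_neqAle sqrtr_ge0 andbT eq_sym; apply/eqP => s00.
  move: s_lo; rewrite s00 expr0n/= leNgt mulr_gt0// subr_gt0//.
have lam_lo : r <= expR lam - 1.
  rewrite -(ler_pM2l sg20) -tm sg2 mulr_suml; apply: ler_sum => i _.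
  exact: tmean_le.
have lam_hi : 1 - expR (- lam) <= r.
  rewrite -(ler_pM2l sg20) -tm sg2 mulr_suml; apply: ler_sum => i _.
  exact: tmean_ge.
have main := tilted_normal_approx mX X1 indep s0 s2 lam0.
have err := normal_error_le x0 sg0 lam0 s0 r0 xE r61 lam_lo lam_hi s_lo s_hi rt tlt1.
rewrite lamE in main.
have e0 := expR_gt0 (lam * (x * sg)).
have mA : measurable [set w | x * sg < S w].
  have := measurable_fun_ltr (@measurable_cst _ _ T R setT (x * sg)) bS.1.
  by move=> /(_ measurableT [set true])/=; rewrite setTI; apply.
(* On the event, [expR (- (a * Y))] with [a = lam * s] equals [expR (- (lam * (S - x * sg)))] and
   cancels the tilting weight up to a constant. This fixes the rate of [h]. *)
have hE : E (fun w => W lam w * hexp (lam * s) ((S w - x * sg) / s)) =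
    expR (lam * (x * sg)) * E \1_[set w | x * sg < S w].
  rewrite -ExZl; last exact: bmeas_ind.
  apply: eq_Ex => w; rewrite indicE /hexp pmulr_lgt0 ?invr_gt0// subr_gt0.
  have [h|h] := ltP (x * sg) (S w).
    rewrite mem_set// mulr1 /W -expRD; congr expR; field.
    by rewrite gt_eqF.
  by rewrite memNset ?mulr0//= => /(le_lt_trans h); rewrite ltxx.
have ME : E (W lam) = expR (lam * (x * sg)) * m lam.
  by rewrite mE mulrA -expRD subrr expR0 mul1r.
move: main; rewrite hE ME [X in _ <= X](mulrCA _ (expR (lam * (x * sg)))).
rewrite [X in `|_ - X|](mulrCA _ (expR (lam * (x * sg)))) -mulrBr normrM (gtr0_norm e0).
rewrite (ler_pM2l e0) => main.
have m0 : 0 < m lam by rewrite mE mulr_gt0 ?expR_gt0 ?Ex_W_gt0.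
apply: le_trans (ler_wpM2r (ltW m0) err).
rewrite (_ : _ - _ = (E \1_[set w | x * sg < S w] - Theta (lam * s) * m lam)
   + (Theta (lam * s) - Theta x) * m lam); last by ring.
apply: le_trans (ler_normD _ _) _; rewrite [X in _ <= X]mulrDl; apply: lerD => //.
by rewrite normrM (gtr0_norm m0).
Qed.
End saddlepoint.

(** * Hoeffding's bound *)

Section hoeffding_real.
Variable R : realType.
Implicit Types b y l v u : R.

Definition hslope b l := (1 - expR (- (l * b))) / b.
(** [- hcurv b l] is the derivative of [hslope b l] in [b]. *)
Definition hcurv b l := (1 - expR (- (l * b)) * (1 + l * b)) / b ^+ 2.

(* The convex function [y |-> (1 - expR (- (l * y))) / y] lies above its
   tangent at [b]. *)
Lemma hslope_tangent b y l : 0 < b -> 0 <= y -> 0 <= l ->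
  y * (hslope b l - (y - b) * hcurv b l) <= 1 - expR (- (l * y)).
Proof.
move=> b0 y0 l0; rewrite -subr_ge0.
(* Differentiating in [l] instead of [y] reduces the claim to the tangent inequality for [expR] and
   keeps [y = 0] admissible. *)
pose f u : R := 1 - expR (- (u * y)) -
  y * ((1 - expR (- (u * b))) / b - (y - b) * ((1 - expR (- (u * b)) * (1 + u * b)) / b ^+ 2)).
rewrite -[leRHS]/(f l) (_ : 0 = f 0); last first.
  by rewrite /f !mul0r !oppr0 expR0; ring.
apply: (@derive_ge0_le R f
  (fun u => y * (expR (- (u * y)) - expR (- (u * b)) * (1 - (y - b) * u)))) l0 _ _ => u.
  by move=> _; apply: is_derive_eq; rewrite /GRing.scale/=; field; rewrite gt_eqF.
move=> _; rewrite mulr_ge0// subr_ge0.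
have := expR_tangent (- (u * b)) (- (u * y)).
by rewrite (_ : - (u * y) - - (u * b) = - ((y - b) * u))//; ring.
Qed.

Lemma powR_expR (a : R) y : 0 < a -> a `^ y = expR (y * ln a).
Proof. by move=> a0; rewrite /powR gt_eqF. Qed.

Lemma Hoeffding_bound_ge0 (n : nat) (x s : R) : 0 <= Hoeffding_bound n x s.
Proof. by rewrite /Hoeffding_bound mulr_ge0 ?powR_ge0. Qed.

Lemma Hoeffding_boundE (n : nat) (x s v tau : R) : (0 < n)%N -> 0 < s ->
  s ^+ 2 = n%:R * v -> x * s = n%:R * tau -> 0 <= tau -> tau < 1 ->
  Hoeffding_bound n x s =
  expR (n%:R * (((tau + v) * ln (v / (tau + v)) + (1 - tau) * ln ((1 - tau)^-1)) / (1 + v))).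
Proof.
move=> n0 s0 s2 xs t0 t1.
have n0' : 0 < n%:R :> R by rewrite ltr0n.
have v0 : 0 < v by rewrite -(pmulr_rgt0 _ n0') -s2 exprn_gt0.
have tv0 : 0 < tau + v by rewrite ltr_wpDl.
have t1' : 0 < 1 - tau by rewrite subr_gt0.
have xs0 : x + s = n%:R * (tau + v) / s.
  by rewrite mulrDr -xs -s2; field; rewrite gt_eqF.
rewrite /Hoeffding_bound; have -> : s / (x + s) = v / (tau + v).
  rewrite xs0 invf_div mulrA -expr2 s2; field.
  by rewrite !gt_eqF.
have -> : n%:R / (n%:R - x * s) = (1 - tau)^-1.
  rewrite (_ : n%:R - x * s = n%:R * (1 - tau)); last by rewrite xs; ring.
  by rewrite invfM mulrA divff ?mul1r// gt_eqF.
have -> : n%:R / (n%:R + s ^+ 2) = (1 + v)^-1.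
  rewrite (_ : n%:R + s ^+ 2 = n%:R * (1 + v)); last by rewrite s2; ring.
  by rewrite invfM mulrA divff ?mul1r// gt_eqF.
rewrite (_ : (x <= n%:R / s) = true); last first.
  by rewrite ler_pdivlMr// xs -{2}(mulr1 n%:R) ler_wpM2l// ltW.
rewrite mulr1 xs s2 -mulrDr (_ : n%:R - n%:R * tau = n%:R * (1 - tau)); last by ring.
rewrite [_ `^ (_ * (tau + v))]powR_expR ?divr_gt0//.
rewrite [_ `^ (_ * (1 - tau))]powR_expR ?invr_gt0// -expRD powR_expR ?expR_gt0//.
by rewrite expRK; congr expR; ring.
Qed.
End hoeffding_real.

Section hoeffding.
Context d (T : measurableType d) (R : realType) (P : probability T R).
Variables (n : nat) (X : 'I_n -> T -> R).
Hypothesis mX : forall i, measurable_fun [set: T] (X i).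
Hypothesis X1 : forall i w, `|X i w| <= 1.
Hypothesis indep : mutually_independent P X.
Local Notation E := (Ex P).
Hypothesis X0 : forall i, E (X i) = 0.
Local Notation q i := (E (fun w => X i w ^+ 2)).
Local Notation S := (total X).
Local Notation W := (exp_total X).
Local Notation mgf := (mgf P X).

Let bX i : bmeas (X i) := bmeas_X mX X1 i.

Lemma Ex_expR_sum lam (s : seq 'I_n) : uniq s ->
  E (fun w => expR (lam * sumX X s w)) = \prod_(i <- s) mgf lam i.
Proof.
have bs (s' : seq 'I_n) : bmeas (sumX X s') by exact: bmeas_sum.
elim: s => [_|k s IHs /= /andP[ks us]].
  by rewrite big_nil -[RHS](Ex_cst P); apply: eq_Ex => w; rewrite /sumX big_nil mulr0 expR0.
have be : bmeas (fun w => expR (lam * sumX X s w)) by bmeas_tac.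
have bk : bmeas (fun w => expR (lam * X k w)) by bmeas_tac; exact: bX.
have [_ [Cf fC]] := be; have [_ [Cg gC]] := bk.
pose Psi (ux : R * R) := expR (lam * ux.1) * expR (lam * ux.2).
rewrite big_cons -IHs// [LHS](_ : _ = E (fun w => Psi (sumX X s w, X k w))); last first.
  by apply: eq_Ex => w; rewrite /Psi /sumX big_cons mulrDr expRD mulrC.
rewrite (@Ex_indep2 _ _ _ P _ _ Psi (Cf * Cg) (bs s).1 (mX k) _ _ (indep_sum_one mX indep us ks)).
- rewrite -[RHS]ExZr; last exact: bk.
  by apply: eq_Ex => z; rewrite /Psi /= ExZr// mulrC.
- apply: measurable_funM; apply: measurableT_comp; try exact: measurable_expR;
    by apply: measurable_funM; [exact: measurable_cst|].
by move=> w z; rewrite /Psi /= normrM ler_pM.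
Qed.

Lemma Ex_WE lam : E (W lam) = \prod_i mgf lam i.
Proof. by rewrite -Ex_expR_sum ?index_enum_uniq. Qed.

(** The tangent at [b = 1 + v], taken at [y = 1 - X i], integrates explicitly: [y] has mean [1] and
    [y * (y - b)] has mean [q i - v]. *)
Lemma mgf_hoeffding (v lam : R) i : 0 < v -> 0 <= lam ->
  mgf lam i <= expR lam * (1 - hslope (1 + v) lam + (q i - v) * hcurv (1 + v) lam).
Proof.
move=> v0 lam0; set k := hslope _ _; set I := hcurv _ _.
rewrite [leRHS](_ : _ = E (fun w => expR lam * (1 - k - v * I) * 1
   + expR lam * (k - (1 - v) * I) * X i w + expR lam * I * X i w ^+ 2)).
  apply: Ex_le => [||w]; [exact: bmeas_ew| by bmeas_tac; exact: bX|].
  have y0 : 0 <= 1 - X i w by have := X1 i w; rewrite ler_norml => /andP[_]; rewrite subr_ge0.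
  have v1 : 0 < 1 + v by rewrite addr_gt0.
  have := hslope_tangent v1 y0 lam0; rewrite -/k -/I => h.
  rewrite /exp_weight (_ : lam * X i w = lam + - (lam * (1 - X i w))); last by ring.
  rewrite expRD.
  have h2 : expR (- (lam * (1 - X i w))) <= 1 - (1 - X i w) * (k - (1 - X i w - (1 + v)) * I) by lra.
  apply: le_trans (ler_wpM2l (expR_ge0 lam) h2) _.
  by rewrite le_eqVlt; apply/orP; left; apply/eqP; ring.
rewrite Ex_lin3; [|by bmeas_tac; exact: bX..].
by rewrite X0 (Ex_cst P); ring.
Qed.

Lemma Ex_W_hoeffding (v lam : R) : 0 < v -> 0 <= lam -> \sum_i q i = n%:R * v ->
  E (W lam) <= (expR lam * (1 - hslope (1 + v) lam)) ^+ n.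
Proof.
move=> v0 lam0 qv; rewrite Ex_WE.
have v1 : 0 < 1 + v by rewrite addr_gt0.
set k := hslope _ _; pose I := hcurv (1 + v) lam.
have k0 : 0 < 1 - k.
  rewrite subr_gt0 /k /hslope ltr_pdivrMr// mul1r.
  by have := expR_gt0 (- (lam * (1 + v))); lra.
have A0 : 0 < expR lam * (1 - k) by rewrite mulr_gt0 ?expR_gt0.
(* [1 + z <= expR z] turns the first-order corrections into exponentials, whose product is [1]
   because the [q i - v] sum to [0]. *)
apply: (@le_trans _ _ (\prod_i (expR lam * (1 - k) * expR ((q i - v) * (I / (1 - k)))))).
  apply: ler_prod => i _; apply/andP; split; first exact/ltW/mgf_gt0.
  apply: le_trans (mgf_hoeffding i v0 lam0) _; rewrite -/k -/I -mulrA ler_wpM2l ?expR_ge0//.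
  have := ler_wpM2l (ltW k0) (expR_ge1Dx ((q i - v) * (I / (1 - k)))).
  apply: le_trans; rewrite le_eqVlt; apply/orP; left; apply/eqP.
  by field; rewrite gt_eqF.
rewrite big_split/= prodr_const card_ord -expR_sum -mulr_suml sumrB qv.
by rewrite sumr_const card_ord -[v *+ n]mulr_natl subrr mul0r expR0 mulr1.
Qed.

Lemma mgf_le_Hoeffding (x sg : R) : (0 < n)%N -> 0 < sg -> sg ^+ 2 = \sum_i q i ->
  0 <= x -> x * sg < n%:R ->
  exists2 l : R, 0 <= l &
    E (fun w => expR (l * (S w - x * sg))) <= Hoeffding_bound n x sg.
Proof.
move=> n0 sg0 sg2 x0 xn.
have n0' : 0 < n%:R :> R by rewrite ltr0n.
pose v := sg ^+ 2 / n%:R; pose tau := x * sg / n%:R.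
have v0 : 0 < v by rewrite divr_gt0// exprn_gt0.
have t0 : 0 <= tau by rewrite divr_ge0 ?mulr_ge0// ltW.
have t1 : tau < 1 by rewrite ltr_pdivrMr// mul1r.
have vE : sg ^+ 2 = n%:R * v by rewrite mulrC divfK// gt_eqF.
have tE : x * sg = n%:R * tau by rewrite [RHS]mulrC divfK// gt_eqF.
have v1 : 0 < 1 + v by rewrite addr_gt0.
have tv0 : 0 < tau + v by rewrite ltr_wpDl.
have t1' : 0 < 1 - tau by rewrite subr_gt0.
pose A := ln (v / (tau + v)); pose B := ln (1 - tau)^-1.
have A0 : A <= 0 by rewrite ln_le0// ler_pdivrMr// mul1r lerDr.
have B0 : 0 <= B by rewrite ln_ge0// invf_ge1// gerBl.
(* The minimizer of [(1 - tau) * l + ln (1 - hslope (1 + v) l)]; there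
   [1 - hslope (1 + v) l = expR A]. *)
pose l := (B - A) / (1 + v).
have l0 : 0 <= l by rewrite divr_ge0 ?(ltW v1)// subr_ge0 (le_trans A0).
have eA : expR A = v / (tau + v) by rewrite lnK// posrE divr_gt0.
have eB : expR B = (1 - tau)^-1 by rewrite lnK// posrE invr_gt0.
exists l => //.
rewrite (Hoeffding_boundE n0 sg0 vE tE t0 t1) -/A -/B.
rewrite [leLHS](_ : _ = expR (- (l * (x * sg))) * E (W l)); last first.
  rewrite -ExZl; last exact: bmeas_W.
  by apply: eq_Ex => w; rewrite /W -expRD; congr expR; ring.
have qv : \sum_i q i = n%:R * v by rewrite -sg2.
apply: le_trans (ler_wpM2l (expR_ge0 _) (Ex_W_hoeffding v0 l0 qv)) _.
have el : expR (- (l * (1 + v))) = (1 - tau) * v / (tau + v).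
  rewrite /l divfK ?gt_eqF// opprB addrC -[- B + A]/(- B + A).
  by rewrite expRD expRN eA eB invrK; ring.
have -> : 1 - hslope (1 + v) l = expR A.
  rewrite /hslope el eA; field; by rewrite !gt_eqF.
rewrite -expRD -expRM_natl -expRD le_eqVlt; apply/orP; left; apply/eqP; congr expR.
by rewrite tE /l; field; rewrite gt_eqF.
Qed.
End hoeffding.

(** * Numerical bounds for [t_of] and [c_of] *)

Section c_of_bounds.
Variable R : realType.
Implicit Types x s r u v : R.

Lemma sqr_mono u v : 0 <= u -> u <= v -> u ^+ 2 <= v ^+ 2.
Proof. by move=> u0 uv; rewrite lerXn2r// nnegrE// (le_trans u0). Qed.

Lemma expRB1_le u : (1 - u) * expR u <= 1.
Proof.
have := ler_wpM2r (expR_ge0 u) (expR_ge1Dx (- u)).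
by rewrite -expRD addNr expR0.
Qed.

Lemma t_ofE x s : 0 < s -> t_of x s = x / s * expR (expR 1 * (x / s) ^+ 2 / 2).
Proof. by move=> s0; rewrite /t_of; congr (_ * expR _); field; rewrite gt_eqF. Qed.

Lemma t_of_ge x s : 0 <= x -> 0 < s -> x / s <= t_of x s.
Proof.
move=> x0 s0; rewrite t_ofE// -[leLHS]mulr1 ler_wpM2l ?divr_ge0 ?(ltW s0)//.
by rewrite -expR0 ler_expR divr_ge0// mulr_ge0 ?expR_ge0 ?sqr_ge0.
Qed.

(** At [r = 0.61] the exponent exceeds [1 / 2], and [0.61 * (41 / 32) ^+ 2 > 1], where [41 / 32] is
    the quadratic Taylor value of [expR (1 / 4)]. This supplies the range of [r] used in the error
    budget. *)
Lemma t_of_lt1_ratio x s : 0 <= x -> 0 < s -> t_of x s < 1 -> x / s <= 61 / 100.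
Proof.
move=> x0 s0; rewrite t_ofE//.
have r0 : 0 <= x / s by rewrite divr_ge0// ltW.
move: (x / s) r0 => r r0 t1; rewrite leNgt; apply/negP => h.
have /andP[e1 _] := expR1_bounds R.
have r2 : (61 / 100) ^+ 2 <= r ^+ 2.
  by apply: sqr_mono; [clear; lra|exact: ltW].
have er : 1 / 2 <= expR 1 * r ^+ 2 / 2.
  have : 0 <= (expR 1 - 27 / 10) * r ^+ 2 by rewrite mulr_ge0 ?subr_ge0 ?sqr_ge0.
  clear -r2; lra.
have ee : (41 / 32) ^+ 2 <= expR (expR 1 * r ^+ 2 / 2).
  apply: (@le_trans _ _ (expR (1 / 2))); last by rewrite ler_expR.
  have q0 : 0 <= 1 / 4 :> R by clear; lra.
  have := expR_ge_deg2 q0; set v := expR (1 / 4) => v1.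
  rewrite (_ : expR (1 / 2) = v ^+ 2); last first.
    by rewrite /v -expRM_natl; congr expR; field.
  by apply: sqr_mono; clear -v1; lra.
move: t1 ee; set E := expR (_ / 2) => t1 ee.
have : 0 <= (r - 61 / 100) * (E - (41 / 32) ^+ 2) by rewrite mulr_ge0 ?subr_ge0 ?(ltW h).
clear -h t1 ee; lra.
Qed.

(** There is little room: [e <= 2.72] keeps the exponent below [1 / 2], [expR (1 / 2) <= 1.65], and
    [0.606 * 1.65 = 0.9999]. *)
Lemma t_of_lt1 x s : 0 <= x -> 0 < s -> x <= 606 / 1000 * s -> t_of x s < 1.
Proof.
move=> x0 s0 xs; rewrite t_ofE//.
have r0 : 0 <= x / s by rewrite divr_ge0// ltW.
have : x / s <= 606 / 1000 by rewrite ler_pdivrMr.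
move: (x / s) r0 => r r0 r1.
have /andP[_ e1] := expR1_bounds R; have e0 := expR_gt0 (1 : R).
have r2 : r ^+ 2 <= (606 / 1000) ^+ 2.
  exact: sqr_mono.
have er : expR 1 * r ^+ 2 / 2 <= 1 / 2.
  have : 0 <= (272 / 100 - expR 1) * r ^+ 2 by rewrite mulr_ge0 ?subr_ge0 ?sqr_ge0.
  clear -r2; lra.
have ee : expR (expR 1 * r ^+ 2 / 2) <= 165 / 100.
  apply: (@le_trans _ _ (expR (1 / 2))); first by rewrite ler_expR.
  rewrite leNgt; apply/negP => h.
  have : expR 1 = expR (1 / 2) ^+ 2 :> R by rewrite -expRM_natl; congr expR; field.
  have : 0 < (expR (1 / 2) - 165 / 100) * (expR (1 / 2) + 165 / 100) :> R.
    by apply: mulr_gt0; clear -h; lra.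
  clear -e1; lra.
move: ee; set E := expR (_ / 2) => ee.
have : 0 <= r * (165 / 100 - E) by rewrite mulr_ge0 ?subr_ge0.
clear -r1; lra.
Qed.

Lemma inv_sqrt_pi_le : (Num.sqrt pi)^-1 <= 77 / 136 :> R.
Proof.
have /andP[pl _] := pi_bounds R; have p0 := @pi_gt0 R.
have s0 : 0 < Num.sqrt pi :> R by rewrite sqrtr_gt0.
have s2 := sqr_sqrtr (ltW p0).
rewrite -[leLHS]mul1r (ler_pdivrMr _ _ s0) leNgt; apply/negP => h.
have : 0 < (1 - 77 / 136 * Num.sqrt pi) * (77 / 136 * Num.sqrt pi + 1) :> R.
  apply: mulr_gt0; lra.
move: s2; set s := Num.sqrt pi => s2; lra.
Qed.

(** [17 / 1250 = 2.72 * 0.01 / 2] bounds the exponent, and [22 / 217] rounds up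
    [(1 / 10) / (1 - 17 / 1250)]. *)
Lemma t_of_le x s : 0 <= x -> 0 < s -> x <= 1 / 10 * s -> t_of x s <= 22 / 217.
Proof.
move=> x0 s0 xs; rewrite t_ofE//.
have r0 : 0 <= x / s by rewrite divr_ge0// ltW.
have : x / s <= 1 / 10 by rewrite ler_pdivrMr.
move: (x / s) r0 => r r0 r1.
have /andP[_ e1] := expR1_bounds R; have e0 := expR_gt0 (1 : R).
have r2 : r ^+ 2 <= (1 / 10) ^+ 2.
  exact: sqr_mono.
have er : expR 1 * r ^+ 2 / 2 <= 17 / 1250.
  have : 0 <= (272 / 100 - expR 1) * r ^+ 2 by rewrite mulr_ge0 ?subr_ge0 ?sqr_ge0.
  clear -r2; lra.
have ee : expR (expR 1 * r ^+ 2 / 2) <= expR (17 / 1250) by rewrite ler_expR.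
have := expRB1_le (17 / 1250); move: ee; set E' := expR (17 / 1250); set E := expR (_ / 2) => ee e'.
have E0 : 0 < E by exact: expR_gt0.
have : 0 <= (1 / 10 - r) * E by rewrite mulr_ge0 ?subr_ge0 ?(ltW E0).
clear -ee e'; lra.
Qed.

(** All factors increase with [t], which is at most [22 / 217]; the rational bounds for them combine
    to about [3.0798]. *)
Lemma c_of_le x s : 0 <= x -> 0 < s -> x <= 1 / 10 * s ->
  (c_of x s <= (308 / 100)%:E)%E.
Proof.
move=> x0 s0 xs; have tle := t_of_le x0 s0 xs.
have t0 : 0 <= t_of x s by apply: le_trans (t_of_ge x0 s0); rewrite divr_ge0// ltW.
rewrite /c_of; move: (t_of x s) t0 tle => t t0 tle.
rewrite ifT; last lra.
rewrite lee_fin.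
have t2 : t ^+ 2 <= (22 / 217) ^+ 2.
  exact: sqr_mono.
have e1 : expR (t ^+ 2 / 2) <= 194 / 193.
  have := expRB1_le (t ^+ 2 / 2); have := expR_gt0 (t ^+ 2 / 2).
  set E := expR _ => E0 e.
  have : 0 <= ((22 / 217) ^+ 2 - t ^+ 2) * E by rewrite mulr_ge0 ?subr_ge0 ?(ltW E0).
  clear -E0 e; lra.
have e2 : expR (t + t ^+ 2) <= 123 / 110.
  apply: (@le_trans _ _ (expR (67 / 600))); first by rewrite ler_expR; clear -t2 tle; lra.
  have q0 : 0 <= 67 / 600 :> R by clear; lra.
  have := expRN_ge_deg3 q0; have := expR_gt0 (67 / 600 : R).
  have : expR (67 / 600) * expR (- (67 / 600)) = 1 :> R by rewrite -expRD subrr expR0.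
  set E := expR (67 / 600); set F := expR _ => EF E0 F0.
  have : 0 <= (F - 110 / 123) * E.
    by apply: mulr_ge0; [clear -F0; lra|exact: ltW].
  clear -EF; lra.
have t1 : 0 < 1 - t by clear -tle; lra.
have q0 : 0 < Num.sqrt (1 - t) by rewrite sqrtr_gt0.
have q2 := sqr_sqrtr (ltW t1).
have iq : (Num.sqrt (1 - t))^-1 <= 96 / 91.
  rewrite -[leLHS]mul1r (ler_pdivrMr _ _ q0) leNgt; apply/negP => h.
  move: q2 q0 h; set q := Num.sqrt _ => q2 q0 h.
  have : 0 < (1 - 96 / 91 * q) * (1 + 96 / 91 * q) by apply: mulr_gt0; clear -q0 h; lra.
  clear -tle q2; lra.
have it : (1 - t)^-1 <= 217 / 195.
  rewrite -[leLHS]mul1r (ler_pdivrMr _ _ t1); clear -tle; lra.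
have ip := inv_sqrt_pi_le; have ip0 : 0 <= (Num.sqrt pi)^-1 :> R by rewrite invr_ge0 sqrtr_ge0.
rewrite invfM.
have iq0 : 0 <= (Num.sqrt (1 - t))^-1 by rewrite invr_ge0 ltW.
have it0 : 0 <= (1 - t)^-1 by rewrite invr_ge0 ltW.
have e20 := expR_ge0 (t + t ^+ 2); have e10 := expR_ge0 (t ^+ 2 / 2).
have h1 := ler_pM e10 iq0 e1 iq.
have h2 := ler_pM ip0 it0 ip it.
have h3 := ler_pM e20 (mulr_ge0 ip0 it0) e2 h2.
clear -h1 h3; lra.
Qed.
End c_of_bounds.

(** * The expansion for bounded summands *)

Definition c_fin (R : realType) (t : R) : R :=
  (224 / 100) * expR (t ^+ 2 / 2) / Num.sqrt (1 - t)
  + expR (t + t ^+ 2) / (Num.sqrt pi * (1 - t)).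

Section bounded_case.
Context d (T : measurableType d) (R : realType) (P : probability T R).
Variables (n : nat) (X : 'I_n -> T -> R).
Hypothesis mX : forall i, measurable_fun [set: T] (X i).
Hypothesis X1 : forall i w, `|X i w| <= 1.
Hypothesis indep : mutually_independent P X.
Local Notation E := (Ex P).
Hypothesis X0 : forall i, E (X i) = 0.
Local Notation S := (total X).
Variables (sg : R).
Hypotheses (sg0 : 0 < sg) (sg2 : sg ^+ 2 = \sum_i E (fun w => X i w ^+ 2)).
Local Notation m x l := (E (fun w => expR (l * (S w - x * sg)))).
Local Notation pr x := (E \1_[set w | x * sg < S w]).
Local Notation c t := (c_fin t).

Let bS : bmeas S := bmeas_S mX X1.

Lemma tail_measurable a : measurable [set w | a < S w].
Proof.
have := measurable_fun_ltr (@measurable_cst _ _ T R setT a) bS.1.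
by move=> /(_ measurableT [set true])/=; rewrite setTI; apply.
Qed.

Lemma tail_approx x : 0 <= x -> t_of x sg < 1 ->
  exists lam, [/\ 0 <= lam, forall l, m x lam <= m x l, 0 < m x lam &
    `|pr x - Theta x * m x lam| <= c (t_of x sg) / sg * m x lam].
Proof.
move=> x0 t1; have rt := t_of_ge x0 sg0.
have r0 : 0 <= x / sg by rewrite divr_ge0// ltW.
have xE : x = x / sg * sg by rewrite divfK// gt_eqF.
have r61 := t_of_lt1_ratio x0 sg0 t1.
have [lam lam0 lamE] := saddlepoint_exists mX X1 indep X0 sg0 sg2 x0 r0 xE (le_lt_trans rt t1).
exists lam; split; first exact: lam0.
- by move=> l; exact: saddlepoint_inf.
- rewrite (_ : m x lam = expR (- (lam * (x * sg))) * E (exp_total X lam)).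
    by rewrite mulr_gt0 ?expR_gt0 ?Ex_W_gt0.
  rewrite -ExZl; last exact: bmeas_W.
  by apply: eq_Ex => w; rewrite /exp_total -expRD; congr expR; ring.
exact: (saddlepoint_approx mX X1 indep X0 sg0 sg2 x0 r0 xE lam0 lamE r61 rt t1).
Qed.

Lemma chernoff x l : 0 <= l -> pr x <= m x l.
Proof.
move=> l0; apply: Ex_le; first exact/bmeas_ind/tail_measurable.
  by apply: bmeas_expR; apply: bmeasM; [exact: bmeas_cst|apply: bmeasB => //; exact: bmeas_cst].
move=> w; rewrite indicE; have [h|h] := ltP (x * sg) (S w).
  rewrite mem_set// -expR0 ler_expR mulr_ge0// subr_ge0; exact: ltW.
by rewrite memNset ?expR_ge0//= => /(le_lt_trans h); rewrite ltxx.
Qed.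

Lemma c_fin_gt0 (t : R) : t < 1 -> 0 < c t.
Proof.
move=> t1; have t1' : 0 < 1 - t by rewrite subr_gt0.
rewrite /c_fin; apply: addr_gt0; last by rewrite divr_gt0 ?expR_gt0// mulr_gt0// sqrtr_gt0 pi_gt0.
rewrite -mulrA; apply: mulr_gt0; first lra.
by rewrite divr_gt0 ?expR_gt0// sqrtr_gt0.
Qed.

Lemma Theta_ge0 (x : R) : 0 <= x -> 0 <= Theta x.
Proof.
by move=> x0; rewrite ThetaE divr_ge0 ?mills_ge0// mulr_ge0// ltW// mills0_gt0.
Qed.

Lemma tail_bound x : (0 < n)%N -> 0 <= x -> pr x <= Hoeffding_bound n x sg /\
  (t_of x sg < 1 -> pr x <= (Theta x + c (t_of x sg) / sg) * Hoeffding_bound n x sg).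
Proof.
move=> n0 x0; have H0 := Hoeffding_bound_ge0 n x sg.
have fac0 : t_of x sg < 1 -> 0 <= Theta x + c (t_of x sg) / sg.
  by move=> t1; rewrite addr_ge0 ?Theta_ge0// divr_ge0 ?(ltW sg0)// ltW// c_fin_gt0.
(* The sum never exceeds [n], so the tail is empty in the first case. It includes [x * sg = n],
   where the logarithmic form of the bound breaks down. *)
have [nx|xn] := leP n%:R (x * sg).
  have -> : pr x = 0.
    rewrite -[RHS](Ex_cst P); apply: eq_Ex => w; rewrite indicE memNset//=.
    apply/negP; rewrite -leNgt; apply: le_trans nx.
    rewrite -[n in n%:R]card_ord -sumr_const; apply: ler_sum => i _.
    exact: le_trans (ler_norm _) (X1 _ _).
  by split=> [//|t1]; rewrite mulr_ge0// fac0.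
have [l l0 lH] := mgf_le_Hoeffding mX X1 indep X0 n0 sg0 sg2 x0 xn.
split; first exact: le_trans (chernoff x l0) lH.
move=> t1; have [lam [lam0 minf m0 err]] := tail_approx x0 t1.
apply: (@le_trans _ _ ((Theta x + c (t_of x sg) / sg) * m x lam)); last first.
  by apply: ler_wpM2l; [exact: fac0|exact: le_trans (minf l) lH].
rewrite mulrDl addrC -lerBlDr; exact: le_trans (ler_norm _) err.
Qed.
End bounded_case.

(** * From almost sure to everywhere bounded summands *)

Section truncation.
Context d (T : measurableType d) (R : realType) (P : probability T R).

(** The bound on the summands is only assumed almost everywhere. Clamping makes it hold everywhere,
    changes each summand on a null set only, and preserves independence, since preimages under
    [clamp] are measurable. *)
Definition clamp (x : R) : R := Num.max (-1) (Num.min x 1).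

Lemma clamp_norm x : `|clamp x| <= 1.
Proof.
rewrite ler_norml /clamp le_max lexx /= ge_max ge_min lexx orbT andbT.
by rewrite -subr_ge0 opprK addr_ge0.
Qed.

Lemma clamp_id x : `|x| <= 1 -> clamp x = x.
Proof.
by rewrite ler_norml => /andP[x0 x1]; rewrite /clamp (min_idPl x1) (max_idPr x0).
Qed.

Lemma measurable_clamp : measurable_fun [set: R] clamp.
Proof.
apply: measurable_maxr; first exact: measurable_cst.
by apply: measurable_minr => //; exact: measurable_cst.
Qed.

Lemma expectation_ae (f g : T -> R) : measurable_fun [set: T] f -> bmeas g ->
  {ae P, forall w, f w = g w} -> 'E_P[f]%E = (Ex P g)%:E.
Proof.
move=> mf bg fg; rewrite -Ex_EFin// unlock.
apply: ae_eq_integral => //; [exact/measurable_EFinP|exact/measurable_EFinP/bg.1|].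
by apply: filterS fg => w /= -> _.
Qed.

Lemma probability_ae (A B : set T) : measurable A -> measurable B ->
  {ae P, forall w, A w <-> B w} -> P A = (Ex P \1_B)%:E.
Proof.
move=> mA mB AB; rewrite -(@expectation_ae \1_A); last 2 first.
- exact: bmeas_ind.
- apply: filterS AB => w h; rewrite !indicE (_ : (w \in A) = (w \in B))//.
  by apply/idP/idP; rewrite !inE => /h.
- by rewrite unlock integral_indic// setIT.
- exact: measurable_indic.
Qed.
End truncation.

Section transfer.
Context d (T : measurableType d) (R : realType) (P : probability T R).
Variables (n : nat) (xi : 'I_n -> {RV P >-> R}).
Hypothesis n_gt0 : (0 < n)%N.
Hypothesis indep : mutually_independent P (fun i => xi i : T -> R).
Hypothesis nondeg : forall i, nondegenerate_rv P (xi i).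
Hypothesis centered : forall i, ('E_P[xi i] = 0)%E.
Hypothesis bounded : forall i, {ae P, forall w, `|xi i w| <= 1}.

Definition truncated i w := clamp (xi i w).
Local Notation X := truncated.
Local Notation sigma := (sigma_of P (fun i => xi i : T -> R)).
Local Notation sum_xi := (partial_sum (fun i => xi i : T -> R)).
Local Notation E := (Ex P).

Lemma measurable_truncated i : measurable_fun [set: T] (X i).
Proof. by apply: measurableT_comp; [exact: measurable_clamp|exact: measurable_funPT]. Qed.

Lemma truncated_norm i w : `|X i w| <= 1.
Proof. exact: clamp_norm. Qed.

Let mX := measurable_truncated.
Let X1 := truncated_norm.
Let bX i : bmeas (X i) := bmeas_X mX X1 i.
Let bS : bmeas (total X) := bmeas_S mX X1.

Lemma truncated_ae i : {ae P, forall w, xi i w = X i w}.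
Proof. by apply: filterS (bounded i) => w h; rewrite /truncated clamp_id. Qed.

Lemma truncated_sum_ae : {ae P, forall w, sum_xi w = total X w}.
Proof.
have h0 : \forall w \near (almost_everywhere P), forall i, xi i w = X i w.
  by apply: filter_forall; exact: truncated_ae.
apply: filterS h0 => w h.
by apply: eq_bigr => i _; exact: h.
Qed.

Lemma truncated_indep : mutually_independent P X.
Proof.
move=> J A mA; apply: (indep J (A := fun i => @clamp R @^-1` A i)) => i.
by rewrite -[X in measurable X]setTI; exact: measurable_clamp.
Qed.

Lemma truncated_centered i : E (X i) = 0.
Proof.
apply: EFin_inj; rewrite -(@expectation_ae d T R P (xi i))//.
exact: truncated_ae.
Qed.

Lemma truncated_sq i : 'E_P[fun w => (xi i w ^+ 2)%R]%E = (E (fun w => X i w ^+ 2))%:E.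
Proof.
apply: expectation_ae; [|exact: bmeasX|].
  by apply: measurable_funX; exact: measurable_funPT.
by apply: filterS (truncated_ae i) => w /= ->.
Qed.

Let q_ge0 i : 0 <= E (fun w => X i w ^+ 2).
Proof. by apply: Ex_ge0 => w; exact: sqr_ge0. Qed.

Lemma sigma_sq : sigma ^+ 2 = \sum_i E (fun w => X i w ^+ 2).
Proof.
rewrite /sigma_of; under eq_bigr do rewrite truncated_sq /=.
by rewrite sqr_sqrtr// sumr_ge0.
Qed.

(** If [sigma] vanished, so would the second moment of the summand of index [0], which exists since
    [n > 0]; that summand would be almost surely [0], against non-degeneracy. *)
Lemma sigma_gt0 : 0 < sigma.
Proof.
rewrite lt_neqAle sqrtr_ge0 andbT eq_sym; apply/eqP => s0.
have := sigma_sq; rewrite s0 expr0n /= => /esym/eqP.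
rewrite psumr_eq0// => /allP /(_ (Ordinal n_gt0)); rewrite mem_index_enum => /(_ isT)/eqP.
set i := Ordinal n_gt0 => qi0; apply: (nondeg (i := i)); exists 0.
have : (\int[P]_w `|((X i w ^+ 2)%:E)| = 0)%E.
  rewrite -[RHS]/((0:R)%:E) -qi0 -Ex_EFin; last exact: bmeasX.
  by apply: eq_integral => w _; rewrite /= ger0_norm// sqr_ge0.
have mXX : measurable_fun [set: T] (fun w => (X i w ^+ 2)%:E).
  by apply/measurable_EFinP; exact: (bmeasX 2 (bX i)).1.
move/(ae_eq_integral_abs P measurableT mXX) => XX0.
apply: filterS2 XX0 (truncated_ae i) => w /= /(_ I) [] /eqP.
by rewrite sqrf_eq0 => /eqP X0 ->.
Qed.

Let mS : measurable_fun [set: T] sum_xi.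
Proof. by apply: measurable_sum => i; exact: measurable_funPT. Qed.

Lemma truncated_tail a :
  P [set w | a < sum_xi w] = (E \1_[set w | a < total X w])%:E.
Proof.
apply: probability_ae; last by apply: filterS truncated_sum_ae => w /= ->.
  have := measurable_fun_ltr (@measurable_cst _ _ T R setT a) mS.
  by move=> /(_ measurableT [set true])/=; rewrite setTI; apply.
exact: (tail_measurable mX X1).
Qed.

Lemma truncated_exp_moment l a :
  'E_P[fun w => expR (l * (sum_xi w - a))%R]%E =
  (E (fun w => expR (l * (total X w - a))))%:E.
Proof.
apply: expectation_ae; last by apply: filterS truncated_sum_ae => w /= ->.
  apply: measurableT_comp; first exact: measurable_expR.
  by apply: measurable_funM => //; apply: measurable_funB.
by apply: bmeas_expR; apply: bmeasM; [exact: bmeas_cst|apply: bmeasB => //; exact: bmeas_cst].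
Qed.

Lemma inf_exp_momentE lam a : 0 <= lam ->
  (forall l, E (fun w => expR (lam * (total X w - a))) <= E (fun w => expR (l * (total X w - a)))) ->
  inf_exp_moment P sum_xi a = (E (fun w => expR (lam * (total X w - a))))%:E.
Proof.
move=> lam0 lam_min; apply/eqP; rewrite eq_le; apply/andP; split.
  by apply: ereal_inf_lbound; exists lam => //; rewrite truncated_exp_moment.
apply: le_ereal_inf_tmp => _ [l _ <-].
by rewrite truncated_exp_moment lee_fin.
Qed.

Lemma c_ofE (x s : R) : t_of x s < 1 -> c_of x s = (c_fin (t_of x s))%:E.
Proof. by move=> t1; rewrite /c_of t1. Qed.

Let tail_approx_X := tail_approx mX X1 truncated_indep truncated_centered sigma_gt0 sigma_sq.
Let tail_bound_X := tail_bound mX X1 truncated_indep truncated_centered sigma_gt0 sigma_sq.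

Lemma saddlepoint_expansion x : 0 <= x -> x <= 606 / 1000 * sigma ->
  exists theta : R, `|theta| <= 1 /\
    P [set w | x * sigma < sum_xi w] =
    (((Theta x)%:E + theta%:E * (c_of x sigma * (sigma^-1)%:E))
      * inf_exp_moment P sum_xi (x * sigma))%E.
Proof.
move=> x0 xs; have t1 := t_of_lt1 x0 sigma_gt0 xs.
have [lam [lam0 lam_min m0 err]] := tail_approx_X x0 t1.
rewrite (inf_exp_momentE lam0 lam_min) truncated_tail (c_ofE t1).
move: (E \1_ _) (E (fun w => _)) m0 err => p m m0 err.
have k0 : 0 < c_fin (t_of x sigma) / sigma by rewrite divr_gt0 ?c_fin_gt0 ?sigma_gt0.
move: k0 err; rewrite -EFinM; move: (c_fin _ / sigma) => k k0 err.
(* The value forced by the identity; [err] divided by the positive [k * m] bounds it by [1]. *)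
exists ((p / m - Theta x) / k); split.
  rewrite normrM normfV (gtr0_norm k0) ler_pdivrMr// mul1r.
  rewrite -(ler_pM2r m0) -[X in _ * X <= _](gtr0_norm m0) -normrM.
  by rewrite mulrBl divfK// gt_eqF.
transitivity ((Theta x + (p / m - Theta x) / k * k) * m)%:E; last by [].
by congr EFin; rewrite divfK ?gt_eqF// subrKC divfK// gt_eqF.
Qed.

Lemma hoeffding_improvement x : 0 <= x ->
  (P [set w | (x * sigma < sum_xi w)%R] <=
     mine ((Theta x)%:E + c_of x sigma * (sigma^-1)%:E) 1
     * (Hoeffding_bound n x sigma)%:E)%E.
Proof.
move=> x0; rewrite truncated_tail.
have [b1 b2] := tail_bound_X n_gt0 x0.
have [t1|t1] := ltP (t_of x sigma) 1; last first.
  (* Here [c_of] is [+oo], so the minimum is [1] and the plain Hoeffding bound [b1] is what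
     remains. *)
  rewrite /c_of ifF; last by rewrite ltNge t1.
  rewrite gt0_mulye ?lte_fin ?invr_gt0 ?sigma_gt0// addey//.
  by rewrite /Order.min ltNge leey mul1e lee_fin.
rewrite (c_ofE t1) -EFinM -EFinD -EFin_min -EFinM lee_fin.
by rewrite /Order.min; case: ifP => _; rewrite ?mul1r ?b1 ?b2.
Qed.
End transfer.

Unset Implicit Arguments.

Theorem theorem3 (d : measure_display) (T : measurableType d) (R : realType)
    (P : probability T R) (n : nat) (xi : 'I_n -> {RV P >-> R})
    (n_gt0 : (0 < n)%N)
    (indep : mutually_independent P (fun i => xi i : T -> R))
    (nondeg : forall i, nondegenerate_rv P (xi i))
    (centered : forall i, ('E_P[xi i] = 0)%E)
    (bounded : forall i, {ae P, forall w, `|xi i w| <= 1}) :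
  let S := partial_sum (fun i => xi i : T -> R) in
  let sigma := sigma_of P (fun i => xi i : T -> R) in
  [/\ forall x : R, 0 <= x -> x <= 606 / 1000 * sigma ->
        exists theta : R, `|theta| <= 1 /\
          P [set w | x * sigma < S w] =
            (((Theta x)%:E + theta%:E * (c_of x sigma * (sigma^-1)%:E))
             * inf_exp_moment P S (x * sigma))%E,
      forall x : R, 0 <= x ->
        (P [set w | (x * sigma < S w)%R] <=
           mine ((Theta x)%:E + c_of x sigma * (sigma^-1)%:E) 1
           * (Hoeffding_bound n x sigma)%:E)%E
    & forall x : R, 0 <= x -> x <= 1 / 10 * sigma ->
        (c_of x sigma <= (308 / 100)%:E)%E].
Proof.
move=> S sigma; split=> x x0.
- exact: saddlepoint_expansion.
- exact: hoeffding_improvement.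
- exact: c_of_le (sigma_gt0 n_gt0 nondeg bounded).
Qed.
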